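(* There are constants $c, d_0>0$ for which the following holds. Let $d\ge d_0$ be an integer, let $L\ge 4$ be an even integer, let $\lambda$ be a real number with $\lambda\ge c\,d^{-1/4}\log^{3/4}d$, and let $\rho\ge0$ be a real number satisfying $$\rho+\frac{1}{2d^{1/2}}\le\frac{\lambda}{1+\lambda}$$ and $$H\left(\frac{1}{2d^{1/2}}\right)+H\left(\rho+\frac{1}{2d^{1/2}}\right)+\left(\frac{1}{d^{1/2}}+\rho\right)\log_2\lambda+\frac{10}{d^4L\log^2L}\le\log_2(1+\lambda).$$ Then $$\pi_\lambda(\mathcal{I}_{b,\rho})\ \le\ \exp\left\{-\frac{2L^{d-1}}{d^4\log^2L}\right\}.$$
   Context: For $L$ even, $T_{L,d}$ (the even discrete torus) is the graph on vertex set $\{0,\dots,L-1\}^d$ in which two vertices are adjacent if they differ on exactly one coordinate and differ by $1\pmod L$ on that coordinate. It is bipartite with classes $\mathcal{E}$ (vertices whose coordinate sum is even) and $\mathcal{O}$ (vertices whose coordinate sum is odd). $\mathcal{I}(T_{L,d})$ is the set of independent sets of $T_{L,d}$. For $\lambda>0$ the hard-core measure $\pi_\lambda$ on $\mathcal{I}(T_{L,d})$ is given by $\pi_\lambda(\{I\})=\lambda^{|I|}/Z_\lambda$ with $Z_\lambda=\sum_{I\in\mathcal{I}(T_{L,d})}\lambda^{|I|}$. The set of balanced independent sets is $$\mathcal{I}_{b,\rho}=\{I\in\mathcal{I}(T_{L,d}):\ \big||I\cap\mathcal{E}|-|I\cap\mathcal{O}|\big|\le\rho L^d/2\}.$$ $H(\alpha)=-\alpha\log_2\alpha-(1-\alpha)\log_2(1-\alpha)$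 is the binary entropy function; $\log$ is the natural logarithm. *)

(* Defs.v *)
From HB Require Import structures.
From mathcomp Require Import all_boot all_order all_algebra.
From mathcomp Require Import reals sequences exp.

Set Implicit Arguments.
Unset Strict Implicit.
Unset Printing Implicit Defensive.

Import Order.TTheory GRing.Theory Num.Theory.
Local Open Scope ring_scope.

Section HardCore.
Variables (T : finType) (e : rel T).

Definition independent (I : {set T}) : bool :=
  [forall x in I, forall y in I, ~~ e x y].

Definition indep_sets : {set {set T}} := [set I | independent I].

Variables (R : realType) (lambda : R).

Definition hc_partition : R := \sum_(I in indep_sets) lambda ^+ #|I|.

Definition hc_measure (A : {set {set T}}) : R :=
  \sum_(I in A :&: indep_sets) lambda ^+ #|I| / hc_partition.

End HardCore.

Section Torus.
Variables L d : nat.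

Definition torus_vertex : finType := {ffun 'I_d -> 'I_L}.

Definition torus_adj : rel torus_vertex := fun x y =>
  (#|[set i | x i != y i]| == 1)%N &&
  [forall i, (x i != y i) ==>
     ((x i).+1 == y i %[mod L])%N || ((y i).+1 == x i %[mod L])%N].

Definition even_class : {set torus_vertex} :=
  [set x : torus_vertex | ~~ odd (\sum_i x i)%N].

Definition odd_class : {set torus_vertex} :=
  [set x : torus_vertex | odd (\sum_i x i)%N].

Definition balanced_indep_sets (R : realType) (rho : R) :
    {set {set torus_vertex}} :=
  [set I in indep_sets torus_adj |
     `| #|I :&: even_class|%:R - #|I :&: odd_class|%:R |
       <= rho * L%:R ^+ d / 2].

End Torus.

Definition log2 (R : realType) (x : R) : R := ln x / ln 2.

(* [ln 0 = 0] in the library, so [entropy 0 = entropy 1 = 0] as usual. *)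
Definition entropy (R : realType) (a : R) : R :=
  - a * log2 a - (1 - a) * log2 (1 - a).

(* Main.v *)
(* The phase of an independent set I separates the torus into an even and an odd region; the
   components of the interface are its contours. If a region U is bounded by contours with edge
   boundary 2 d B, moving I one step inside U frees B sites, so that such a configuration is less
   likely by a factor (1 + lambda)^-B; a container argument (U is described by a cheap approximation,
   found by greedy covers) shows that the entropy of U costs less than this gain. A balanced I then
   falls in one of three cases. Either it is nearly absent from one parity class, which the entropy
   hypothesis makes unlikely. Or some contour bounds no region: it is a closed 1-form mod 2 that is
   not exact, hence meets every line in some direction, and the contours of this kind bound a region
   of enormous boundary. Or all contours have an inside, and the outermost ones enclose a total
   volume of order L^d / sqrt d, which an exponential moment bound over the sets of outermost
   contours excludes. *)

Require Import Defs.
From mathcomp Require Import all_boot all_order all_algebra.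
From mathcomp Require Import boolp reals sequences exp.
From mathcomp Require Import zify lra ring.

Set Implicit Arguments.
Unset Strict Implicit.
Unset Printing Implicit Defensive.

Import Order.TTheory GRing.Theory Num.Theory.

(** * Step graphs and boundaries *)

(** The shift of [I] inside [U] cannot be inverted without knowing [U], and naming [U] itself may
    cost more than the shift gains when [lambda] is small. Hence only a pair [(F, S)] approximating
    [U] is named, with a threshold [psi] for the number of misjudged neighbours, and one of two
    transfers is applied (take [lambda <= 1]). If [U] has at most [n] odd points outside [F],
    listing them costs about [n * ln d], and the full gain, of order [lambda * B], pays for it as
    long as [n] is a small multiple of [lambda * B / ln d]. If there are more, the shift uses only
    points outside [F], gains about [n * lambda], that is [lambda ^ 2 * B / ln d], and pays for
    [psi * B / d] undetermined sites; naming the pair costs about [B * ln d / psi]. These two costs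
    are balanced by [psi = kappa * d] with [kappa = sqrt (ln d / d)], both being of order
    [kappa * B]. So [lambda ^ 2] has to dominate [kappa * ln d], which is the square of
    [d ^ (-1/4) * (ln d) ^ (3/4)]. *)

(* A bipartite graph given by commuting steps, such as the torus with its 2 d unit translations;
   [par] is true on the odd class. *)
Record step_graph := StepGraph {
  vtx :> finType;
  dir : finType;
  stp : dir -> vtx -> vtx;
  opp : dir -> dir;
  par : vtx -> bool;
  stpK : forall j, cancel (stp j) (stp (opp j));
  oppK : involutive opp;
  stpC : forall i j x, stp i (stp j x) = stp j (stp i x);
  stp_inj : forall x i j, stp i x = stp j x -> i = j;
  par_stp : forall j x, par (stp j x) = ~~ par x }.

Section Counting.
Variable G : step_graph.
Local Notation D := #|dir G|.
Implicit Types (x y : G) (i j : dir G) (A B U : {set G}).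

Lemma stpVK j : cancel (stp (opp j)) (@stp G j).
Proof. by move=> x; rewrite -{1}(oppK j) stpK. Qed.

Lemma stp_injr j : injective (@stp G j).
Proof. exact: can_inj (stpK j). Qed.

Definition ndeg A x := #|[set j | stp j x \in A]|.
Definition nb A : {set G} := [set y | 0 < ndeg A y].
Definition bdeg U x := #|[set j | (stp j x \in U) != (x \in U)]|.

Lemma nbP A x : reflect (exists j, stp j x \in A) (x \in nb A).
Proof.
rewrite inE /ndeg card_gt0; apply: (iffP (set0Pn _)) => -[j]; last by exists j; rewrite inE.
by rewrite inE; exists j.
Qed.

Lemma nb_stp A x j : x \in A -> stp j x \in nb A.
Proof. by move=> xA; apply/nbP; exists (opp j); rewrite stpK. Qed.

Lemma ndeg_le A x : ndeg A x <= D.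
Proof. exact: max_card. Qed.

Lemma ndegS A B x : A \subset B -> ndeg A x <= ndeg B x.
Proof.
move=> sAB; apply/subset_leq_card/subsetP => j; rewrite !inE.
exact: (subsetP sAB).
Qed.

Lemma ndegU A B x : ndeg (A :|: B) x <= ndeg A x + ndeg B x.
Proof.
rewrite /ndeg; apply: leq_trans (leq_card_setU _ _).
by apply/subset_leq_card/subsetP => j; rewrite !inE.
Qed.

Lemma ndegC A x : ndeg A x + ndeg (~: A) x = D.
Proof.
rewrite /ndeg -[in RHS](cardsC [set j | stp j x \in A]); congr (_ + #|pred_of_set _|).
by apply/setP => j; rewrite !inE.
Qed.

Lemma ndeg_card A x : ndeg A x <= #|A|.
Proof.
rewrite /ndeg -(@card_in_imset _ _ (fun j => stp j x)) => [|i j _ _]; last exact: stp_inj.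
by apply/subset_leq_card/subsetP => _ /imsetP[j jA ->]; rewrite inE in jA.
Qed.

Lemma ndeg_sum A x : ndeg A x = \sum_j (stp j x \in A).
Proof. by rewrite /ndeg -sum1dep_card big_mkcond. Qed.

Lemma ndeg_exchange A B : \sum_(x in A) ndeg B x = \sum_(y in B) ndeg A y.
Proof.
under eq_bigr do rewrite ndeg_sum; under [RHS]eq_bigr do rewrite ndeg_sum.
rewrite big_mkcond [RHS]big_mkcond /=.
transitivity (\sum_(x : G) \sum_j ((x \in A) * (stp j x \in B))).
  by apply: eq_bigr => x _; case: (x \in A); [apply: eq_bigr => j _; rewrite mul1n|rewrite big1].
rewrite exchange_big (reindex_inj (inv_inj (@oppK G))) /=.
transitivity (\sum_j \sum_(y : G) ((y \in B) * (stp j y \in A))); last first.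
  rewrite exchange_big; apply: eq_bigr => x _.
  by case: (x \in B); [apply: eq_bigr => j _; rewrite mul1n|rewrite big1].
apply: eq_bigr => j _; rewrite (reindex_inj (@stp_injr j)) /=.
by apply: eq_bigr => x _; rewrite stpK mulnC.
Qed.

Lemma ndeg_markov A B m : (forall x, x \in A -> m <= ndeg B x) -> #|A| * m <= D * #|B|.
Proof.
move=> h; rewrite -sum_nat_const mulnC.
apply: (@leq_trans (\sum_(x in A) ndeg B x)); first exact: leq_sum.
rewrite ndeg_exchange -sum_nat_const; apply: leq_sum => *; exact: ndeg_le.
Qed.

Lemma card_nb A : #|nb A| <= D * #|A|.
Proof. by rewrite -[#|nb A|]muln1; apply: ndeg_markov => x; rewrite inE. Qed.

Lemma nbS A B : A \subset B -> nb A \subset nb B.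
Proof.
by move=> sAB; apply/subsetP => x; rewrite !inE => /leq_trans; apply; apply: ndegS.
Qed.

Lemma nbU A B : nb (A :|: B) = nb A :|: nb B.
Proof.
apply/setP => x; rewrite in_setU; apply/nbP/orP => [[j]|].
  by rewrite inE => /orP[h|h]; [left|right]; apply/nbP; exists j.
by case=> /nbP[j h]; exists j; rewrite inE h ?orbT.
Qed.

Lemma ndeg1_nb H x : ndeg H x = #|H :&: nb [set x]|.
Proof.
rewrite /ndeg -(@card_in_imset _ _ (fun j => stp j x)) => [|i j _ _]; last exact: stp_inj.
apply: eq_card => y; rewrite in_setI; apply/imsetP/andP => [[j]|[yH /nbP[j]]].
  by rewrite inE => jH ->; split => //; apply: nb_stp; rewrite inE.
by rewrite inE => /eqP jx; exists (opp j); rewrite -?jx ?stpK // inE stpK.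
Qed.

(** As long as some point of [P] sees at least [m] uncovered points of [H], it is added to [Y]. Each
    addition covers [m] new points, which bounds [Y]; the stopping condition is the last clause. *)
Lemma greedy_cover (P : pred G) (H : {set G}) m : 0 < m ->
  exists Y : {set G},
    [/\ forall y, y \in Y -> P y /\ y \in nb H, #|Y| * m <= #|H|
      & forall y, P y -> ndeg (H :\: nb Y) y < m].
Proof.
move=> m0; have [n] := ubnP #|H|; elim: n H => // n IH H /ltnSE leHn.
have [/existsP[y /andP[Py my]]|] := boolP [exists y, P y && (m <= ndeg H y)]; last first.
  move/existsPn => h; exists set0; split=> [y||y Py]; rewrite ?inE ?cards0 //.
  have := h y; rewrite Py -ltnNge; apply: leq_ltn_trans; apply: ndegS; exact: subsetDl.
have cH : #|H :\: nb [set y]| + ndeg H y = #|H|.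
  by rewrite ndeg1_nb addnC cardsID.
case: (IH (H :\: nb [set y])); first by rewrite -cH in leHn; lia.
move=> Y [YP cY hY]; exists (y |: Y); split.
- move=> z /setU1P[->|/YP[Pz hz]].
    by split=> //; rewrite inE; apply: leq_trans m0 my.
  by split=> //; apply: (subsetP (nbS (subsetDl _ _)) _ hz).
- rewrite -cH; apply: leq_trans (leq_add cY my).
  have h : #|y |: Y| <= #|Y|.+1 by rewrite cardsU1; case: (y \notin Y); lia.
  by rewrite -mulSnr leq_mul2r h orbT.
- by move=> z Pz; rewrite nbU -setDDl hY.
Qed.

End Counting.

(** * Counting sets whose components all contain a prescribed point *)

Section RootedSets.
Variables (T : finType) (g : rel T) (R : realFieldType).
Local Open Scope ring_scope.
Implicit Types P Q A : {set T}.

(* Every connected component of the graph induced on [A] meets [P]. *)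
Definition rooted P A := (P \subset A) &&
  [forall P' : {set T}, (P \subset P') ==> (P' \subset A) ==>
     [forall x in P', forall y in A, g x y ==> (y \in P')] ==> (P' == A)].

Lemma rootedP P A : reflect
  (P \subset A /\ forall P', P \subset P' -> P' \subset A ->
     (forall x y, x \in P' -> y \in A -> g x y -> y \in P') -> P' = A)
  (rooted P A).
Proof.
apply: (iffP andP) => -[sPA h]; split=> //.
  move=> P' s1 s2 hc; have /forallP/(_ P') := h; rewrite s1 s2 /= => /implyP hP.
  apply/eqP/hP/forallP => x; apply/implyP => xP.
  by apply/forallP => y; apply/implyP => yA; apply/implyP; apply: hc.
apply/forallP => P'; apply/implyP => s1; apply/implyP => s2; apply/implyP => hc.
apply/eqP/h => // x y xP yA xy.
by move/forallP/(_ x)/implyP/(_ xP)/forallP/(_ y)/implyP/(_ yA)/implyP/(_ xy): hc.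
Qed.

Definition frontier P Q := [set y | [exists x in P, g x y]] :\: (P :|: Q).

Variables (Dl : nat) (x a : R).
Hypothesis gdeg : forall v, (#|[set w | g v w]| <= Dl)%N.
Hypotheses (x0 : 0 <= x) (a1 : 1 <= a) (xa : x * a ^+ Dl + 1 <= a).

(** Exploration of [A] with [P] known to be inside and [Q] outside. A frontier point [v] either
    belongs to [A] and moves to [P], at the price [x] and at most [Dl] new frontier points, or it
    moves to [Q]. Hypothesis [xa] lets the two alternatives share one factor [a]. With an empty
    frontier only [A = P] is left. *)
Lemma rooted_sum_aux P Q :
  \sum_(A : {set T} | rooted P A && [disjoint A & Q]) x ^+ (#|A :\: P|)
    <= a ^+ #|frontier P Q|.
Proof.
have a0 : 0 <= a by apply: le_trans a1.
have [n] := ubnP #|~: (P :|: Q)|; elim: n P Q => // n IH P Q /ltnSE leN.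
have [F0|[v vF]] := set_0Vmem (frontier P Q).
  rewrite F0 cards0 expr0.
  have sub A : rooted P A && [disjoint A & Q] -> A = P.
    case/andP=> /rootedP[sPA h] dAQ; apply/esym/h => // y z yP zA gyz.
    apply: contraT => zP; suff : z \in frontier P Q by rewrite F0 inE.
    rewrite !inE negb_or zP (disjointFr dAQ) //=; apply/existsP; exists y; exact/andP.
  have [hP|hP] := boolP (rooted P P && [disjoint P & Q]).
    rewrite (big_pred1 P) ?setDv ?cards0 ?expr0 // => A /=.
    by apply/idP/eqP => [/sub//|->].
  by rewrite big_pred0 // => A; apply/negP => hA; move: (hA); rewrite (sub _ hA) (negbTE hP).
have [vg vP vQ] : [/\ [exists y in P, g y v], v \notin P & v \notin Q].
  by move: vF; rewrite !inE negb_or => /andP[/andP[-> ->] ->].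
rewrite (bigID (fun A : {set T} => v \in A)) /=.
have l1 : \sum_(A : {set T} | (rooted P A && [disjoint A & Q]) && (v \in A)) x ^+ (#|A :\: P|)
    <= x * a ^+ (#|frontier P Q|.-1 + Dl).
  apply: (@le_trans _ _ (\sum_(A : {set T} | rooted (v |: P) A && [disjoint A & Q])
     x * x ^+ (#|A :\: (v |: P)|))); last first.
    rewrite -mulr_sumr ler_wpM2l //; apply: le_trans (IH _ _ _) _.
      have -> : ~: ((v |: P) :|: Q) = ~: (P :|: Q) :\ v by apply/setP=> z; rewrite !inE; case: eqP.
      move: leN; rewrite (cardsD1 v (~: (P :|: Q))) !inE negb_or vP vQ /=; lia.
    rewrite ler_weXn2l //.
    have: frontier (v |: P) Q \subset (frontier P Q :\ v) :|: [set w | g v w].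
      apply/subsetP => z; rewrite !inE !negb_or => /andP[/andP[/andP[zv zP] zQ]].
      move=> /existsP[y /andP[]]; rewrite !inE => /orP[/eqP->->|yP gyz]; first by rewrite orbT.
      by rewrite zv zP zQ /=; apply/orP; left; apply/existsP; exists y; rewrite yP.
    move/subset_leq_card/leq_trans; apply; apply: leq_trans (leq_card_setU _ _) _.
    by apply: leq_add (gdeg v); rewrite (cardsD1 v (frontier P Q)) vF.
  rewrite [leRHS]big_mkcond [leLHS]big_mkcond /=; apply: ler_sum => A _.
  case: ifP => [/andP[/andP[/rootedP[sPA h] dAQ] vA]|_]; last first.
    by case: ifP => // _; rewrite mulr_ge0 ?exprn_ge0.
  have -> : rooted (v |: P) A && [disjoint A & Q].
    rewrite dAQ andbT; apply/rootedP; split; first by rewrite subUset sub1set vA.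
    by move=> P' s1 s2; apply: h s2; apply: subset_trans s1; apply: subsetUr.
  rewrite -exprS (cardsD1 v (A :\: P)) !inE vP vA /= add1n.
  by rewrite (_ : (A :\: P) :\ v = A :\: (v |: P)) // setDDl setUC.
have l2 : \sum_(A : {set T} | (rooted P A && [disjoint A & Q]) && (v \notin A)) x ^+ (#|A :\: P|)
    <= a ^+ (#|frontier P Q|.-1).
  apply: (@le_trans _ _ (\sum_(A : {set T} | rooted P A && [disjoint A & v |: Q])
     x ^+ (#|A :\: P|))); last first.
    apply: le_trans (IH _ _ _) _.
      have -> : ~: (P :|: (v |: Q)) = ~: (P :|: Q) :\ v
        by apply/setP=> z; rewrite !inE; case: eqP => //=; rewrite ?orbT.
      move: leN; rewrite (cardsD1 v (~: (P :|: Q))) !inE negb_or vP vQ /=; lia.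
    rewrite ler_weXn2l //.
    have -> : frontier P (v |: Q) = frontier P Q :\ v.
      by apply/setP=> z; rewrite !inE; case: eqP => //=; rewrite ?orbT.
    by rewrite (cardsD1 v (frontier P Q)) vF.
  rewrite le_eqVlt; apply/orP; left; apply/eqP/eq_bigl => A.
  rewrite -andbA; congr andb; rewrite -!setI_eq0 setIUr setU_eq0 andbC; congr andb.
  by rewrite setI_eq0 disjoint_sym disjoints1.
apply: le_trans (lerD l1 l2) _.
have -> : a ^+ #|frontier P Q| = a ^+ (#|frontier P Q|.-1) * a.
  by rewrite -exprSr prednK // card_gt0; apply/set0Pn; exists v.
by rewrite exprD mulrCA -{2}[a ^+ _]mulr1 -mulrDr ler_wpM2l ?exprn_ge0.
Qed.

End RootedSets.

Section RootedCount.
Local Open Scope ring_scope.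

Lemma bernoulli_upper (R : realFieldType) (u : R) n : 0 <= u ->
  (1 + u) ^+ n * (1 - n%:R * u) <= 1.
Proof.
move=> u0; elim: n => [|n IH]; first by rewrite mul0r subr0 mulr1.
apply: le_trans IH; rewrite exprSr -mulrA ler_wpM2l ?exprn_ge0 ?addr_ge0 //.
rewrite -natr1; have := mulr_ge0 u0 u0; have := ler0n R n; nra.
Qed.

Lemma card_frontier (T : finType) (g : rel T) (Dl : nat) (P Q : {set T}) :
  (forall v, (#|[set w | g v w]| <= Dl)%N) -> (#|frontier g P Q| <= Dl * #|P|)%N.
Proof.
move=> gdeg; apply: leq_trans (subset_leq_card (subsetDl _ _)) _.
have -> : [set y | [exists x in P, g x y]] = \bigcup_(x in P) [set w | g x w].
  apply/setP => y; rewrite inE; apply/existsP/bigcupP => [[x /andP[xP xy]]|[x xP]].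
    by exists x; rewrite ?inE.
  by rewrite inE => xy; exists x; apply/andP.
rewrite mulnC -sum_nat_const; elim/big_rec2: _ => [|x m A _ IH]; first by rewrite cards0.
by apply: leq_trans (leq_card_setU _ _) _; apply: leq_add.
Qed.

Lemma card_rooted (T : finType) (g : rel T) (Dl : nat) (P : {set T}) n :
  (0 < Dl)%N -> (forall v, (#|[set w | g v w]| <= Dl)%N) ->
  (#|[set A | rooted g P A & (#|A :\: P| <= n)%N]| <= (4 * Dl) ^ n * 2 ^ #|P|)%N.
Proof.
(* These weights give [a ^+ Dl <= 2], so that [x * a ^+ Dl] is at most the excess of [a] over 1. A
   counted set weighs at least [x ^+ n], the inverse of the first factor of the claim, and the
   frontier of [P] contributes at most [2 ^ #|P|]. *)
move=> D0 gdeg; pose D : rat := Dl%:R; pose x := (4%:R * D)^-1; pose a := 1 + (2%:R * D)^-1.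
have Dp : 0 < D by rewrite ltr0n.
have D1 : 1 <= D by rewrite ler1n.
have x0 : 0 < x by rewrite invr_gt0 mulr_gt0.
have x1 : x <= 1 by rewrite invf_le1 ?mulr_gt0 //; lra.
have ap : 0 <= (2%:R * D)^-1 by rewrite invr_ge0 mulr_ge0 // ltW.
have a1 : 1 <= a by rewrite lerDl.
have aD : a ^+ Dl <= 2%:R.
  have := bernoulli_upper Dl ap; rewrite -/D -/a.
  have -> : 1 - D * (2%:R * D)^-1 = 2%:R^-1 by field; rewrite gt_eqF.
  lra.
have xa : x * a ^+ Dl + 1 <= a.
  have : x * a ^+ Dl <= x * 2%:R by rewrite ler_pM2l.
  have -> : x * 2%:R = (2%:R * D)^-1 by rewrite /x; field; rewrite gt_eqF.
  rewrite /a; lra.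
have := rooted_sum_aux gdeg (ltW x0) a1 xa P set0.
set S := [set A | _ & _] => hsum.
have h1 : #|S|%:R * x ^+ n <= 2%:R ^+ #|P|.
  apply: le_trans (_ : a ^+ #|frontier g P set0| <= _); last first.
    apply: le_trans (_ : (a ^+ Dl) ^+ #|P| <= _).
      by rewrite -exprM ler_weXn2l // card_frontier.
    by rewrite lerXn2r // nnegrE ?exprn_ge0 // (le_trans _ a1).
  apply: le_trans hsum; rewrite mulr_natl -sumr_const [leLHS]big_mkcond [leRHS]big_mkcond /=.
  apply: ler_sum => A _; rewrite /S inE -setI_eq0 setI0 eqxx andbT.
  case: (rooted g P A) => //=; case: ifP => // h; last by rewrite exprn_ge0 ?ltW.
  by rewrite ler_wiXn2l // ltW.
have y0 : 0 <= (4%:R * D) ^+ n by rewrite exprn_ge0 ?mulr_ge0 ?ltW.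
have xy : x ^+ n * (4%:R * D) ^+ n = 1.
  by rewrite -exprMn mulVf ?expr1n // gt_eqF // mulr_gt0.
have := ler_wpM2r y0 h1; rewrite -mulrA xy mulr1 mulrC.
by rewrite -(ler_nat rat) natrM !natrX natrM.
Qed.

Lemma prod_1D_sub (R : comRingType) (T : finType) (M : {set T}) (F : T -> R) :
  \prod_(i in M) (1 + F i) = \sum_(A : {set T} | A \subset M) \prod_(i in A) F i.
Proof.
rewrite big_mkcond /=.
transitivity (\prod_i ((if i \in M then F i else 0) + 1)).
  by apply: eq_bigr => i _; case: ifP; rewrite ?add0r // addrC.
rewrite bigA_distr [RHS]big_mkcond; apply: eq_bigr => A _.
case: ifPn => [sAM|/subsetPn[i iA iM]]; last by rewrite (bigD1 i) //= iA (negbTE iM) mul0r.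
rewrite [RHS]big_mkcond; apply: eq_bigr => i _; case: ifP => // iA.
by rewrite (subsetP sAM).
Qed.

(** Each counted set contributes at least [x ^+ n] to the expansion of [(1 + x) ^+ #|M|]. A small
    [x] makes the size of the ground set nearly irrelevant. *)
Lemma card_small_subsets (R : realFieldType) (T : finType) (M : {set T}) n (x : R) :
  0 <= x <= 1 ->
  #|[set A : {set T} | A \subset M & (#|A| <= n)%N]|%:R * x ^+ n <= (1 + x) ^+ #|M|.
Proof.
move=> /andP[x0 x1]; rewrite -prodr_const prod_1D_sub mulr_natl -sumr_const.
rewrite [leLHS]big_mkcond [leRHS]big_mkcond /=; apply: ler_sum => A _; rewrite inE prodr_const.
case: (A \subset M) => //=; case: ifP => // h; last by rewrite exprn_ge0.
exact: ler_wiXn2l.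
Qed.

End RootedCount.

Lemma leq_cardU (T : finType) (A B : {set T}) : #|A :|: B| <= #|A| + #|B|.
Proof. exact: leq_card_setU. Qed.

(** * Odd regions and the structure of their edge boundary *)

Section Boundary.
Variable G : step_graph.
Local Notation D := #|dir G|.
Implicit Types (x y : G) (i j : dir G) (A U Z : {set G}) (B : nat).

(* All inner boundary points are odd, so that stepping in any one direction [j] crosses the boundary
   of [U] outwards equally often: the [inflow U j] all have the same size. *)
Definition oddset U := forall x j, x \in U -> stp j x \notin U -> par x.
Definition bnd U : {set G} := [set x | 0 < bdeg U x].
Definition nabla U := \sum_(x in U) ndeg (~: U) x.
Definition inflow U j : {set G} := [set x in U | stp (opp j) x \notin U].

Lemma bndP U x : reflect (exists j, (stp j x \in U) != (x \in U)) (x \in bnd U).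
Proof.
rewrite inE /bdeg card_gt0; apply: (iffP (set0Pn _)) => -[j]; first by rewrite inE; exists j.
by exists j; rewrite inE.
Qed.

Lemma bdegC U x : bdeg (~: U) x = bdeg U x.
Proof.
by apply: eq_card => j; rewrite !inE; do 2!case: (_ \in U).
Qed.

Lemma bdeg_in U x : x \in U -> bdeg U x = ndeg (~: U) x.
Proof. by move=> xU; apply: eq_card => j; rewrite !inE xU; case: (_ \in U). Qed.

Lemma bdeg_out U x : x \notin U -> bdeg U x = ndeg U x.
Proof. by move=> xU; apply: eq_card => j; rewrite !inE (negbTE xU); case: (_ \in U). Qed.

Lemma bndC U : bnd (~: U) = bnd U.
Proof. by apply/setP => x; rewrite !inE bdegC. Qed.

Lemma nablaC U : nabla (~: U) = nabla U.
Proof. by rewrite /nabla setCK ndeg_exchange. Qed.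

Lemma sum_bdeg U : \sum_x bdeg U x = 2 * nabla U.
Proof.
rewrite (bigID (mem U)) /= mul2n -addnn -{2}nablaC; congr (_ + _).
  by apply: eq_bigr => x; apply: bdeg_in.
rewrite /nabla setCK; apply: eq_big => [x|x]; rewrite ?inE //; apply: bdeg_out.
Qed.

(** The step [j] maps the even points of [U] injectively to odd points of [U], and the odd points
    that it misses form the inflow. Its size is thus the excess of odd over even points, whatever
    [j] is. *)
Lemma card_inflow U j : oddset U ->
  #|[set x in U | ~~ par x]| + #|inflow U j| = #|[set x in U | par x]|.
Proof.
move=> oU; set E := [set stp j x | x in [set x in U | ~~ par x]].
have <- : #|E| = #|[set x in U | ~~ par x]| by rewrite card_imset //; apply: stp_injr.
rewrite -cardsUI; have E0 : E :&: inflow U j = set0.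
  apply/eqP; rewrite -subset0; apply/subsetP => y; rewrite in_setI => /andP[/imsetP[x]].
  by rewrite !inE => /andP[xU _] ->; rewrite stpK xU andbF.
rewrite E0 cards0 addn0; apply: eq_card => y; rewrite in_setU [RHS]inE.
apply/orP/andP => [[/imsetP[x]|]|[yU py]].
- rewrite inE => /andP[xU px] ->; split; last by rewrite par_stp.
  by apply: contraT => /(oU _ _ xU); rewrite (negbTE px).
- by rewrite inE => /andP[yU h]; split=> //; apply: oU h.
have [h|h] := boolP (stp (opp j) y \in U); last by right; rewrite inE yU.
left; apply/imsetP; exists (stp (opp j) y); last by rewrite stpVK.
by rewrite inE h par_stp negbK.
Qed.

Lemma nabla_inflow U : nabla U = \sum_j #|inflow U j|.
Proof.
rewrite (reindex_inj (inv_inj (@oppK G))) /= /nabla.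
under eq_bigr do rewrite ndeg_sum; rewrite exchange_big /=; apply: eq_bigr => j _.
rewrite -sum1_card [RHS]big_mkcond [LHS]big_mkcond /=; apply: eq_bigr => x _.
by rewrite !inE oppK; case: (x \in U); case: (stp j x \in U).
Qed.

Lemma inflow_const U i j : oddset U -> #|inflow U i| = #|inflow U j|.
Proof. by move=> oU; have := card_inflow i oU; have := card_inflow j oU; lia. Qed.

Lemma card_inflow_nabla U j B : oddset U -> nabla U = D * B -> #|inflow U j| = B.
Proof.
move=> oU; rewrite nabla_inflow.
under eq_bigr do rewrite (inflow_const _ j oU).
rewrite sum_nat_const => /eqP; rewrite eqn_mul2l => /orP[|/eqP//].
by move=> /eqP/card0_eq/(_ j).
Qed.

Lemma bnd_par U x : oddset U -> x \in bnd U -> par x = (x \in U).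
Proof.
move=> oU /bndP[j]; case: (boolP (x \in U)) => xU.
  by rewrite eqb_id => /(oU _ _ xU).
rewrite eqbF_neg negbK => jU; apply/negbTE; rewrite -(par_stp j).
by apply: (oU _ (opp j)) => //; rewrite stpK.
Qed.

Lemma bnd_alt U x j : oddset U -> x \in bnd U -> (stp j x \in U) = (x \in U) ->
  stp j x \notin bnd U.
Proof.
move=> oU xb e; apply/negP => /(bnd_par oU).
by rewrite par_stp (bnd_par oU xb) e; case: (x \in U).
Qed.

(** For every direction [f], one of the parallel edges leaving [x] and [stp j x] along [f] crosses
    the boundary: if [stp f x] stays on the side of [x], parity keeps it off the boundary, so its
    neighbour along [j] lies on that side too. Hence every boundary edge has an endpoint in
    [high U]. *)
Lemma bdeg_edge U x j : oddset U -> (stp j x \in U) != (x \in U) ->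
  D <= bdeg U x + bdeg U (stp j x).
Proof.
move=> oU xj; have xb : x \in bnd U by apply/bndP; exists j.
rewrite /bdeg; apply: leq_trans (leq_card_setU _ _); rewrite -cardsT.
apply/subset_leq_card/subsetP => f _; rewrite !inE.
have [fx|//] := eqVneq (stp f x \in U) (x \in U); rewrite /=.
have : (stp j (stp f x) \in U) = (stp f x \in U).
  have := bnd_alt oU xb fx; apply: contraNeq => h; apply/bndP; by exists j.
by rewrite stpC fx => ->; rewrite eq_sym.
Qed.

Definition high U : {set G} := [set x | D <= 2 * bdeg U x].

Lemma card_high U B : 0 < D -> nabla U = D * B -> #|high U| <= 4 * B.
Proof.
move=> D0 nU; rewrite -(leq_pmul2r D0) -sum_nat_const.
apply: (@leq_trans (\sum_(x in high U) 2 * bdeg U x)).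
  by apply: leq_sum => x; rewrite inE.
rewrite -big_distrr /=; apply: (@leq_trans (2 * \sum_x bdeg U x)).
  by rewrite leq_mul2l [X in _ <= X](bigID (mem (high U))) /= leq_addr.
by rewrite sum_bdeg nU (mulnC D) !mulnA.
Qed.

Lemma edge_high U x j : oddset U -> (stp j x \in U) != (x \in U) ->
  (x \in high U) || (stp j x \in high U).
Proof. by move=> oU /(bdeg_edge oU); rewrite !inE; lia. Qed.

Lemma high_bnd U x : 0 < D -> x \in high U -> x \in bnd U.
Proof. by rewrite !inE; lia. Qed.

Section Cover.
Variables (U Z : {set G}) (m : nat).
Hypothesis oU : oddset U.
Hypothesis m0 : 0 < m.
Hypothesis mD : 8 * m <= D.
Hypothesis cov : forall y, ndeg (high U :\: Z) y < m.

Let D0 : 0 < D. Proof. by lia. Qed.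
Let Z1 : {set G} := [set x | m <= ndeg Z x].
Let Z2 : {set G} := [set x | m <= ndeg Z1 x].

(* Sliding the at least D/2 boundary edges at x along the step f gives boundary edges at the
   neighbours of stp f x, and each of these has an endpoint of high degree. *)
Lemma nbr_high x f : x \in high U -> x \notin Z1 -> (stp f x \in U) = (x \in U) ->
  stp f x \in Z1.
Proof.
move=> xH; rewrite !inE -ltnNge => xZ fx.
have xb := high_bnd D0 xH; have := bnd_alt oU xb fx => wb.
have h1 : [set i | (stp i x \in U) != (x \in U)] \subset
   ([set i | stp i x \in Z] :|: [set i | stp i x \in high U :\: Z]) :|:
   ([set i | stp i (stp f x) \in high U :\: Z] :|: [set i | stp i (stp f x) \in Z]).
  apply/subsetP => i; rewrite inE => ix.
  have iw : (stp i (stp f x) \in U) = (stp f x \in U).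
    apply/eqP; apply: contraNT wb => h; by apply/bndP; exists i.
  have : (stp f (stp i x) \in U) != (stp i x \in U) by rewrite stpC iw fx eq_sym.
  move/(edge_high oU); rewrite stpC ![i \in _]inE ![_ \in _ :\: _]inE.
  by do 2!case: (_ \in Z) => //=; rewrite ?orbT ?orbF.
have := leq_trans (subset_leq_card h1) (leq_cardU _ _).
have := cov x; have := cov (stp f x); move: xH xZ; rewrite inE /ndeg /bdeg.
move: (leq_cardU [set i | stp i x \in Z] [set i | stp i x \in high U :\: Z]).
move: (leq_cardU [set i | stp i (stp f x) \in high U :\: Z] [set i | stp i (stp f x) \in Z]).
lia.
Qed.

Let Zs := Z :|: Z1 :|: Z2.
Let bad := high U :\: Zs.

(** Such points [x] and [y] lie on different sides. In each direction, either one of them has a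
    neighbour on its own side, which is in [Z1] by [nbr_high], or the two neighbours form a boundary
    edge, so that one of them is high and hence in [Z] or uncovered. This puts all [D] directions
    into six sets of fewer than [m] elements, against [8 * m <= D]. *)
Lemma bad_nonadj x j : x \in bad -> stp j x \in bad -> false.
Proof.
rewrite !in_setD !in_setU !negb_or => /andP[/andP[/andP[xZ xZ1] xZ2] xH].
move=> /andP[/andP[/andP[yZ yZ1] yZ2] yH].
have xb := high_bnd D0 xH; have yb := high_bnd D0 yH.
have xy : (stp j x \in U) != (x \in U).
  by apply/negP => /eqP/(bnd_alt oU xb); rewrite yb.
set y := stp j x in yZ yZ1 yZ2 yH yb xy.
have sub : [set: dir G] \subset
  ([set i | stp i x \in Z1] :|: [set i | stp i y \in Z1]) :|:
  (([set i | stp i x \in Z] :|: [set i | stp i x \in high U :\: Z]) :|: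
   ([set i | stp i y \in Z] :|: [set i | stp i y \in high U :\: Z])).
  apply/subsetP => f _; rewrite in_setU [f \in _ :|: [set i | stp i y \in Z1]]in_setU.
  have [e|ne] := eqVneq (stp f x \in U) (x \in U).
    by rewrite [f \in _]inE (nbr_high xH xZ1 e).
  have [e|ne'] := eqVneq (stp f y \in U) (y \in U).
    by rewrite [f \in [set i | stp i y \in Z1]]inE (nbr_high yH yZ1 e) orbT.
  apply/orP; right.
  have : (stp j (stp f x) \in U) != (stp f x \in U).
    rewrite stpC -/y; move: ne ne' xy.
    by case: (stp f y \in U); case: (stp f x \in U); case: (x \in U); case: (y \in U).
  move/(edge_high oU); rewrite stpC -/y ![f \in _]inE ![_ \in _ :\: _]inE.
  by do 2!case: (_ \in Z) => //=; rewrite ?orbT ?orbF.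
have := leq_trans (subset_leq_card sub) (leq_cardU _ _); rewrite cardsT.
have := cov x; have := cov y; move: xZ1 xZ2 yZ1 yZ2; rewrite !inE -!ltnNge /ndeg.
move: (leq_cardU [set i | stp i x \in Z1] [set i | stp i y \in Z1]).
move: (leq_cardU ([set i | stp i x \in Z] :|: [set i | stp i x \in high U :\: Z])
   ([set i | stp i y \in Z] :|: [set i | stp i y \in high U :\: Z])).
move: (leq_cardU [set i | stp i x \in Z] [set i | stp i x \in high U :\: Z]).
move: (leq_cardU [set i | stp i y \in Z] [set i | stp i y \in high U :\: Z]).
lia.
Qed.

Definition corrected : {set G} := [set x | (x \in U) (+) (x \in bad)].

(** A boundary edge of [U] off [Zs] has a high endpoint, which is bad. All neighbours of a bad point
    off [Zs] lie on the other side of [U] and none of them is bad, so flipping the bad points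
    removes all these edges and creates none. *)
Lemma corrected_edge x j : x \notin Zs -> stp j x \notin Zs ->
  (stp j x \in corrected) = (x \in corrected).
Proof.
have key y k : y \in bad -> stp k y \notin Zs -> (stp k y \in U) != (y \in U).
  rewrite !in_setD !in_setU !negb_or => /andP[/andP[/andP[xZ xZ1] xZ2] xH].
  move=> /andP[/andP[_ h] _]; apply/negP => /eqP/(nbr_high xH xZ1).
  by rewrite (negbTE h).
move=> xZ jZ; rewrite ![_ \in corrected]inE.
have [xb|xb] := boolP (x \in bad).
  have -> : (stp j x \in bad) = false by apply/negP => /(bad_nonadj xb).
  by have := key _ _ xb jZ; case: (_ \in U); case: (_ \in U).
have [jb|jb] := boolP (stp j x \in bad).
  have := key _ (opp j) jb; rewrite stpK => /(_ xZ).
  by case: (_ \in U); case: (_ \in U).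
rewrite !addbF; apply/eqP/negPn/negP => /(edge_high oU).
by case/orP => h; [move: xb|move: jb]; rewrite in_setD h andbT => /negP; apply.
Qed.

End Cover.

End Boundary.

(** * Approximating odd regions *)

Section Near.
Variable G : step_graph.
Local Notation D := #|dir G|.
Implicit Types (x y : G) (A B K P rho : {set G}).

Definition near n A : {set G} := iter n (fun A => A :|: nb A) A.
Definition adj : rel G := fun x y => [exists j, y == stp j x].

Lemma near0 A : near 0 A = A.
Proof. by []. Qed.

Lemma nearS n A : near n.+1 A = near n A :|: nb (near n A).
Proof. by []. Qed.

Lemma nearD n m A : near (n + m) A = near n (near m A).
Proof. by rewrite /near iterD. Qed.

Lemma near_mono n A B : A \subset B -> near n A \subset near n B.
Proof. by move=> sAB; elim: n => // n IH; rewrite !nearS setUSS ?nbS. Qed.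

Lemma near_sub n m A : n <= m -> near n A \subset near m A.
Proof.
move=> /subnK <-; elim: (m - n) => // k IH.
by rewrite addSn nearS; apply: subset_trans IH (subsetUl _ _).
Qed.

Lemma near_le n m x y : n <= m -> y \in near n [set x] -> y \in near m [set x].
Proof. by move=> nm; apply/subsetP/near_sub. Qed.

Lemma near_trans n m x y z :
  y \in near n [set x] -> z \in near m [set y] -> z \in near (m + n) [set x].
Proof. by move=> h; rewrite nearD; apply/subsetP/near_mono; rewrite sub1set. Qed.

Lemma near_sym n x y : y \in near n [set x] -> x \in near n [set y].
Proof.
elim: n x y => [|n IH] x y; first by rewrite !inE eq_sym.
rewrite {1}nearS in_setU => /orP[/IH|/nbP[j /IH h]].
  exact: near_le.
have /near_trans/(_ h) : stp j y \in near 1 [set y].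
  by rewrite nearS in_setU nb_stp ?orbT // inE.
by rewrite addn1.
Qed.

Lemma near1_stp x j : stp j x \in near 1 [set x].
Proof. by rewrite nearS in_setU nb_stp ?orbT ?inE. Qed.

Lemma card_near n A : #|near n A| <= D.+1 ^ n * #|A|.
Proof.
elim: n => [|n IH]; first by rewrite mul1n.
rewrite nearS expnS -mulnA; apply: leq_trans (leq_cardU _ _) _.
apply: (@leq_trans (D.+1 * #|near n A|)); last by rewrite leq_mul2l IH orbT.
by rewrite mulSn leq_add2l card_nb.
Qed.

Opaque near.

(** Paths in [K] are shadowed by [A]: adjacent points of [K] have points of [A] within distance 4,
    which are therefore within 4 + 1 + 4 = 9 of each other. *)
Lemma rooted_near rho K A : rooted adj rho K -> rho \subset A ->
  (forall k, k \in K -> exists2 y, y \in A & y \in near 4 [set k]) ->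
  (forall y, y \in A -> exists2 k, k \in K & k \in near 1 [set y]) ->
  rooted (fun x y => y \in near 9 [set x]) rho A.
Proof.
move=> /rootedP[sK hK] sA hKA hAK; apply/rootedP; split=> // P' s1 s2 hc.
pose K' := [set k in K | [exists p in P', k \in near 4 [set p]]].
have eK : K' = K.
  apply: hK.
  - apply/subsetP => r rr; rewrite inE (subsetP sK) //=; apply/existsP; exists r.
    by rewrite (subsetP s1) //=; apply: (@near_le 0 4 r r isT); rewrite near0 inE.
  - by apply/subsetP => k; rewrite inE => /andP[].
  move=> k k'; rewrite inE => /andP[kK /existsP[p /andP[pP pk]]] k'K /existsP[j /eqP k'E].
  have [y yA yk] := hKA _ k'K.
  have k1 : k' \in near 1 [set k] by rewrite k'E near1_stp.
  rewrite inE k'K; apply/existsP; exists y; rewrite (near_sym yk) andbT.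
  apply: hc pP yA _; have h := near_trans (near_trans pk k1) yk.
  exact: (@near_le (4 + (1 + 4)) 9 p y isT h).
apply/eqP; rewrite eqEsubset s2; apply/subsetP => y yA.
have [k kK ky] := hAK _ yA; move: kK; rewrite -eK inE => /andP[_ /existsP[p /andP[pP pk]]].
apply: hc pP yA _; have h := near_trans pk (near_sym ky).
exact: (@near_le (1 + 4) 9 p y isT h).
Qed.

End Near.
Arguments adj {G}.

Lemma leq_sum_sub (T : finType) (A B : {set T}) (F : T -> nat) :
  A \subset B -> \sum_(x in A) F x <= \sum_(x in B) F x.
Proof.
move=> sAB; rewrite big_mkcond [X in _ <= X]big_mkcond; apply: leq_sum => x _.
by case: ifP => // /(subsetP sAB) ->.
Qed.

Section Approximation.
Variable G : step_graph.
Local Notation D := #|dir G|.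
Implicit Types (x y : G) (i j : dir G) (A U Z F S rho : {set G}) (lab : {set {set G}}) (B : nat).

Definition conn_off Z : rel G := fun x y => [&& x \notin Z, y \notin Z & adj x y].
Definition comp_off Z x : {set G} := [set y | connect (conn_off Z) x y].
Definition large_comps Z : {set {set G}} :=
  [set comp_off Z x | x in [set x | x \notin Z & D <= 2 * #|comp_off Z x|]].

Lemma conn_off_sym Z : connect_sym (conn_off Z).
Proof.
apply: sym_connect_sym => x y; rewrite /conn_off [RHS]andbCA; congr [&& _, _ & _].
by apply/existsP/existsP => -[j /eqP ->]; exists (opp j); rewrite stpK.
Qed.

Lemma comp_offP Z x y : y \in comp_off Z x -> comp_off Z y = comp_off Z x.
Proof.
rewrite inE => xy; apply/setP => z; rewrite !inE.
by rewrite (same_connect (conn_off_sym Z) xy).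
Qed.

Lemma comp_off_id Z x : x \in comp_off Z x. Proof. by rewrite inE. Qed.

Lemma comp_off_notin Z x y : x \notin Z -> y \in comp_off Z x -> y \notin Z.
Proof.
rewrite inE => xZ /connectP[p pp ->]; elim: p x xZ pp => //= y' p IH x xZ.
by move=> /andP[/and3P[_ yZ _]]; apply: IH.
Qed.

Lemma comp_off_step Z x y j : x \notin Z -> y \in comp_off Z x ->
  stp j y \in comp_off Z x :|: Z.
Proof.
move=> xZ yc; rewrite in_setU orbC; have [//|jZ /=] := boolP (_ \in Z).
rewrite inE; move: (yc); rewrite inE => /connect_trans; apply; apply: connect1.
by rewrite /conn_off (comp_off_notin xZ yc) jZ; apply/existsP; exists j.
Qed.

Lemma small_comp_nb Z x : x \notin Z -> ~~ (D <= 2 * #|comp_off Z x|) -> D <= 2 * ndeg Z x.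
Proof.
move=> xZ; have : D <= ndeg (comp_off Z x) x + ndeg Z x.
  rewrite -cardsT; apply: leq_trans (ndegU _ _ _); apply/subset_leq_card/subsetP => j _.
  by rewrite inE; apply: comp_off_step (comp_off_id _ _).
have := ndeg_card (comp_off Z x) x; lia.
Qed.

(** All edges leaving a component end in [Z], so a large component with a large complement uses up
    [q] of the at most [D * #|Z|] edges at [Z]. A large component with a small complement leaves no
    room for a second one; the summand [q] covers this case. *)
Lemma card_large_comps Z q :
  (forall A, D <= 2 * #|A| -> D <= 2 * #|~: A| -> q <= nabla A) ->
  #|large_comps Z| * q <= D * #|Z| + q.
Proof.
move=> iso; have tI : trivIset (large_comps Z).
  apply/trivIsetP => A B /imsetP[x _ ->] /imsetP[y _ ->]; apply: contraR.
  rewrite -setI_eq0 => /set0Pn[z]; rewrite in_setI => /andP[zx zy].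
  by rewrite -(comp_offP zx) -(comp_offP zy).
have [/existsP[A /andP[AL hA]]|/existsPn hL] :=
    boolP [exists A in large_comps Z, ~~ (D <= 2 * #|~: A|)].
  suff /subset_leq_card : large_comps Z \subset [set A].
    rewrite cards1 => h; apply: leq_trans (leq_addl _ _).
    by rewrite -[X in _ <= X]mul1n leq_mul2r h orbT.
  apply/subsetP => B BL; rewrite inE; apply: contraNT hA => BA.
  have /imsetP[y] := BL; rewrite inE => /andP[_ hy] eB; rewrite -eB in hy.
  apply: (leq_trans hy); rewrite leq_mul2l /=; apply: subset_leq_card.
  by rewrite -disjoints_subset; apply: (trivIsetP tI).
apply: leq_trans (leq_addr _ _); rewrite -sum_nat_const.
apply: (@leq_trans (\sum_(A in large_comps Z) \sum_(x in A) ndeg Z x)).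
  apply: leq_sum => A AL; have := hL A; rewrite AL negbK => hA.
  have /imsetP[x] := AL; rewrite inE => /andP[xZ hx] eA.
  apply: (@leq_trans (nabla A)); first by apply: iso => //; rewrite eA.
  apply: leq_sum => y; rewrite eA => yA; apply/subset_leq_card/subsetP => j.
  rewrite [j \in _]inE [j \in [set _ | _]]inE in_setC => /negbTE h.
  by have := comp_off_step j xZ yA; rewrite in_setU h.
rewrite -(big_trivIset _ tI) /=; apply: (@leq_trans (\sum_(x in setT) ndeg Z x)).
  exact/leq_sum_sub/subsetT.
rewrite ndeg_exchange mulnC -sum_nat_const; apply: leq_sum => y _.
exact: ndeg_le.
Qed.

(** The set off which [corrected] has no boundary edge, with [nb A] as the cover. It is computed
    from [A] alone, without reference to [U]. *)
Definition enlarge m A : {set G} :=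
  let Z := nb A in let Z1 := [set x | m <= ndeg Z x] in
  Z :|: Z1 :|: [set x | m <= ndeg Z1 x].

(** 111 = 1 + 10 + 100: each of the two threshold steps multiplies the size by at most [D / m], that
    is by 10. *)
Lemma card_enlarge m A : 0 < m -> D <= 10 * m -> #|enlarge m A| <= 111 * (D * #|A|).
Proof.
move=> m0 Dm; have step S : #|[set x | m <= ndeg S x]| <= 10 * #|S|.
  rewrite -(leq_pmul2r m0); apply: (@leq_trans (D * #|S|)).
    by apply: ndeg_markov => x; rewrite inE.
  by rewrite mulnAC leq_mul2r Dm orbT.
have := card_nb A; have := step (nb A); have := step [set x | m <= ndeg (nb A) x].
rewrite /enlarge; set Z := nb A; set Z1 := [set x | m <= ndeg Z x].
set Z2 := [set x | m <= ndeg Z1 x].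
have := leq_cardU (Z :|: Z1) Z2; have := leq_cardU Z Z1; lia.
Qed.

Definition core lab : {set G} := [set x in cover lab | par x].
Definition upper_env psi F : {set G} := [set u | ~~ par u & ndeg (~: F) u < psi].
(** [upper_env] contains the bulk of [U]. The points outside [U] that have to be removed from it all
    lie in this thin part, whose size is of order [D * (#|Z| + B)]; this makes the choice of [Y4]
    affordable. *)
Definition boundary_env psi F : {set G} := [set u in upper_env psi F | 0 < ndeg (~: F) u].

(* In a code (A, lab, Y3, Y4), A determines a small set Z covering the boundary of (a correction
   of) U, lab lists the large components off Z that lie in U, and Y3 and Y4 are greedy covers of
   the odd points of U still missing and of the even points outside U still present. *)
Definition code := ({set G} * {set {set G}} * {set G} * {set G})%type.
Definition code_F1 (c : code) := core c.1.1.2 :|: nb c.1.2.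
Definition code_S psi (c : code) := upper_env psi (code_F1 c) :\: nb c.2.
Definition code_F psi (c : code) :=
  code_F1 c :|: [set v | par v & psi <= ndeg (code_S psi c) v].

(** The [psi]-approximation of the container method: [F] approximates the odd points of [U] from
    inside and [S] its even points from outside; a point of [S] misses [F], and an odd point outside
    [F] meets [S], along fewer than [psi] edges. *)
Definition approx psi F S U :=
  [/\ F \subset U, forall x, x \in F -> par x, forall u, u \in U -> ~~ par u -> u \in S,
      forall u, u \in S -> ~~ par u /\ ndeg (~: F) u < psi
    & forall v, par v -> v \notin F -> ndeg S v < psi].

Definition nolone U := forall x, x \in bnd U -> exists j, (stp j x \in U) = (x \in U).

Definition good_code m psi rho B (c : code) :=
  let Z := enlarge m c.1.1.1 in
  [&& rooted (fun x y => y \in near 9 [set x]) rho c.1.1.1,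
      #|c.1.1.1 :\: rho| * m <= 4 * B,
      c.1.1.2 \subset large_comps Z,
      c.1.2 \subset nb (Z :|: nb Z),
      #|c.1.2| * psi <= 3 * #|Z| + 4 * B,
      c.2 \subset nb (boundary_env psi (code_F1 c)),
      #|c.2| * psi <= 2 * B
    & #|boundary_env psi (code_F1 c)| <= D * (3 * #|Z| + 4 * B) + 2 * B].

Lemma approx_exists U rho m psi B :
  oddset U -> nolone U -> nabla U = D * B -> rooted adj rho (bnd U) ->
  0 < m -> 8 * m <= D -> 0 < psi -> 2 * psi <= D ->
  exists2 c, good_code m psi rho B c & approx psi (code_F psi c) (code_S psi c) U.
Proof.
move=> oU nU BU rU m0 mD psi0 psiD.
have D0 : 0 < D by lia.
have UE u j : u \in U -> ~~ par u -> stp j u \in U.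
  by move=> uU; apply: contraR => /(oU _ _ uU).
have hH := card_high D0 BU.
(* [high U] meets all boundary edges but is too large to be named; a cover missing fewer than [m]
   high points around each point suffices for the correction. Adding [rho] makes [A] rooted in the
   distance-9 graph, so that it can be counted. *)
have [Y [YP cY covY]] := greedy_cover predT (high U) m0.
pose A := Y :|: rho; pose Z := enlarge m A.
have YA : nb Y \subset nb A by rewrite nbS // subsetUl.
have cov y : ndeg (high U :\: nb A) y < m.
  by apply: leq_ltn_trans (covY y isT); apply: ndegS; rewrite setDS.
have nb_in x j : stp j x \in high U -> exists2 k, k \in bnd U & k \in near 1 [set x].
  by move=> h; exists (stp j x); rewrite ?near1_stp ?(high_bnd D0 h).
have rA : rooted (fun x y => y \in near 9 [set x]) rho A.
  apply: (rooted_near rU); first exact: subsetUr.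
    have hnear h : h \in high U -> exists2 y, y \in A & y \in near 3 [set h].
      have nZ x : x \in nb A -> exists2 y, y \in A & y \in near 1 [set x].
        by case/nbP=> j jA; exists (stp j x); rewrite ?near1_stp.
      have nZ1 x : m <= ndeg (nb A) x -> exists2 y, y \in A & y \in near 2 [set x].
        move=> /(leq_trans m0) xZ; have /nbP[j /nZ[y yA h1]] : x \in nb (nb A) by rewrite inE.
        by exists y => //; apply: (@near_le _ (1 + 1) 2 x y isT (near_trans (near1_stp x j) h1)).
      have nZ2 x : x \in nb [set x | m <= ndeg (nb A) x] ->
          exists2 y, y \in A & y \in near 3 [set x].
        case/nbP=> j; rewrite inE => /nZ1[y yA h1].
        by exists y => //; apply: (@near_le _ (2 + 1) 3 x y isT (near_trans (near1_stp x j) h1)).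
      move=> hh; have [/nZ[y yA hy]|hnA] := boolP (h \in nb A).
        by exists y => //; apply: near_le hy.
      have [/nZ1[y yA hy]|hn1] := boolP (m <= ndeg (nb A) h).
        by exists y => //; apply: near_le hy.
      have [j hj] := nU _ (high_bnd D0 hh); apply: nZ2; apply/nbP; exists j.
      by apply: (nbr_high oU m0 mD cov hh _ hj); rewrite inE.
    move=> k /bndP[j kj]; case/orP: (edge_high oU kj) => /hnear[y yA hy]; exists y; try exact: yA.
      exact: (@near_le _ 3 4 k y isT hy).
    exact: (@near_le _ (3 + 1) 4 k y isT (near_trans (near1_stp k j) hy)).
  move=> y; rewrite in_setU => /orP[/YP[_ /nbP[j]]|yr]; first exact: nb_in.
  exists y; last by apply: (@near_le _ 0 1 y y isT); rewrite near0 inE.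
  by have /rootedP[/subsetP sr _] := rU; apply: sr.
(* [Ut] is constant on every component off [Z], so the large components inside it, listed by [lab],
   are a cheap description. It differs from [U] only at uncovered high points. *)
pose Ut := corrected U (nb A) m.
have UtE x : (x \in Ut) = (x \in U) (+) (x \in high U :\: Z) by rewrite inE.
have Ut_step := corrected_edge oU m0 mD cov.
pose lab := [set comp_off Z x | x in [set x in Ut | (x \notin Z) && (D <= 2 * #|comp_off Z x|)]].
have labL : lab \subset large_comps Z.
  by apply: imsetS; apply/subsetP => x; rewrite !inE => /andP[_ ->].
have Ut_const x y : y \in comp_off Z x -> (y \in Ut) = (x \in Ut).
  rewrite inE => /connectP[p pp ->]; elim: p x pp => //= z p IH x1.
  case/andP=> /and3P[x1Z zZ /existsP[j /eqP ez]] /IH ->.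
  by rewrite ez; apply: Ut_step => //; rewrite -ez.
have labU y : y \in cover lab -> y \in Ut /\ y \notin Z.
  case/bigcupP=> C /imsetP[x]; rewrite inE => /and3P[xU xZ _] -> yx.
  by rewrite (Ut_const _ _ yx) (comp_off_notin xZ yx).
have coreU : core lab \subset U.
  apply/subsetP => x; rewrite inE => /andP[/labU[xt xZ] px].
  move: xt; rewrite UtE; have [//|xU /=] := boolP (x \in U).
  rewrite in_setD => /andP[_ /(high_bnd D0)/(bnd_par oU)]; by rewrite px (negbTE xU).
(* An odd point of [U] escapes the core only if it lies in [Z], or in a small component, which puts
   half of its neighbours into [Z], or if the correction flips it. This bounds [E0] by a multiple of
   [#|Z|] plus [#|high U|]. *)
pose E0 := [set x in U | par x] :\: core lab.
have bad_nbZ x : x \in high U -> x \notin Z -> x \in nb Z.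
  move=> xH xZ; have [j hj] := nU _ (high_bnd D0 xH); apply/nbP; exists j.
  rewrite in_setU in_setU (nbr_high oU m0 mD cov xH _ hj) ?orbT //.
  by apply: contra xZ; rewrite !in_setU => ->; rewrite orbT.
have E0P x : x \in E0 -> [|| x \in Z, D <= 2 * ndeg Z x | x \in high U :\: Z].
  case/setDP=> xUp xc; have /andP[xU px] : (x \in U) && par x by rewrite inE in xUp.
  rewrite inE px andbT in xc.
  have [//|xZ /=] := boolP (x \in Z).
  have [//|xs /=] := boolP (D <= _); apply: contraR xc => xH.
  have xt : x \in Ut by rewrite UtE xU (negbTE xH).
  apply/bigcupP; exists (comp_off Z x); last exact: comp_off_id.
  apply: imset_f; rewrite inE xt xZ /=; apply: contraR xs; exact: small_comp_nb.
have E0Z : E0 \subset Z :|: nb Z.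
  apply/subsetP => x /E0P/or3P[xZ|xZ|]; rewrite in_setU ?xZ //.
    by rewrite orbC inE; move: xZ; lia.
  by rewrite in_setD => /andP[xZ xH]; rewrite (bad_nbZ _ xH xZ) orbT.
have cE0 : #|E0| <= 3 * #|Z| + 4 * B.
  have c2 : #|[set x | D <= 2 * ndeg Z x]| <= 2 * #|Z|.
    rewrite -(leq_pmul2r D0).
    have := @ndeg_markov _ [set x | D <= 2 * ndeg Z x] Z (uphalf D) _.
    have h : forall x, x \in [set x | D <= 2 * ndeg Z x] -> uphalf D <= ndeg Z x.
      by move=> x; rewrite inE; lia.
    by move=> /(_ h); nia.
  have sE : E0 \subset (Z :|: [set x | D <= 2 * ndeg Z x]) :|: (high U :\: Z).
    apply/subsetP => x /E0P/or3P[h|h|h]; rewrite in_setU ?h ?orbT // in_setU ?h //.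
    by rewrite [x \in [set _ | _]]inE h orbT.
  have := subset_leq_card sE; have := leq_cardU (Z :|: [set x | D <= 2 * ndeg Z x]) (high U :\: Z).
  have := leq_cardU Z [set x | D <= 2 * ndeg Z x].
  have := subset_leq_card (subsetDl (high U) Z); lia.
(* Neighbours of an even point of [U] lie in [U], so adding [nb Y3] keeps [F1] inside [U]. Dually,
   odd points outside [U] have no neighbour in [U], so removing [nb Y4] below loses no even point of
   [U]. *)
have [Y3 [Y3P cY3 covY3]] := greedy_cover (fun y => (y \in U) && ~~ par y) E0 psi0.
pose F1 := core lab :|: nb Y3.
have F1U x : x \in F1 -> (x \in U) /\ par x.
  rewrite in_setU => /orP[xc|/nbP[j /Y3P[/andP[jU jp] _]]].
    by rewrite (subsetP coreU) //; move: xc; rewrite inE => /andP[].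
  by have := UE _ (opp j) jU jp; rewrite stpK => ->; move: jp; rewrite par_stp negbK.
have envU u : u \in U -> ~~ par u -> u \in upper_env psi F1.
  move=> uU up; rewrite inE up /=; apply: leq_ltn_trans (covY3 u _); last by rewrite uU.
  apply/subset_leq_card/subsetP => j.
  rewrite [j \in _]inE in_setC in_setU negb_or => /andP[c1 c3].
  rewrite [j \in _]inE in_setD c3 in_setD c1 /= [_ \in [set _ | _]]inE.
  by rewrite UE // par_stp up.
have outS u : u \in upper_env psi F1 -> u \notin U -> D <= 2 * bdeg U u.
  rewrite inE => /andP[up uF] uU; rewrite (bdeg_out uU).
  have := ndegC F1 u; have : ndeg F1 u <= ndeg U u.
    by apply: ndegS; apply/subsetP => x /F1U[].
  lia.
pose S0 := upper_env psi F1 :\: U.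
(* Each point of [S0] has at least [D / 2] neighbours in [F1], hence in [U], so that many of the
   [D * B] boundary edges end there. *)
have cS0 : #|S0| <= 2 * B.
  rewrite -(leq_pmul2r D0) -sum_nat_const.
  apply: (@leq_trans (\sum_(u in S0) 2 * ndeg U u)).
    by apply: leq_sum => u; rewrite in_setD => /andP[uU /outS/(_ uU)]; rewrite bdeg_out.
  rewrite -big_distrr /= -mulnA leq_mul2l /= mulnC -BU -nablaC /nabla setCK.
  by apply: leq_sum_sub; apply/subsetP => u; rewrite in_setD in_setC => /andP[].
have S0env u : u \in S0 -> u \in boundary_env psi F1.
  rewrite in_setD => /andP[uU uS]; rewrite inE uS /= card_gt0; apply/set0Pn.
  have [j] : exists j, stp j u \notin F1.
    have [ub|ub] := boolP (u \in bnd U).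
      have [j hj] := nU _ ub; exists j; apply/negP => /F1U[].
      by rewrite hj (negbTE uU).
    have /card_gt0P[j _] := D0; exists j; apply/negP => /F1U[jU _].
    by move/bndP: ub; apply; exists j; rewrite jU (negbTE uU).
  by exists j; rewrite inE in_setC.
have [Y4 [Y4P cY4 covY4]] := greedy_cover (fun y => (y \notin U) && par y) S0 psi0.
pose S := upper_env psi F1 :\: nb Y4.
have SU u : u \in U -> ~~ par u -> u \in S.
  move=> uU up; rewrite in_setD (envU u uU up) andbT; apply/nbP => -[j /Y4P[/andP[jU _] _]].
  by rewrite (UE _ j uU up) in jU.
have ndegS_out v : par v -> v \notin U -> ndeg S v < psi.
  move=> pv vU; apply: leq_ltn_trans (covY4 v _); last by rewrite vU pv.
  apply/subset_leq_card/subsetP => j; rewrite [j \in _]inE [j \in [set _ | _]]inE.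
  rewrite ![_ \in _ :\: nb Y4]in_setD => /andP[-> jS]; rewrite in_setD jS andbT /=.
  apply: contra vU => jU; have := UE _ (opp j) jU _; rewrite stpK; apply.
  by move: jS; rewrite inE => /andP[].
pose c : code := (A, lab, Y3, Y4); exists c.
  have Y4s : Y4 \subset nb (boundary_env psi F1).
    apply/subsetP => y /Y4P[_]; apply: subsetP; apply: nbS; apply/subsetP; exact: S0env.
  have Y3s : Y3 \subset nb (Z :|: nb Z).
    by apply/subsetP => y /Y3P[_]; apply: subsetP; apply: nbS.
  have cA : #|A :\: rho| * m <= 4 * B.
    apply: leq_trans (leq_trans cY hH); rewrite leq_mul2r; apply/orP; right.
    by apply: subset_leq_card; rewrite /A setDUl setDv setU0 subsetDl.
  have cenv : #|boundary_env psi F1| <= D * (3 * #|Z| + 4 * B) + 2 * B.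
    have sub : boundary_env psi F1 \subset nb E0 :|: S0.
      apply/subsetP => u; rewrite inE => /andP[uS]; rewrite card_gt0 => /set0Pn[j].
      rewrite inE in_setC => jF; rewrite in_setU orbC in_setD uS andbT.
      have [uU /=|//] := boolP (u \in U); apply/nbP; exists j.
      have up : ~~ par u by move: uS; rewrite inE => /andP[].
      rewrite in_setD inE UE // par_stp up /= andbT.
      by apply: contra jF => h; rewrite in_setU h.
    apply: leq_trans (subset_leq_card sub) _; apply: leq_trans (leq_cardU _ _) _.
    by apply: leq_add cS0; apply: leq_trans (card_nb _) _; rewrite leq_mul2l cE0 orbT.
  rewrite /good_code /= rA cA labL Y3s (leq_trans cY3 cE0) Y4s (leq_trans cY4 cS0).
  exact: cenv.
split.
- apply/subsetP => x; rewrite in_setU => /orP[/F1U[]//|]; rewrite inE => /andP[px].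
  by apply: contraLR => xU; rewrite -ltnNge; apply: ndegS_out.
- by move=> x; rewrite in_setU => /orP[/F1U[]//|]; rewrite inE => /andP[].
- exact: SU.
- move=> u; rewrite in_setD => /andP[_]; rewrite inE => /andP[up uF]; split=> //.
  by apply: leq_ltn_trans uF; apply: ndegS; rewrite setCS subsetUl.
- move=> v pv; rewrite in_setU negb_or => /andP[_]; rewrite inE pv /= -ltnNge.
  by apply.
Qed.

End Approximation.

Lemma card_dep_le (R : numDomainType) (T1 T2 : finType) (S : {set T1 * T2}) (P : {set T1})
    (Q : T1 -> {set T2}) (a b : R) :
  (forall c, c \in S -> c.1 \in P /\ c.2 \in Q c.1) ->
  (#|P|%:R <= a)%R -> (forall t, t \in P -> (#|Q t|%:R <= b)%R) -> (0 <= b)%R ->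
  (#|S|%:R <= a * b)%R.
Proof.
move=> hS hP hQ b0; apply: (@le_trans _ _ (#|P|%:R * b)%R); last by rewrite ler_wpM2r.
apply: (@le_trans _ _ (\sum_(t in P) #|Q t|)%:R%R).
  rewrite ler_nat; pose f (t : T1) (u : T2) := (t, u).
  apply: (@leq_trans #|\bigcup_(t in P) [set (t, u) | u in Q t]|).
    apply/subset_leq_card/subsetP => -[t u] /hS[/= tP uQ]; apply/bigcupP; exists t => //.
    exact: imset_f.
  elim/big_rec2: _ => [|t n A _ IH]; first by rewrite cards0.
  by apply: leq_trans (leq_cardU _ _) _; apply: leq_add IH; apply: leq_imset_card.
rewrite natr_sum mulr_natl -sumr_const; exact: ler_sum.
Qed.

Section CountCodes.
Variables (G : step_graph) (R : realFieldType).
Local Notation D := #|dir G|.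
Local Open Scope ring_scope.

(** The factors count [A], [lab], [Y3] and [Y4], chosen in this order. The roots and the further
    points of [A] number at most [8 * B / m] together and [D <= 10 * m], so [z] bounds the size of
    [enlarge m A]. *)
Lemma card_good_codes (rho : {set G}) (m psi q nl B : nat) (x : R) :
  (0 < m)%N -> (D <= 10 * m)%N -> (0 < psi)%N -> (#|rho| * m <= 4 * B)%N ->
  (forall A : {set G}, D <= 2 * #|A| -> D <= 2 * #|~: A| -> q <= nabla A)%N ->
  0 < x <= 1 ->
  let z := (111 * (10 * (8 * B)))%N in
  (D * z + q < nl.+1 * q)%N ->
  #|[set c | good_code m psi rho B c]|%:R <=
    ((4 * D.+1 ^ 9) ^ (4 * B %/ m) * 2 ^ #|rho|)%N%:R * 2 ^+ nl *
    ((1 + x) ^+ (D * (z + D * z)) * x ^- ((3 * z + 4 * B) %/ psi)) *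
    ((1 + x) ^+ (D * (D * (3 * z + 4 * B) + 2 * B)) * x ^- (2 * B %/ psi)).
Proof.
move=> m0 Dm psi0 hrho iso /andP[x0 x1] z hnl.
pose g : rel G := fun u v => v \in near 9 [set u].
pose P1 := [set A : {set G} | rooted g rho A & (#|A :\: rho| <= 4 * B %/ m)%N].
have cZ A : A \in P1 -> (#|enlarge m A| <= z)%N.
  rewrite inE leq_divRL // => /andP[/rootedP[sA _] hA].
  apply: leq_trans (card_enlarge _ m0 Dm) _; rewrite leq_mul2l /=.
  apply: leq_trans (leq_mul Dm (leqnn _)) _; rewrite -mulnA leq_mul2l /= mulnC.
  by rewrite -(cardsID rho A) (setIidPr sA); lia.
have sub_le (M : {set G}) n N : (#|M| <= N)%N ->
    #|[set Y : {set G} | Y \subset M & (#|Y| <= n)%N]|%:R <= (1 + x) ^+ N * x ^- n.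
  move=> MN; rewrite ler_pdivlMr ?exprn_gt0 //.
  apply: le_trans (card_small_subsets _ _ _) _; first by rewrite (ltW x0).
  by rewrite ler_weXn2l // lerDl ltW.
have pow0 N n : 0 <= (1 + x) ^+ N * x ^- n.
  by rewrite mulr_ge0 ?invr_ge0 ?exprn_ge0 ?addr_ge0 ?ltW.
pose P2 := [set p : {set G} * {set {set G}} | p.1 \in P1 & p.2 \subset large_comps (enlarge m p.1)].
pose env (p : {set G} * {set {set G}} * {set G}) := boundary_env psi (core p.1.2 :|: nb p.2) : {set G}.
pose Q3 (p : {set G} * {set {set G}}) := [set Y : {set G} |
  Y \subset nb (enlarge m p.1 :|: nb (enlarge m p.1)) & (#|Y| <= (3 * z + 4 * B) %/ psi)%N].
pose P3 := [set p : {set G} * {set {set G}} * {set G} | [&& p.1 \in P2, p.2 \in Q3 p.1 &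
   (#|env p| <= D * (3 * z + 4 * B) + 2 * B)%N]].
pose Q4 (p : {set G} * {set {set G}} * {set G}) := [set Y : {set G} | Y \subset nb (env p) & (#|Y| <= 2 * B %/ psi)%N].
apply: (@card_dep_le _ _ _ _ P3 Q4) => //.
- move=> [[[A lab] Y3] Y4]; rewrite inE => /and5P[/= rA cA labL sY3 /and4P[cY3 sY4 cY4 cE]].
  have AP : A \in P1 by rewrite inE leq_divRL // rA cA.
  have AZ := cZ _ AP; have pP2 : (A, lab) \in P2 by rewrite inE; apply/andP.
  have YQ3 : Y3 \in Q3 (A, lab).
    rewrite inE sY3 /= leq_divRL //; apply: leq_trans cY3 _.
    by rewrite leq_add2r leq_mul2l AZ orbT.
  have YQ4 : Y4 \in Q4 (A, lab, Y3) by rewrite inE leq_divRL // cY4 andbT.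
  split=> //; rewrite inE; apply/and3P; split=> //=; apply: (leq_trans cE).
  by rewrite leq_add2r leq_mul2l leq_add2r leq_mul2l AZ !orbT.
- apply: (@card_dep_le _ _ _ _ P2 Q3) => //.
  + by move=> p; rewrite inE => /and3P[].
  + apply: (@card_dep_le _ _ _ _ P1 (fun A => powerset (large_comps (enlarge m A)))).
    * by move=> p; rewrite inE => /andP[? ?]; rewrite powersetE.
    * rewrite ler_nat; apply: card_rooted => [|v].
        by rewrite expn_gt0.
      apply: leq_trans (_ : #|near 9 [set v]| <= _)%N.
        by apply/subset_leq_card/subsetP => w; rewrite inE.
      by rewrite -[X in (_ <= X)%N]muln1 -(cards1 v) card_near.
    * move=> A AP; rewrite card_powerset -natrX ler_nat leq_exp2l //.
      have := card_large_comps (enlarge m A) iso; have := cZ _ AP.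
      move=> h1 h2; rewrite -ltnS -(ltn_pmul2r (_ : 0 < q)%N); last by case: (q) hnl => //; rewrite !muln0.
      apply: leq_ltn_trans hnl; apply: leq_trans h2 _; by rewrite leq_add2r leq_mul2l h1 orbT.
    * by rewrite exprn_ge0.
  + move=> p; rewrite inE => /andP[/cZ h _]; apply: sub_le.
    apply: leq_trans (card_nb _) _; rewrite leq_mul2l; apply/orP; right.
    apply: leq_trans (leq_cardU _ _) _; apply: leq_add => //.
    by apply: leq_trans (card_nb _) _; rewrite leq_mul2l h orbT.
move=> p; rewrite inE => /and3P[_ _ h]; apply: sub_le.
by apply: leq_trans (card_nb _) _; rewrite leq_mul2l h orbT.
Qed.

End CountCodes.

(** * Shifting an independent set *)

Section Shift.
Variable G : step_graph.
Local Notation D := #|dir G|.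
Implicit Types (x y : G) (i j : dir G) (U F S T I : {set G}) (B : nat).

Definition stable I := [forall x in I, forall j, stp j x \notin I].

Lemma stableP I : reflect (forall x j, x \in I -> stp j x \notin I) (stable I).
Proof.
apply: (iffP forall_inP) => h x => [j /h/forallP|xI]; first exact.
by apply/forallP => j; apply: h.
Qed.

(** The second clause keeps the shifted points inside [U] and the shifted set stable. The last two
    give every boundary point a neighbour on its own side, and they make [U] recoverable from the
    occupied points of [S] ([approx_determined]). *)
Definition good I U := [/\ oddset U,
  forall x j, x \in U -> stp j x \notin U -> x \notin I /\ stp j x \notin I,
  forall x, x \in U -> x \in bnd U -> exists j, stp j x \in I :&: U
  & forall y, y \notin U -> y \in bnd U -> exists j, stp j y \notin U].

Lemma good_odd I U : good I U -> oddset U. Proof. by case. Qed.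

Lemma good_nolone I U : good I U -> nolone U.
Proof.
move=> [_ _ h1 h2] x xb; have [xU|xU] := boolP (x \in U).
  by have [j] := h1 _ xU xb; rewrite inE => /andP[_ jU]; exists j.
by have [j jU] := h2 _ xU xb; exists j; apply: negbTE.
Qed.

(* Moving [I] one step inside [U] frees the points of [inflow U j], any subset [T] of which can then
   be occupied; this gains a factor (1 + lambda) ^ #|inflow U j|. *)
Definition shift j U I T := (I :\: U) :|: stp j @: (I :&: U) :|: T.

Section Fixed.
Variables (j : dir G) (U I T : {set G}).
Hypotheses (sI : stable I) (gU : good I U) (sT : T \subset inflow U j).

Let avoid x k : x \in U -> stp k x \notin U -> x \notin I /\ stp k x \notin I.
Proof. by have [_ h _ _] := gU; apply: h. Qed.

Lemma shift_stp x : x \in I -> x \in U -> stp j x \in U.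
Proof. by move=> xI xU; apply: contraLR xI => /(avoid xU)[]. Qed.

Lemma mem_stp_imset x : (x \in stp j @: (I :&: U)) = (stp (opp j) x \in I :&: U).
Proof.
apply/imsetP/idP => [[y yIU ->]|h]; first by rewrite stpK.
by exists (stp (opp j) x); rewrite ?stpVK.
Qed.

Lemma shift_in x : x \in U -> (x \in shift j U I T) = (stp (opp j) x \in I :&: U) || (x \in T).
Proof. by move=> xU; rewrite /shift !in_setU in_setD xU /= mem_stp_imset. Qed.

Lemma shift_out x : x \notin U -> (x \in shift j U I T) = (x \in I).
Proof.
move=> xU; rewrite /shift !in_setU in_setD xU mem_stp_imset /=.
have -> : x \in T = false.
  by apply/negP => /(subsetP sT); rewrite inE (negbTE xU).
have -> : (stp (opp j) x \in I :&: U) = false; last by rewrite !orbF.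
by apply/negP; rewrite in_setI => /andP[h1 h2]; have := shift_stp h1 h2; rewrite stpVK (negbTE xU).
Qed.

Lemma card_shift : #|shift j U I T| = #|I| + #|T|.
Proof.
rewrite /shift cardsU.
have -> : (I :\: U :|: stp j @: (I :&: U)) :&: T = set0.
  apply/setP => x; rewrite !inE; apply/negP => /andP[h /(subsetP sT)].
  rewrite inE => /andP[xU /negbTE xj]; move: h.
  by rewrite xU /= mem_stp_imset in_setI xj andbF.
rewrite cards0 subn0 cardsU.
have -> : (I :\: U) :&: stp j @: (I :&: U) = set0.
  apply/setP => x; rewrite in_setI in_setD in_set0; apply/negP => /andP[/andP[xU _]].
  case/imsetP=> y; rewrite in_setI => /andP[yI yU] ex.
  by have := shift_stp yI yU; rewrite -ex (negbTE xU).
rewrite cards0 subn0 card_imset; last exact: stp_injr.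
by rewrite -(cardsID U I) [#|I :&: U| + _]addnC.
Qed.

Lemma shift_stable : stable (shift j U I T).
Proof.
have hI := stableP _ sI.
have inT x : x \in T -> x \in U /\ stp (opp j) x \notin U.
  by move/(subsetP sT); rewrite inE => /andP[].
have mixed x k : x \in T -> stp (opp j) (stp k x) \in I :&: U -> false.
  move=> /inT[xU xj]; rewrite in_setI => /andP[yI yU].
  have := @avoid (stp (opp j) (stp k x)) (opp k) yU.
  by rewrite stpC stpK => /(_ xj)[]; rewrite yI.
apply/stableP => x k; have [xU|xU] := boolP (x \in U); have [yU|yU] := boolP (stp k x \in U).
- rewrite !shift_in // negb_or => /orP[xI|xT]; apply/andP; split.
  + apply: contraL xI; rewrite !in_setI stpC => /andP[h _].
    by have := hI _ (opp k) h; rewrite stpK => /negbTE ->.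
  + apply/negP => yT; have := @mixed (stp k x) (opp k) yT; by rewrite stpK => /(_ xI).
  + by apply/negP => /(mixed _ _ xT).
  + apply/negP => /inT[_ yj]; have [_ xj] := inT _ xT; have [oU _ _ _] := gU.
    have := oU _ _ yU yj; by rewrite par_stp (oU _ _ xU xj).
- by rewrite (shift_out yU) => _; have [] := avoid xU yU.
- rewrite (shift_out xU) => xI; have := @avoid (stp k x) (opp k) yU.
  by rewrite stpK xI => /(_ xU)[].
by rewrite !shift_out // => xI; apply: hI.
Qed.

End Fixed.

(** A point [x] of [U] is occupied exactly if [stp j x] is in [U] and in the shifted set, because
    the points of [T] are reached along [j] from outside [U] only. *)
Lemma shift_inj j U I1 I2 T1 T2 : good I1 U -> good I2 U ->
  T1 \subset inflow U j -> T2 \subset inflow U j ->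
  shift j U I1 T1 = shift j U I2 T2 -> I1 = I2 /\ T1 = T2.
Proof.
move=> g1 g2 s1 s2 e.
have inU I T x : good I U -> T \subset inflow U j -> x \in U ->
    (x \in I) = (stp j x \in U) && (stp j x \in shift j U I T).
  move=> g sT xU; apply/idP/andP => [xI|[jU]].
    have jU := shift_stp j g xI xU.
    by rewrite jU shift_in // stpK in_setI xI xU.
  rewrite shift_in // stpK in_setI => /orP[/andP[]//|/(subsetP sT)].
  by rewrite inE stpK xU andbF.
have eI : I1 = I2.
  apply/setP => x; have [xU|xU] := boolP (x \in U).
    by rewrite (inU _ _ _ g1 s1 xU) (inU _ _ _ g2 s2 xU) e.
  by rewrite -(shift_out g1 s1 xU) -(shift_out g2 s2 xU) e.
split=> //.
have inT I T x : T \subset inflow U j -> (x \in T) = (x \in inflow U j) && (x \in shift j U I T).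
  move=> sT; apply/idP/andP => [xT|[]].
    by split; [apply: (subsetP sT)|rewrite /shift in_setU xT orbT].
  rewrite inE => /andP[xU xj]; rewrite shift_in // in_setI (negbTE xj) andbF.
  by [].
by apply/setP => x; rewrite (inT I1 _ _ s1) (inT I2 _ _ s2) e.
Qed.

Section Transfer.
Variables (R : numFieldType) (lambda : R).
Local Open Scope ring_scope.
Hypothesis lambda0 : 0 < lambda.

Definition weight I : R := lambda ^+ #|I|.
Definition partition_fun : R := \sum_(I | stable I) weight I.

Lemma weight_ge0 I : 0 <= weight I.
Proof. by rewrite exprn_ge0 ?ltW. Qed.

(** [(1 + lambda) ^+ #|Rf I|] expands over the subsets [T] of [Rf I], and
    [weight I * lambda ^+ #|T|] is the weight of the shifted set. Pairs [(I, T)] inject into pairs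
    of a label and a stable set, so each label costs one partition function. *)
Lemma transfer (L : finType) (II : {set {set G}}) (Uf Rf : {set G} -> {set G})
    (lab : {set G} -> L) (Ls : {set L}) j :
  (forall I, I \in II -> [/\ stable I, good I (Uf I), Rf I \subset inflow (Uf I) j & lab I \in Ls]) ->
  (forall I1 I2 T1 T2, I1 \in II -> I2 \in II -> T1 \subset Rf I1 -> T2 \subset Rf I2 ->
     lab I1 = lab I2 -> shift j (Uf I1) I1 T1 = shift j (Uf I2) I2 T2 -> I1 = I2) ->
  \sum_(I in II) weight I * (1 + lambda) ^+ #|Rf I| <= #|Ls|%:R * partition_fun.
Proof.
move=> hII inj.
pose P := [set p : {set G} * {set G} | p.1 \in II & p.2 \subset Rf p.1].
pose h (p : {set G} * {set G}) := (lab p.1, shift j (Uf p.1) p.1 p.2).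
have hP p : p \in P -> weight p.1 * weight p.2 = weight (h p).2.
  rewrite inE => /andP[/hII[sI gI sR _] sT].
  by rewrite /weight /= card_shift ?exprD // (subset_trans sT).
apply: (@le_trans _ _ (\sum_(p in P) weight (h p).2)).
  rewrite le_eqVlt; apply/orP; left; apply/eqP.
  under eq_bigr do rewrite -prodr_const prod_1D_sub mulr_sumr.
  rewrite pair_big_dep /=; apply: eq_big => [p|p hp]; first by rewrite inE.
  have pP : p \in P by rewrite inE.
  by rewrite -(hP _ pP) prodr_const.
have injh : {in P &, injective h}.
  move=> [I1 T1] [I2 T2]; rewrite !inE /= => /andP[m1 s1] /andP[m2 s2] [el es].
  have e := inj _ _ _ _ m1 m2 s1 s2 el es; rewrite -e in es m2 s2 *.
  have [_ g1 r1 _] := hII _ m1; have [_ ->//] := shift_inj g1 g1 (subset_trans s1 r1) (subset_trans s2 r1) es.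
rewrite -(big_imset (fun q : L * {set G} => weight q.2) injh) /=.
apply: (@le_trans _ _ (\sum_(q in [set q : L * {set G} | (q.1 \in Ls) && stable q.2]) weight q.2)).
  rewrite [leRHS]big_mkcond [leLHS]big_mkcond; apply: ler_sum => q _.
  case: ifP => [/imsetP[p pP ->]|_]; last by case: ifP; rewrite ?weight_ge0.
  have /andP[/hII[sI gI sR lI] sT] : (p.1 \in II) && (p.2 \subset Rf p.1) by rewrite inE in pP.
  rewrite inE /= lI.
  by rewrite shift_stable // (subset_trans sT).
rewrite mulr_natl -sumr_const /partition_fun pair_big /= le_eqVlt; apply/orP; left.
by apply/eqP/eq_bigl => q; rewrite inE.
Qed.

End Transfer.
End Shift.

Section Cases.
Variable G : step_graph.
Local Notation D := #|dir G|.
Implicit Types (x y u v : G) (i j : dir G) (A U I T : {set G}).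
Variables (F S : {set G}) (psi : nat).
Hypotheses (D0 : 0 < D) (psi0 : 0 < psi) (psiD : 2 * psi <= D).

(* If many points of [inflow U j] are outside F for some j, they alone are used by the shift, and the
   label [dark j I] suffices to recover I; otherwise few odd points are missed by F, and listing
   them determines U. *)
Definition missed U : {set G} := [set x in U | par x] :\: F.

Lemma odd_even_in U u j : oddset U -> u \in U -> ~~ par u -> stp j u \in U.
Proof. by move=> oU uU; apply: contraR => /(oU _ _ uU). Qed.

Lemma odd_even_out U v j : oddset U -> v \notin U -> par v -> stp j v \notin U.
Proof.
move=> oU vU pv; apply: contra vU => jU; rewrite -(stpK j v).
by apply: (odd_even_in _ oU jU); rewrite par_stp pv.
Qed.

Lemma approx_in_nb U u : approx psi F S U -> u \in S -> exists2 j, stp j u \in U & stp j u \in F.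
Proof.
move=> [FU _ _ hS _] /hS[_ uF]; have := ndegC F u => h.
have /card_gt0P[j] : 0 < ndeg F u by lia.
by rewrite inE => jF; exists j => //; apply: (subsetP FU).
Qed.

(** A missed point has fewer than [psi] neighbours in [U], since these lie in [S]; so at least half
    of its edges are among the [D * B] boundary edges. The same holds for points of [S] outside [U].
    The remaining bounds count edges at these at most [2 * B] points of either kind. *)
Lemma approx_sizes U B : oddset U -> nabla U = D * B -> approx psi F S U ->
  [/\ #|missed U| <= 2 * B, \sum_(u in S) ndeg (~: F) u <= psi * (4 * B)
    & \sum_j #|[set v in missed U | stp (opp j) v \in U]| <= psi * #|missed U|].
Proof.
move=> oU nU [FU Fp US hS hF].
have mP v : v \in missed U -> [/\ v \in U, par v & v \notin F].
  by rewrite !inE => /and3P[-> -> ->].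
have mdeg v : v \in missed U -> ndeg U v < psi.
  move=> /mP[vU pv vF]; apply: leq_ltn_trans (hF _ pv vF).
  apply/subset_leq_card/subsetP => j; rewrite !inE => jU; apply: US => //.
  by rewrite par_stp pv.
have c1 : #|missed U| <= 2 * B.
  rewrite -(leq_pmul2r D0) -sum_nat_const; apply: (@leq_trans (\sum_(v in missed U) 2 * ndeg (~: U) v)).
    apply: leq_sum => v vm; have := mdeg _ vm; have := ndegC U v; lia.
  rewrite -big_distrr /= -mulnA leq_mul2l /= mulnC -nU; apply: leq_sum_sub.
  by apply/subsetP => v /mP[].
have c2 : #|S :\: U| <= 2 * B.
  rewrite -(leq_pmul2r D0) -sum_nat_const; apply: (@leq_trans (\sum_(v in S :\: U) 2 * ndeg U v)).
    apply: leq_sum => v; rewrite in_setD => /andP[vU /hS[pv vF]].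
    have := ndegS v FU; have := ndegC F v; lia.
  rewrite -big_distrr /= -mulnA leq_mul2l /= mulnC -nU -nablaC /nabla setCK; apply: leq_sum_sub.
  by apply/subsetP => v; rewrite in_setD in_setC => /andP[].
split=> //.
  rewrite (bigID (fun u => u \in U)) /=.
  apply: (@leq_trans (psi * (2 * B) + psi * (2 * B))); last by lia.
  apply: leq_add.
    apply: (@leq_trans (\sum_(u in S :&: U) ndeg (missed U) u)).
      rewrite [X in _ <= X](eq_bigl (fun u => (u \in S) && (u \in U))); last by move=> u; rewrite in_setI.
      apply: leq_sum => u /andP[/hS[pu _] uU]; apply/subset_leq_card/subsetP => j.
      by rewrite !inE => ->; rewrite (odd_even_in _ oU) // par_stp pu.
    rewrite ndeg_exchange; apply: (@leq_trans (\sum_(v in missed U) psi)).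
      apply: leq_sum => v vm; apply: ltnW; apply: leq_ltn_trans (mdeg _ vm).
      exact/ndegS/subsetIr.
    by rewrite sum_nat_const mulnC leq_mul2l c1 orbT.
  rewrite (eq_bigl (fun u => u \in S :\: U)) => [|u]; last by rewrite in_setD andbC.
  apply: (@leq_trans (\sum_(u in S :\: U) psi)).
    by apply: leq_sum => u; rewrite in_setD => /andP[_ /hS[_ /ltnW]].
  by rewrite sum_nat_const mulnC leq_mul2l c2 orbT.
rewrite (reindex_inj (inv_inj (@oppK G))) /=.
apply: (@leq_trans (\sum_(v in missed U) ndeg U v)).
  apply: eq_leq; under [RHS]eq_bigr do rewrite ndeg_sum; rewrite exchange_big /=; apply: eq_bigr => j _.
  rewrite -sum1_card [RHS]big_mkcond [LHS]big_mkcond /=; apply: eq_bigr => v _.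
  by rewrite [v \in [set _ | _]]inE oppK; case: (v \in missed U); case: (stp j v \in U).
rewrite mulnC -sum_nat_const; apply: leq_sum => v /mdeg; exact: ltnW.
Qed.

Definition dark j I : {set G} := [set u in S | (u \in I) && (stp j u \notin F)].

(** If [stp j u] is in [F], it is in [U] but not in [T], so it is in the shifted set exactly if [u]
    is in [I] and in [U]; and a point [u] outside [U] next to it is vacant. Only the other points of
    [S], the dark ones, need a label. *)
Lemma mem_bright I U T j u : stable I -> good I U -> approx psi F S U ->
  T \subset inflow U j :\: F -> u \in S ->
  (u \in I) = if stp j u \in F then stp j u \in shift j U I T else u \in dark j I.
Proof.
move=> sI gU aU sT uS; have [FU _ _ _ _] := aU; case: ifPn => jF; last first.
  by rewrite inE uS jF andbT.
have jU := subsetP FU _ jF; rewrite shift_in // stpK in_setI.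
have -> : stp j u \in T = false.
  by apply/negP => /(subsetP sT); rewrite in_setD jF.
rewrite orbF; have [uU|uU] := boolP (u \in U); first by rewrite andbT.
rewrite andbF; apply/negbTE; have [_ h _ _] := gU.
by have := h _ (opp j) jU; rewrite stpK => /(_ uU)[].
Qed.

Lemma occupied_in I U u : good I U -> approx psi F S U -> u \in S -> u \in I -> u \in U.
Proof.
move=> [_ h _ _] aU uS uI; have [j jU _] := approx_in_nb aU uS.
apply: contraLR uI => uU; have := h _ (opp j) jU; rewrite stpK => /(_ uU)[].
by [].
Qed.

(* A point of U1 outside U2 propagates to an odd one, all of whose neighbours lie in S although
   it is outside F; this contradicts the approximation property. *)
Lemma approx_determined I1 I2 U1 U2 : good I1 U1 -> good I2 U2 ->
  approx psi F S U1 -> approx psi F S U2 ->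
  (forall u, u \in S -> (u \in I1) = (u \in I2)) -> U1 \subset U2.
Proof.
move=> g1 g2 a1 a2 e12; have o1 := good_odd g1; have o2 := good_odd g2.
have [_ _ US1 _ _] := a1; have [FU2 _ _ _ hF] := a2.
have odd_case x : x \in U1 -> par x -> x \in U2.
  move=> x1 px; apply: contraT => x2.
  have nb1 j : stp j x \in U1.
    apply: contraT => j1; have [_ _ h _] := g1.
    have xb : x \in bnd U1 by apply/bndP; exists j; rewrite (negbTE j1) x1.
    have [k] := h _ x1 xb; rewrite in_setI => /andP[kI k1].
    have kS : stp k x \in S by apply: US1 => //; rewrite par_stp px.
    have k2 : stp k x \in U2 by apply: (occupied_in g2 a2 kS); rewrite -e12.
    by have := odd_even_out k o2 x2 px; rewrite k2.
  have xF : x \notin F by apply: contra x2; apply: (subsetP FU2).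
  have : D <= ndeg S x.
    rewrite -cardsT; apply/subset_leq_card/subsetP => j _; rewrite inE.
    by apply: US1 => //; rewrite par_stp px.
  have := hF _ px xF; lia.
apply/subsetP => x x1; have [px|px] := boolP (par x); first exact: odd_case.
apply: contraT => x2.
have [j j2] : exists j, stp j x \notin U2.
  have [xb|xb] := boolP (x \in bnd U2); first by have [_ _ _ h] := g2; apply: h.
  have /card_gt0P[j _] := D0; exists j; apply/negP => j2; move/bndP: xb; apply.
  by exists j; rewrite j2 (negbTE x2).
have := odd_case _ (odd_even_in j o1 x1 px); rewrite par_stp px (negbTE j2).
by move=> /(_ isT).
Qed.

Lemma recover I1 I2 U1 U2 T1 T2 j : stable I1 -> stable I2 -> good I1 U1 -> good I2 U2 ->
  approx psi F S U1 -> approx psi F S U2 ->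
  T1 \subset inflow U1 j :\: F -> T2 \subset inflow U2 j :\: F ->
  dark j I1 = dark j I2 -> shift j U1 I1 T1 = shift j U2 I2 T2 -> I1 = I2.
Proof.
move=> s1 s2 g1 g2 a1 a2 t1 t2 eA eJ.
have e12 u : u \in S -> (u \in I1) = (u \in I2).
  by move=> uS; rewrite (mem_bright s1 g1 a1 t1 uS) (mem_bright s2 g2 a2 t2 uS) eA eJ.
have eU : U1 = U2.
  apply/eqP; rewrite eqEsubset (approx_determined g1 g2) // (approx_determined g2 g1) //.
  by move=> u uS; rewrite e12.
rewrite -eU in g2 t2 eJ.
by have [] := shift_inj g1 g2 (subset_trans t1 (subsetDl _ _)) (subset_trans t2 (subsetDl _ _)) eJ.
Qed.

Lemma missed_inj I1 I2 U1 U2 : good I1 U1 -> good I2 U2 -> approx psi F S U1 -> approx psi F S U2 ->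
  missed U1 = missed U2 -> U1 = U2.
Proof.
move=> g1 g2 [F1 Fp1 _ _ _] [F2 _ _ _ _] e.
have oddE U x : F \subset U -> par x -> (x \in U) = (x \in F) || (x \in missed U).
  move=> FU px; rewrite in_setD inE px andbT; case: (boolP (x \in F)) => // /(subsetP FU) ->.
  by [].
have evenE I U x : good I U -> ~~ par x -> (x \in U) = [forall j, stp j x \in U].
  move=> g px; apply/idP/forallP => [xU j|h]; first exact: (odd_even_in _ (good_odd g)).
  apply: contraT => xU; have [_ _ _ hg] := g.
  have [|j] := hg _ xU; last by rewrite h.
  by have /card_gt0P[j _] := D0; apply/bndP; exists j; rewrite h (negbTE xU).
apply/setP => x; have [px|px] := boolP (par x); first by rewrite (oddE _ _ F1 px) (oddE _ _ F2 px) e.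
rewrite (evenE _ _ _ g1) // (evenE _ _ _ g2) //; apply: eq_forallb => j.
have pj : par (stp j x) by rewrite par_stp px.
by rewrite (oddE _ _ F1 pj) (oddE _ _ F2 pj) e.
Qed.

Lemma missed_nb I U : good I U -> approx psi F S U -> missed U \subset nb S :\: F.
Proof.
move=> g [_ _ US _ _]; apply/subsetP => v /setDP[vUp vF]; rewrite inE in vUp.
case/andP: vUp => vU pv; rewrite in_setD vF /=; have [j jU] : exists j, stp j v \in U.
  have [vb|vb] := boolP (v \in bnd U).
    by have [j] := good_nolone g vb; rewrite vU => jU; exists j.
  have /card_gt0P[j _] := D0; exists j; apply: contraT => jU.
  by move/bndP: vb; case; exists j; rewrite vU (negbTE jU).
by apply/nbP; exists j; apply: US => //; rewrite par_stp pv.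
Qed.

(** Averaging over directions: if every [j] failed, [D * (e j * z + 4 * B * f j)] would always
    exceed [8 * psi * B * z], contradicting the sums bounded in [approx_sizes]. Missed points not
    counted by [f j] are in the inflow along [j] and outside [F]. *)
Lemma good_direction I U B n : 4 * psi <= D -> good I U -> nabla U = D * B -> approx psi F S U ->
  n < #|missed U| -> exists j, D * #|[set u in S | stp j u \notin F]| <= 8 * psi * B
    /\ n.+1 <= 2 * #|inflow U j :\: F|.
Proof.
move=> psi4 g nU aU nm; have oU := good_odd g; have [c1 c2 c3] := approx_sizes oU nU aU.
have [FU _ _ _ _] := aU.
pose e j := #|[set u in S | stp j u \notin F]|.
pose f j := #|[set v in missed U | stp (opp j) v \in U]|.
set z := #|missed U| in c1 c3 nm *.
have se : \sum_j e j <= psi * (4 * B).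
  apply: leq_trans c2; apply: eq_leq; under [RHS]eq_bigr do rewrite ndeg_sum.
  rewrite exchange_big /=; apply: eq_bigr => j _.
  rewrite /e -sum1_card big_mkcond [RHS]big_mkcond /=; apply: eq_bigr => u _.
  by rewrite !inE; case: (u \in S); case: (_ \in F).
have fz j : z <= f j + #|inflow U j :\: F|.
  rewrite /z -(cardsID [set v | stp (opp j) v \in U]) leq_add //.
    by apply/subset_leq_card/subsetP => v; rewrite in_setI [v \in [set _ | stp _ _ \in _]]inE [v \in [set _ | _ & _]]inE.
  apply/subset_leq_card/subsetP => v /setDP[/setDP[vU vF] vj].
  rewrite inE in vj; rewrite inE in vU; case/andP: vU => vU _.
  by rewrite in_setD vF inE vU.
have [/existsP[j /andP[h1 h2]]|/existsPn h] :=
    boolP [exists j, (D * e j <= 8 * psi * B) && (4 * f j <= 2 * z)].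
  by exists j; split=> //; have := fz j; lia.
have zB : 0 < z * B by rewrite muln_gt0; lia.
have key j : 8 * psi * B * z < D * (e j * z + 4 * B * f j).
  have := h j; rewrite negb_and -!ltnNge mulnDr => /orP[h1|h1].
    by apply: ltn_addr; rewrite mulnA ltn_mul2r h1 andbT; lia.
  apply: ltn_addl; apply: (@leq_ltn_trans (D * (2 * (z * B)))).
    by rewrite [8 * psi](_ : _ = 2 * (4 * psi)); nia.
  by rewrite ltn_pmul2l //; nia.
have : D * \sum_j (e j * z + 4 * B * f j) <= D * (8 * psi * B * z).
  rewrite leq_mul2l big_split /= -big_distrl -big_distrr /=; apply/orP; right.
  apply: (@leq_trans (psi * (4 * B) * z + 4 * B * (psi * z))); last by lia.
  by apply: leq_add; rewrite ?leq_mul2r ?leq_mul2l ?se ?c3 ?orbT.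
rewrite big_distrr /= -sum_nat_const leqNgt; case/negP.
have /card_gt0P[j0 _] := D0.
rewrite (bigD1 j0) //= [X in _ < X](bigD1 j0) //= -addSn leq_add //.
by apply: leq_sum => j _; apply: ltnW.
Qed.

End Cases.

(** * Probability of an approximation and of a set of contours *)

Section Event.
Variables (G : step_graph) (R : realFieldType) (lambda : R).
Local Notation D := #|dir G|.
Local Notation w := (@weight G R lambda).
Local Notation Z := (partition_fun G lambda).
Hypotheses (D0 : 0 < D) (lambda0 : (0 < lambda)%R).
Implicit Types (F S U I rho : {set G}) (B psi : nat).

Definition approx_event psi F S B := [set I | stable I &
  `[< exists U, [/\ good I U, nabla U = D * B & approx psi F S U] >]].

Definition contour_event rho B := [set I | stable I &
  `[< exists U, [/\ good I U, nabla U = D * B & rooted adj rho (bnd U)] >]].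

Local Open Scope ring_scope.

(** With more than [n] missed points, a good direction frees at least [a] points outside [F], and
    the label is one of at most [2 ^+ e] sets of dark points. Otherwise the whole inflow of size [B]
    is freed, and the label lists at most [n] missed points among at most [psi * (4 * B)]
    candidates. *)
Lemma sum_approx_event psi F S B n e a (x : R) : (0 < psi)%N -> (4 * psi <= D)%N ->
  (8 * psi * B < D * e.+1)%N -> (2 * a <= n.+1)%N -> 0 < x <= 1 ->
  \sum_(I in approx_event psi F S B) w I <=
    (D%:R * 2 ^+ e * (1 + lambda) ^- a +
     (1 + x) ^+ (psi * (4 * B)) * x ^- n * (1 + lambda) ^- B) * Z.
Proof.
move=> psi0 psi4 he ha /andP[x0 x1]; have psiD : (2 * psi <= D)%N by lia.
have l1 : 1 <= 1 + lambda by rewrite lerDl ltW.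
have l0 : 0 < 1 + lambda by apply: lt_le_trans l1.
have w0 := weight_ge0 lambda0 (G := G).
have Z0 : 0 <= Z by apply: sumr_ge0.
set E := approx_event psi F S B.
have [Uf hUf] : exists Uf : {set G} -> {set G}, forall I, I \in E ->
    [/\ stable I, good I (Uf I), nabla (Uf I) = (D * B)%N & approx psi F S (Uf I)].
  have h I : exists U, I \in E -> [/\ stable I, good I U, nabla U = (D * B)%N & approx psi F S U].
    have [IE|_] := boolP (I \in E); last by exists set0.
    by move: (IE); rewrite inE => /andP[sI /asboolP[U [gU nU aU]]]; exists U.
  by have [Uf hUf] := choice h; exists Uf.
pose E2 := [set I in E | (#|missed F (Uf I)| <= n)%N].
pose E1 j := [set I in E | (D * #|[set u in S | stp j u \notin F]| <= 8 * psi * B)%N &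
   (n.+1 <= 2 * #|inflow (Uf I) j :\: F|)%N].
apply: (@le_trans _ _ (\sum_j \sum_(I in E1 j) w I + \sum_(I in E2) w I)).
  rewrite (bigID (mem E2)) /= addrC lerD //; last first.
    rewrite le_eqVlt; apply/orP; left; apply/eqP/eq_bigl => I.
    by rewrite andb_idl // inE => /andP[].
  rewrite (exchange_big_dep predT) //= [leLHS]big_mkcond; apply: ler_sum => I _.
  case: ifP => [/andP[IE]|_]; last by apply: sumr_ge0.
  rewrite inE IE /= -ltnNge => hn.
  have [sI gI nI aI] := hUf _ IE; have [j [h1 h2]] := good_direction D0 psi0 psiD psi4 gI nI aI hn.
  rewrite (bigD1 j) /=; last by rewrite inE IE h1.
  by rewrite lerDl sumr_ge0.
rewrite mulrDl; apply: lerD.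
  apply: (@le_trans _ _ (\sum_(j : dir G) 2 ^+ e * (1 + lambda) ^- a * Z)); last first.
    by rewrite sumr_const -!mulrA mulr_natl.
  apply: ler_sum => j _.
  have [->|[I0 hI0]] := set_0Vmem (E1 j).
    by rewrite big_set0 !mulr_ge0 ?invr_ge0 ?exprn_ge0 // ltW.
  have ej : (#|[set u in S | stp j u \notin F]| <= e)%N.
    move: hI0; rewrite inE => /and3P[_ h _].
    by rewrite -ltnS -(ltn_pmul2l D0); apply: leq_ltn_trans he.
  apply: (@le_trans _ _ (\sum_(I in E1 j) w I * (1 + lambda) ^+ #|inflow (Uf I) j :\: F| *
      (1 + lambda) ^- a)).
    apply: ler_sum => I; rewrite inE => /and3P[_ _ hI].
    by rewrite -mulrA ler_peMr // ler_pdivlMr ?exprn_gt0 // mul1r ler_weXn2l //; lia.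
  rewrite -mulr_suml mulrAC ler_wpM2r ?invr_ge0 ?exprn_ge0 ?(ltW l0) //.
  apply: le_trans (@transfer G R lambda lambda0 _ (E1 j) Uf (fun I => inflow (Uf I) j :\: F)
    (dark F S j) (powerset [set u in S | stp j u \notin F]) j _ _) _.
  - move=> I; rewrite inE => /and3P[/hUf[sI gI _ _] _ _]; split=> //; first exact: subsetDl.
    by rewrite powersetE; apply/subsetP => u; rewrite !inE => /and3P[-> _ ->].
  - move=> I1 I2 T1 T2; rewrite ![_ \in E1 j]inE.
    move=> /and3P[/hUf[s1 g1 _ a1] _ _] /and3P[/hUf[s2 g2 _ a2] _ _] t1 t2.
    exact: recover a1 a2 t1 t2.
  by rewrite ler_wpM2r // card_powerset -natrX ler_nat leq_exp2l.
have [->|[I0 hI0]] := set_0Vmem E2.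
  by rewrite big_set0 !mulr_ge0 ?invr_ge0 ?exprn_ge0 ?addr_ge0 // ltW.
have /card_gt0P[j _] := D0.
apply: (@le_trans _ _ (\sum_(I in E2) w I * (1 + lambda) ^+ #|inflow (Uf I) j| *
      (1 + lambda) ^- B)).
  apply: ler_sum => I; rewrite [I \in _]inE => /andP[/hUf[_ gI nI _] _].
  by rewrite (card_inflow_nabla j (good_odd gI) nI) mulfK // expf_neq0 // gt_eqF.
rewrite -mulr_suml mulrAC ler_wpM2r ?invr_ge0 ?exprn_ge0 ?(ltW l0) //.
apply: le_trans (@transfer G R lambda lambda0 _ E2 Uf (fun I => inflow (Uf I) j)
    (fun I => missed F (Uf I)) [set A : {set G} | A \subset nb S :\: F & (#|A| <= n)%N] j _ _) _.
- move=> I; rewrite [I \in E2]inE => /andP[/hUf[sI gI nI aI] hn]; split=> //.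
  by rewrite inE hn andbT; exact: (missed_nb D0 gI aI).
- move=> I1 I2 T1 T2; rewrite ![_ \in E2]inE.
  move=> /andP[/hUf[s1 g1 _ a1] _] /andP[/hUf[s2 g2 _ a2] _] t1 t2 eM eJ.
  have eU := missed_inj D0 g1 g2 a1 a2 eM; rewrite -eU in g2 eJ t2.
  by have [] := shift_inj g1 g2 t1 t2 eJ.
rewrite ler_wpM2r // ler_pdivlMr ?exprn_gt0 //.
apply: le_trans (card_small_subsets _ _ _) _; first by rewrite (ltW x0).
rewrite ler_weXn2l //; first by rewrite lerDl ltW.
have [_ gI nI aI] : [/\ stable I0, good I0 (Uf I0), nabla (Uf I0) = (D * B)%N &
  approx psi F S (Uf I0)] by apply: hUf; move: hI0; rewrite inE => /andP[].
have [_ h2 _] := approx_sizes D0 psi0 psiD (good_odd gI) nI aI; apply: leq_trans h2.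
apply: (@leq_trans (\sum_(v in ~: F) ndeg S v)); last by rewrite ndeg_exchange.
rewrite -sum1_card big_mkcond [X in (_ <= X)%N]big_mkcond; apply: leq_sum => v _.
by rewrite in_setD in_setC; case: ifP => // /andP[->]; rewrite inE.
Qed.

Lemma sum_contour_event rho B m psi q nl n e a (x : R) :
  (0 < m)%N -> (8 * m <= D)%N -> (D <= 10 * m)%N ->
  (0 < psi)%N -> (4 * psi <= D)%N -> (#|rho| * m <= 4 * B)%N ->
  (forall A : {set G}, D <= 2 * #|A| -> D <= 2 * #|~: A| -> q <= nabla A)%N ->
  0 < x <= 1 ->
  let z := (111 * (10 * (8 * B)))%N in
  (D * z + q < nl.+1 * q)%N ->
  (8 * psi * B < D * e.+1)%N -> (2 * a <= n.+1)%N ->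
  \sum_(I in contour_event rho B) w I <=
    (((4 * D.+1 ^ 9) ^ (4 * B %/ m) * 2 ^ #|rho|)%N%:R * 2 ^+ nl *
    ((1 + x) ^+ (D * (z + D * z)) * x ^- ((3 * z + 4 * B) %/ psi)) *
    ((1 + x) ^+ (D * (D * (3 * z + 4 * B) + 2 * B)) * x ^- (2 * B %/ psi))) *
    ((D%:R * 2 ^+ e * (1 + lambda) ^- a +
     (1 + x) ^+ (psi * (4 * B)) * x ^- n * (1 + lambda) ^- B) * Z).
Proof.
move=> m0 mD Dm psi0 psi4 hrho iso hx z hnl he ha.
have psiD : (2 * psi <= D)%N by lia.
have l0 : 0 < 1 + lambda by rewrite addr_gt0.
have Z0 : 0 <= Z by apply: sumr_ge0 => I _; apply: weight_ge0.
have bd0 : 0 <= (D%:R * 2 ^+ e * (1 + lambda) ^- a +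
     (1 + x) ^+ (psi * (4 * B)) * x ^- n * (1 + lambda) ^- B) * Z.
  have /andP[x0 _] := hx.
  by rewrite !(mulr_ge0, addr_ge0) ?invr_ge0 ?exprn_ge0 ?addr_ge0 // ltW.
apply: le_trans (ler_wpM2r bd0 (card_good_codes m0 Dm psi0 hrho iso hx hnl)).
apply: (@le_trans _ _ (\sum_(c in [set c | good_code m psi rho B c])
   \sum_(I in approx_event psi (code_F psi c) (code_S psi c) B) w I)).
  rewrite (exchange_big_dep predT) //= [leLHS]big_mkcond; apply: ler_sum => I _.
  case: ifP => [|_]; last by apply: sumr_ge0 => c _; apply: weight_ge0.
  rewrite inE => /andP[sI /asboolP[U [gU nU rU]]].
  have [c gc ac] := approx_exists (good_odd gU) (good_nolone gU) nU rU m0 mD psi0 psiD.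
  rewrite (bigD1 c) /=; last first.
    by rewrite !inE gc sI; apply/asboolP; exists U.
  by rewrite lerDl sumr_ge0 // => ? _; apply: weight_ge0.
apply: le_trans (ler_sum _ (fun c _ =>
  sum_approx_event (code_F psi c) (code_S psi c) psi0 psi4 he ha hx)) _.
by rewrite sumr_const [leRHS]mulr_natl lexx.
Qed.

End Event.

Lemma quarter_nat d : 100 <= d ->
  exists m, [/\ 0 < m, 8 * m <= 2 * d, 2 * d <= 10 * m & 4 * m <= d].
Proof. by exists (d %/ 4); split; lia. Qed.

Lemma rho_nat r m d B : r * d <= 13 * B -> 4 * m <= d -> r * m <= 4 * B.
Proof.
move=> h1 h2; have h3 : r * (4 * m) <= 13 * B by apply: leq_trans h1; rewrite leq_mul2l h2 orbT.
lia.
Qed.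

Lemma half_nat2 n : n <= 2 * uphalf n. Proof. by lia. Qed.

Lemma half_nat n : 2 * uphalf n <= n.+1. Proof. by lia. Qed.

Lemma third_nat d : 100 <= d ->
  [/\ 0 < d * (d - 1) %/ 3 & d * (d - 1) <= 4 * (d * (d - 1) %/ 3)].
Proof.
move=> h; have : 100 <= d * (d - 1) by rewrite -[100]muln1 leq_mul //; lia.
by move: (d * (d - 1)) => N hN; split; lia.
Qed.

Lemma ceil_nat d psi B : 0 < d -> 8 * psi * B < 2 * d * (4 * psi * B %/ d).+1.
Proof.
move=> d0; have -> : 8 * psi * B = 2 * (4 * psi * B) by rewrite !mulnA.
by rewrite -[2 * d * _]mulnA (mulnC d) ltn_mul2l ltn_ceil.
Qed.

Lemma exponent_arith (R : realFieldType) (v y u lam a : R) : (lam <= 1 ->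
  5 * 10 ^+ 5 * y <= v * lam -> (v - 1) * lam <= 2 * a * lam -> 10 ^+ 4 * u <= y -> 1 <= u ->
  1 + u + 8 * y + - (a * (lam / 2)) <= - (97 * 10 ^+ 3 * y))%R.
Proof. lra. Qed.

(** * The cost of a set of contours *)

Section Asymptotics.
Variable R : realType.
Local Open Scope ring_scope.

Lemma expR_ge_pow (y : R) n : 0 <= y -> (y / n.+1%:R) ^+ n.+1 <= expR y.
Proof.
move=> y0; have -> : expR y = expR (y / n.+1%:R) ^+ n.+1.
  by rewrite -expRM_natl mulrCA divff ?mulr1 // pnatr_eq0.
have h0 : 0 <= y / n.+1%:R by rewrite divr_ge0.
rewrite lerXn2r ?nnegrE ?expR_ge0 //.
by apply: le_trans (expR_ge1Dx _); rewrite lerDr.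
Qed.

Lemma poly_bound1 (D t : R) : 1 <= D -> 0 <= t ->
  2 * D * (111 * (10 * (8 * t)) + 2 * D * (111 * (10 * (8 * t)))) <= 10 ^+ 6 * D ^+ 2 * t.
Proof.
move=> D1 t0; have h : 0 <= t * (D * (D - 1)) by rewrite !mulr_ge0 //; lra.
have h2 : 0 <= t * (D * D) by rewrite !mulr_ge0 //; lra.
lra.
Qed.

Lemma poly_bound2 (D t : R) : 1 <= D -> 0 <= t ->
  2 * D * (2 * D * (3 * (111 * (10 * (8 * t))) + 4 * t) + 2 * t) <= 10 ^+ 6 * D ^+ 2 * t.
Proof.
move=> D1 t0; have h : 0 <= t * (D * (D - 1)) by rewrite !mulr_ge0 //; lra.
have h2 : 0 <= t * (D * D) by rewrite !mulr_ge0 //; lra.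
lra.
Qed.

Lemma poly_bound3 (D t p : R) : 1 <= D -> 0 <= t -> p <= 2 * D ->
  p * (4 * t) <= 10 ^+ 6 * D ^+ 2 * t.
Proof.
move=> D1 t0 hp; have h : 0 <= t * (D * (D - 1)) by rewrite !mulr_ge0 //; lra.
have h2 : 0 <= t * (D * D) by rewrite !mulr_ge0 //; lra.
have h3 : 0 <= (2 * D - p) * (4 * t) by rewrite mulr_ge0 //; lra.
lra.
Qed.

Definition kappa (d : nat) : R := Num.sqrt (ln d%:R / d%:R).

Variable d : nat.
Local Notation dR := (d%:R : R).
Local Notation l := (ln dR).
Local Notation k := (kappa d).
Hypothesis l_big : 10 ^+ 5 <= l.

Lemma d_gt0 : 0 < dR.
Proof.
rewrite ltNge; apply/negP => /ln0 h; move: l_big; rewrite h leNgt => /negP; apply.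
by rewrite exprn_gt0.
Qed.

Lemma d_expR : dR = expR l. Proof. by rewrite lnK // posrE d_gt0. Qed.

Lemma l_ge1 : 1 <= l. Proof. by apply: le_trans l_big; lra. Qed.

Lemma kappa_sqr : k ^+ 2 * dR = l.
Proof.
have l0 := l_ge1; have d0 := d_gt0.
rewrite sqr_sqrtr; last by rewrite divr_ge0; lra.
by rewrite divfK // gt_eqF.
Qed.

Lemma kappa_gt0 : 0 < k.
Proof. by have l0 := l_ge1; have d0 := d_gt0; rewrite sqrtr_gt0 divr_gt0; lra. Qed.

Lemma d_ge_l3 : 10 ^+ 14 * l ^+ 3 <= dR.
Proof.
have l0 : 0 <= l by apply: le_trans l_ge1.
have := expR_ge_pow 7 l0; rewrite -d_expR; apply: le_trans.
have l5 : (10 ^+ 5) ^+ 5 <= l ^+ 5 by rewrite lerXn2r ?nnegrE ?exprn_ge0.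
have -> : (l / 8) ^+ 8 = l ^+ 3 * (l ^+ 5 * 8^-1 ^+ 8) by rewrite exprMn mulrA -exprD.
rewrite mulrC ler_wpM2l ?exprn_ge0 //.
rewrite exprVn ler_pdivlMr; last by rewrite exprn_gt0.
by apply: le_trans l5; lra.
Qed.

Lemma kappa_small : 10 ^+ 7 * (l * k) <= 1.
Proof.
have l0 := l_ge1; have d0 := d_gt0; have k0 := kappa_gt0.
rewrite -(@ler_pXn2r _ 2) ?nnegrE //; last by rewrite !mulr_ge0 //; lra.
rewrite -(ler_pM2r d0) expr1n mul1r.
have -> : (10 ^+ 7 * (l * k)) ^+ 2 * dR = 10 ^+ 14 * l ^+ 2 * (k ^+ 2 * dR) by ring.
rewrite kappa_sqr -mulrA -exprSr.
exact: d_ge_l3.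
Qed.

Lemma kappa_d : 10 ^+ 7 * l ^+ 2 <= k * dR.
Proof.
have l0 := l_ge1; have k0 := kappa_gt0; have h := kappa_small.
rewrite -(ler_pM2r k0); have -> : k * dR * k = l by rewrite -[RHS]kappa_sqr; ring.
rewrite expr2; have : 0 <= l * (1 - 10 ^+ 7 * (l * k)) by rewrite mulr_ge0; lra.
lra.
Qed.

Lemma kappa_le1 : 10 ^+ 7 * k <= 1.
Proof.
apply: le_trans kappa_small; rewrite ler_pM2l ?exprn_gt0 //.
by have := l_ge1; have := kappa_gt0; nra.
Qed.

Lemma d_ge100 : (100 <= d)%N.
Proof.
rewrite -(ler_nat R); apply: le_trans (d_ge_l3).
have := exprn_ege1 3 (l_ge1); move: (l ^+ 3) => u hu.
lra.
Qed.

Lemma d_ge1 : 1 <= dR.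
Proof. by rewrite ler1n (leq_trans _ d_ge100). Qed.

Lemma quarter : exists m, [/\ 0 < m, 8 * m <= 2 * d, 2 * d <= 10 * m & 4 * m <= d]%N.
Proof.
exact: quarter_nat d_ge100. Qed.

Lemma threshold : exists psi,
  [/\ (0 < psi)%N, (4 * psi <= 2 * d)%N, k * dR <= psi%:R & psi%:R <= 2 * (k * dR)].
Proof.
have l2 : 1 <= l ^+ 2 by rewrite exprn_ege1 ?l_ge1.
have kd := kappa_d; have d0 := d_gt0.
have hk : 10 ^+ 7 * k * dR <= 1 * dR by rewrite ler_pM2r ?kappa_le1.
have kd0 : 0 <= k * dR by rewrite mulr_ge0 ?ltW ?kappa_gt0.
exists (Num.truncn (k * dR)).+1.
have /andP[psi1 psi2] := truncn_itv kd0.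
have psi_le : (Num.truncn (k * dR)).+1%:R <= 2 * (k * dR).
  rewrite -[in leLHS]natr1; move: kd l2 psi1; set u := l ^+ 2; set v := k * dR.
  lra.
split=> //; last exact: ltW.
rewrite -(ler_nat R) !natrM; apply: le_trans (_ : 4 * (2 * (k * dR)) <= _).
  by rewrite ler_pM2l.
by move: hk d0; rewrite -mulrA; set v := k * dR; lra.
Qed.

Section Terms.
Variables (B : nat).
Local Notation t := (B%:R : R).
Local Notation E := (@expR R).
Hypothesis dB : (d <= 13 * B)%N.

Lemma kt_big : 10 ^+ 4 * l <= k * t.
Proof.
have l0 := l_ge1; have k0 := kappa_gt0; have h := kappa_d.
have h1 : dR <= 13 * t by rewrite -natrM ler_nat.
have h2 : k * dR <= k * (13 * t) by rewrite ler_pM2l.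
have : 10 ^+ 5 * l <= l ^+ 2 by rewrite expr2 ler_pM2r //; lra.
lra.
Qed.

(** Small enough for a ground set of [10 ^ 6 * d ^ 2 * B] points to cost only [exp (kappa * B)],
    while each point chosen from it costs [3 * ln d] in the exponent. *)
Let x : R := dR^-1 ^+ 3.

Lemma x_itv : 0 < x <= 1.
Proof.
have d0 := d_gt0; rewrite exprn_gt0 ?invr_gt0 //= exprn_ile1 ?invr_ge0 ?(ltW d0) //.
rewrite invf_le1 //; have := kappa_d; have := kappa_le1; have := kappa_gt0; have := l_ge1.
nra.
Qed.

Lemma pow1x_le N : N%:R <= 10 ^+ 6 * dR ^+ 2 * t -> (1 + x) ^+ N <= E (k * t).
Proof.
move=> hN; have d0 := d_gt0; have /andP[x0 _] := x_itv; have l0 := l_ge1.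
apply: (@le_trans _ _ (E (N%:R * x))).
  by rewrite expRM_natl lerXn2r ?nnegrE ?expR_ge0 ?addr_ge0 ?(ltW x0) // expR_ge1Dx.
rewrite ler_expR; apply: (@le_trans _ _ (10 ^+ 6 * dR ^+ 2 * t * x)).
  by rewrite ler_pM2r.
have -> : 10 ^+ 6 * dR ^+ 2 * t * x = 10 ^+ 6 * dR^-1 * t.
  by rewrite /x; field; rewrite gt_eqF.
rewrite ler_wpM2r // ler_pdivrMr //.
apply: le_trans (kappa_d); have : 1 <= l ^+ 2 by rewrite exprn_ege1.
lra.
Qed.

Lemma powx_eq n : x ^- n = E (3 * l * n%:R).
Proof.
have d0 := d_gt0; rewrite /x -exprM exprVn invrK {1}d_expR -expRM_natl natrM; congr expR.
ring.
Qed.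

Lemma base_le n m : (0 < m)%N -> (d <= 5 * m)%N -> (n * m <= 4 * B)%N ->
  ((4 * (2 * d).+1 ^ 9) ^ n)%N%:R <= E (k * t).
Proof.
move=> m0 dm nm; have l0 := l_ge1; have k0 := kappa_gt0; have k1 := kappa_le1; have d0 := d_gt0.
have h2 : (n * d <= 20 * B)%N.
  apply: (@leq_trans (n * (5 * m))); first by rewrite leq_mul2l dm orbT.
  by rewrite mulnCA; lia.
have d4 : (4 <= d)%N by apply: leq_trans d_ge100.
have h1 : (4 * (2 * d).+1 ^ 9 <= d ^ 20)%N.
  have -> : (d ^ 20 = d ^ 2 * (d ^ 2) ^ 9)%N by rewrite -expnM -expnD.
  by apply: leq_mul; rewrite ?leq_exp2r //; nia.
apply: (@le_trans _ _ ((d ^ 20) ^ n)%N%:R).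
  by rewrite ler_nat; case: (n) => // n'; rewrite leq_exp2r.
rewrite !natrX {1}d_expR -!expRM_natl ler_expR.
have h3 : n%:R * dR <= 20 * t by rewrite -!natrM ler_nat.
have h4 : 20 * (n%:R * l) <= 400 * (k ^+ 2 * t).
  rewrite -[X in n%:R * X]kappa_sqr.
  have -> : 20 * (n%:R * (k ^+ 2 * dR)) = 20 * k ^+ 2 * (n%:R * dR) by ring.
  apply: le_trans (ler_wpM2l _ h3) _; first by rewrite mulr_ge0 ?exprn_ge0 // ltW.
  lra.
rewrite mulrCA; apply: (le_trans h4).
have -> : 400 * (k ^+ 2 * t) = (400 * k) * (k * t) by ring.
by rewrite ler_piMl //; [rewrite mulr_ge0 // ltW|lra].
Qed.

Lemma two_le n : 2 ^+ n <= E n%:R.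
Proof.
rewrite -[n%:R]mulr1 expRM_natl lerXn2r ?nnegrE ?expR_ge0 //.
by apply: le_trans (expR_ge1Dx 1); lra.
Qed.

(** Large components have boundaries of order [d ^ 2], so there are about [B / d] of them, far fewer
    than [kappa * B]. The summand 1 stands for a component with small complement. *)
Lemma label_le q nl : (d * (d - 1) <= 4 * q)%N ->
  (nl * q <= 2 * d * (111 * (10 * (8 * B))) + q)%N -> 2 ^+ nl <= E (k * t + 1).
Proof.
move=> hq hn; apply: (le_trans (two_le _)); rewrite ler_expR.
have d0 := d_gt0; have kd := kappa_d; have l0 := l_ge1; have k0 := kappa_gt0.
have l2 : 1 <= l ^+ 2 by rewrite exprn_ege1.
have kt0 : 0 <= k * t by rewrite mulr_ge0 // ltW.
have hq' : dR * (dR - 1) <= 4 * q%:R.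
  have <- : (d - 1)%:R = dR - 1 by rewrite natrB // (leq_trans _ d_ge100).
  by rewrite -!natrM ler_nat.
have hn' : nl%:R * q%:R <= 2 * dR * (111 * (10 * (8 * t))) + q%:R.
  by rewrite -!natrM -natrD ler_nat.
have d2 : 2 <= dR by rewrite ler_nat (leq_trans _ d_ge100).
rewrite -lerBlDr; set u := nl%:R - 1; have [u0|u0] := leP u 0; first exact: le_trans kt0.
have h1 : u * q%:R <= 18 * 10 ^+ 3 * (dR * t).
  by have := mulr_ge0 (ltW d0) (ler0n R B); rewrite /u; lra.
have h2 : dR * dR <= 8 * q%:R by nra.
have h3 : u * (dR * dR) <= 8 * (18 * 10 ^+ 3 * (dR * t)).
  by apply: le_trans (ler_wpM2l (ltW u0) h2) _; lra.
have h4 : u * dR <= 8 * (18 * 10 ^+ 3 * t) by rewrite -(ler_pM2r d0); lra.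
have h5 : u * (k * dR) <= 8 * (18 * 10 ^+ 3 * (k * t)).
  have := ler_wpM2l (ltW k0) h4; lra.
have h6 : u * 10 ^+ 7 <= u * (k * dR).
  by rewrite ler_wpM2l ?(ltW u0) //; apply: le_trans kd; lra.
lra.
Qed.

(** Since [kappa ^ 2 * d = ln d], division by [psi] turns the price [ln d] of a point into
    [kappa]. *)
Lemma inv_le n psi (C : R) : k * dR <= psi%:R -> (n * psi)%:R <= C * t ->
  3 * l * n%:R <= 3 * C * (k * t).
Proof.
move=> hp; rewrite natrM => hn; have k0 := kappa_gt0; have n0 : 0 <= n%:R :> R by [].
have h1 : n%:R * (k * dR) <= C * t by apply: le_trans hn; rewrite ler_wpM2l.
have h2 := ler_wpM2l (ltW k0) h1.
have e : k * (n%:R * (k * dR)) = l * n%:R by rewrite -[in RHS]kappa_sqr; ring.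
rewrite e in h2; lra.
Qed.

End Terms.

Local Notation E := (@expR R).

Lemma two_le_e : 2 <= E 1.
Proof. by apply: le_trans (expR_ge1Dx 1); lra. Qed.

Lemma arith_z (t : R) : 0 <= t -> 3 * (111 * (10 * (8 * t))) + 4 * t <= 3 * 10 ^+ 4 * t.
Proof. lra. Qed.

Lemma arith_labels (t p : R) : 0 <= t -> p <= 2 * (k * dR) -> 4 * p * t <= 8 * (k * t) * dR.
Proof. by move=> t0 hp; have := ler_wpM2r t0 hp; lra. Qed.

Section ExponentArithmetic.
Variables lam t : R.
Hypotheses (ly : 0 < lam) (ly1 : lam <= 1) (ls : 4 * 10 ^+ 6 * (l * k) <= lam ^+ 2).
Hypotheses (t0 : 0 <= t).

Lemma arith_term1 a : lam / (8 * l) * t - 1 <= 2 * a -> 10 ^+ 4 * l <= k * t ->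
  1 + l + 8 * (k * t) + - (a * (lam / 2)) <= - (97 * 10 ^+ 3 * (k * t)).
Proof.
have l0 := l_ge1; move=> h6 y4.
have h5 : 5 * 10 ^+ 5 * (k * t) <= lam / (8 * l) * t * lam.
  have -> : lam / (8 * l) * t * lam = lam ^+ 2 * t / (8 * l) by field; rewrite gt_eqF //; lra.
  rewrite ler_pdivlMr; last lra.
  have -> : 5 * 10 ^+ 5 * (k * t) * (8 * l) = 4 * 10 ^+ 6 * (l * k) * t by ring.
  exact: ler_wpM2r.
exact: (exponent_arith ly1 h5 (ler_wpM2r (ltW ly) h6) y4 l0).
Qed.

Lemma arith_term2 :
  k * t + 3 * l * (lam / (8 * l) * t) + - (t * (lam / 2)) <= - (97 * 10 ^+ 3 * (k * t)).
Proof.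
have l0 := l_ge1; have k0 := kappa_gt0.
have -> : 3 * l * (lam / (8 * l) * t) = 3 / 8 * (lam * t) by field; rewrite gt_eqF //; lra.
have h4 : 4 * 10 ^+ 6 * k <= lam.
  have h2 : lam ^+ 2 <= lam by rewrite expr2 ler_piMr // ltW.
  apply: le_trans (le_trans ls h2); rewrite ler_wpM2l ?mulr_ge0 ?exprn_ge0 //.
  by rewrite ler_peMl // ltW.
have := ler_wpM2r t0 h4; have := mulr_ge0 (ltW k0) t0; lra.
Qed.

End ExponentArithmetic.

Lemma arith_sum (y : R) :
  E (- (97 * 10 ^+ 3 * y)) + E (- (97 * 10 ^+ 3 * y)) <= E (1 - 97 * 10 ^+ 3 * y).
Proof.
rewrite expRD; have := two_le_e; have := expR_gt0 (- (97 * 10 ^+ 3 * y)).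
move: (E _) (E 1) => u v; nra.
Qed.

(** The dominant cost [3 * (3 * 10 ^+ 4) * y] is that of the cover [Y3]; the constant in the
    hypothesis on [lambda] is made for the gain [97 * 10 ^+ 3 * y] to exceed it. *)
Lemma arith_total (y : R) : 10 ^+ 4 <= y ->
  y + (y + 1) + (y + 3 * (3 * 10 ^+ 4) * y) + (y + 3 * 2 * y) + (1 - 97 * 10 ^+ 3 * y) <= - y.
Proof. lra. Qed.

Section MainBound.
Variables (G : step_graph) (lambda : R).
Hypothesis dirG : #|dir G| = (2 * d)%N.
Hypothesis iso : forall A : {set G}, (d <= #|A| -> d <= #|~: A| -> d * (d - 1) <= 3 * nabla A)%N.
Hypothesis lambda0 : 0 < lambda.
Hypothesis lambda_big : 4 * 10 ^+ 6 * (l * k) <= lambda ^+ 2.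

(** The estimate [exp (lam / 2) <= 1 + lambda] needs a bounded argument; the lower bound on
    [lambda ^+ 2] survives truncation because [l * kappa] is tiny. *)
Let lam : R := Num.min lambda 1.

Lemma lam_gt0 : 0 < lam. Proof. by rewrite lt_min lambda0 ltr01. Qed.
Lemma lam_le1 : lam <= 1. Proof. by rewrite ge_min lexx orbT. Qed.
Lemma lam_sqr : 4 * 10 ^+ 6 * (l * k) <= lam ^+ 2.
Proof.
rewrite /lam; case: (leP lambda 1) => // _; rewrite expr1n.
have := kappa_small; have := kappa_gt0; have := l_ge1.
by move=> h1 h2; have := mulr_gt0 (lt_le_trans ltr01 h1) h2; lra.
Qed.

Lemma lam_powV n : (1 + lambda) ^- n <= E (- (n%:R * (lam / 2))).
Proof.
have y0 := lam_gt0; have y1 := lam_le1.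
rewrite expRN lef_pV2 ?posrE ?exprn_gt0 ?expR_gt0 ?addr_gt0 // expRM_natl.
rewrite lerXn2r ?nnegrE ?expR_ge0 //; first by rewrite addr_ge0 ?ltW.
apply: (@le_trans _ _ (1 + lam)); last by rewrite lerD2l ge_min lexx.
have h := expR_ge1Dx (- (lam / 2)).
have : E (lam / 2) * E (- (lam / 2)) = 1 by rewrite -expRD subrr expR0.
have := expR_gt0 (lam / 2); set u := E (lam / 2); set v := E _ in h *.
move=> u0 uv; have : u * (1 - lam / 2) <= u * v by rewrite ler_pM2l.
rewrite uv; nra.
Qed.

Theorem main_bound (rho : {set G}) (B : nat) :
  (d <= 13 * B)%N -> (#|rho| * d <= 13 * B)%N ->
  \sum_(I in contour_event rho B) weight lambda I
    <= 2 ^+ #|rho| * E (- (k * B%:R)) * partition_fun G lambda.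
Proof.
move=> dB rB; have l0 := l_ge1; have k0 := kappa_gt0; have k1 := kappa_le1; have d0 := d_gt0.
have kd := kappa_d; have ks := kappa_small; have kt := kt_big dB.
have l2 : 1 <= l ^+ 2 by rewrite exprn_ege1.
have d100 := d_ge100.
have [m [m0 m8 m10 m4]] := quarter.
have [psi [psi0 psi4 psi1 psi_le]] := threshold.
pose q := (d * (d - 1) %/ 3)%N.
have [q0 q4] := third_nat d100; rewrite -/q in q0 q4.
have isoq (A : {set G}) : (#|dir G| <= 2 * #|A| -> #|dir G| <= 2 * #|~: A| -> q <= nabla (G:=G) A)%N.
  rewrite dirG !leq_mul2l /= => h1 h2; apply: leq_trans (leq_div2r 3 (iso h1 h2)) _.
  by rewrite mulKn.
pose z := (111 * (10 * (8 * B)))%N.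
pose nl := (#|dir G| * z %/ q).+1.
have hnl : (#|dir G| * z + q < nl.+1 * q)%N.
  by rewrite [nl.+1]/= mulSn addnC ltn_add2l /nl ltn_ceil.
pose e := (4 * psi * B %/ d)%N.
have he : (8 * psi * B < #|dir G| * e.+1)%N.
  by rewrite dirG; apply: ceil_nat; apply: leq_trans d100.
(* Up to this number of missed points, listing them at [3 * l] each costs at most [3 / 8 * lam * B],
   less than the gain [lam / 2 * B]. Beyond it, the gain from half of them is about
   [lam ^ 2 * B / (32 * l)], which dominates the cost [8 * kappa * B] of the dark points. *)
pose zeta := lam / (8 * l) * B%:R.
pose n := Num.truncn zeta; pose a := uphalf n.
have zeta0 : 0 <= zeta by rewrite !mulr_ge0 ?invr_ge0 ?mulr_ge0 ?(ltW lam_gt0) //; lra.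
have /andP[n1 n2] : n%:R <= zeta < n.+1%:R by rewrite truncn_itv.
have ha : (2 * a <= n.+1)%N := half_nat n.
have hx := x_itv.
have D0 : (0 < #|dir G|)%N by rewrite dirG muln_gt0 /= (leq_trans _ d100).
have m8' : (8 * m <= #|dir G|)%N by rewrite dirG.
have m10' : (#|dir G| <= 10 * m)%N by rewrite dirG.
have psi4' : (4 * psi <= #|dir G|)%N by rewrite dirG.
apply: (le_trans (@sum_contour_event G R lambda D0 lambda0 rho B m psi q nl n e a _ m0 m8' m10'
  psi0 psi4' (rho_nat rB m4) isoq hx hnl he ha)).
rewrite /= dirG.
have Z0 : 0 <= partition_fun G lambda by apply: sumr_ge0 => I _; apply: weight_ge0.
rewrite [leLHS]mulrA ler_wpM2r //.
have t0 : 0 <= B%:R :> R by [].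
have b1 : ((4 * (2 * d).+1 ^ 9) ^ (4 * B %/ m) * 2 ^ #|rho|)%N%:R <= E (k * B%:R) * 2 ^+ #|rho|.
  have h5 : (d <= 5 * m)%N by move: m10; rewrite -[10%N]/(2 * 5)%N -mulnA leq_mul2l.
  rewrite natrM; apply: ler_pM => //; last by rewrite natrX.
  by apply: (base_le dB m0 h5); apply: leq_divM.
have b2 : 2 ^+ nl <= E (k * B%:R + 1).
  apply: (label_le q4).
  by rewrite /nl mulSn dirG addnC leq_add2r leq_divM.
have poly1 : (2 * d * (z + 2 * d * z))%:R <= 10 ^+ 6 * dR ^+ 2 * B%:R.
  rewrite !(natrM, natrD); exact: (poly_bound1 (d_ge1) t0).
have poly2 : (2 * d * (2 * d * (3 * z + 4 * B) + 2 * B))%:R <= 10 ^+ 6 * dR ^+ 2 * B%:R.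
  rewrite !(natrM, natrD); exact: (poly_bound2 (d_ge1) t0).
have poly3 : (psi * (4 * B))%:R <= 10 ^+ 6 * dR ^+ 2 * B%:R.
  rewrite !natrM; apply: (poly_bound3 d_ge1 t0).
  by rewrite -!natrM ler_nat; apply: leq_trans psi4; rewrite leq_pmull.
have b3 : dR^-1 ^+ 3 ^- ((3 * z + 4 * B) %/ psi) <= E (3 * (3 * 10 ^+ 4) * (k * B%:R)).
  rewrite powx_eq ler_expR; apply: inv_le psi1 _.
  apply: (@le_trans _ _ (3 * z + 4 * B)%:R); first by rewrite ler_nat leq_divM.
  by rewrite !(natrM, natrD); apply: arith_z.
have b4 : dR^-1 ^+ 3 ^- (2 * B %/ psi) <= E (3 * 2 * (k * B%:R)).
  rewrite powx_eq ler_expR; apply: inv_le psi1 _.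
  by rewrite -natrM ler_nat leq_divM.
have p1 := pow1x_le poly1; have p2 := pow1x_le poly2; have p3 := pow1x_le poly3.
have E0 y : 0 <= E y by apply: expR_ge0.
have [x0 x1] : 0 < dR^-1 ^+ 3 /\ dR^-1 ^+ 3 <= 1 by apply/andP.
move: b1 b2 b3 b4 p1 p2 p3 x0 x1; set x := dR^-1 ^+ 3.
move=> b1 b2 b3 b4 p1 p2 p3 x0 x1.
set y := k * B%:R in b1 b2 b3 b4 p1 p2 p3 kt *.
have y0 : 0 <= y by rewrite mulr_ge0 // ltW.
have x10 : 0 <= 1 + x by rewrite addr_ge0 ?ltW.
have codes : ((4 * (2 * d).+1 ^ 9) ^ (4 * B %/ m) * 2 ^ #|rho|)%N%:R * 2 ^+ nl *
    ((1 + x) ^+ (2 * d * (z + 2 * d * z)) * x ^- ((3 * z + 4 * B) %/ psi)) *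
    ((1 + x) ^+ (2 * d * (2 * d * (3 * z + 4 * B) + 2 * B)) * x ^- (2 * B %/ psi))
    <= 2 ^+ #|rho| * E (y + (y + 1) + (y + 3 * (3 * 10 ^+ 4) * y) + (y + 3 * 2 * y)).
  rewrite !expRD [leRHS](_ : _ = E y * 2 ^+ #|rho| * (E y * E 1) *
     (E y * E (3 * (3 * 10 ^+ 4) * y)) * (E y * E (3 * 2 * y))); last by ring.
  rewrite expRD in b2.
  have n1E : 0 <= x ^- ((3 * z + 4 * B) %/ psi) by rewrite invr_ge0 exprn_ge0 ?ltW.
  have n2E : 0 <= x ^- (2 * B %/ psi) by rewrite invr_ge0 exprn_ge0 ?ltW.
  have n3E N : 0 <= (1 + x) ^+ N by rewrite exprn_ge0 ?addr_ge0 ?ltW.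
  apply: ler_pM; rewrite ?mulr_ge0 ?exprn_ge0 //; last exact: ler_pM.
  apply: ler_pM; rewrite ?mulr_ge0 ?exprn_ge0 //; last exact: ler_pM.
  by apply: ler_pM; rewrite ?exprn_ge0.
have term : (2 * d)%:R * 2 ^+ e * (1 + lambda) ^- a +
    (1 + x) ^+ (psi * (4 * B)) * x ^- n * (1 + lambda) ^- B
    <= E (1 - 97 * 10 ^+ 3 * y).
  have y4 : 10 ^+ 4 * l <= k * B%:R by [].
  have ly := lam_gt0; have ly1 := lam_le1; have ls := lam_sqr.
  have l1V N : 0 <= (1 + lambda) ^- N by rewrite invr_ge0 exprn_ge0 // ltW // addr_gt0.
  have i1 N : 0 <= x ^- N by rewrite invr_ge0 exprn_ge0 // ltW.
  have e1 : (2 * d)%:R * 2 ^+ e * (1 + lambda) ^- a <= E (- (97 * 10 ^+ 3 * y)).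
    have h1 : (2 * d)%:R <= E (1 + l) :> R.
      by rewrite natrM expRD -d_expR ler_wpM2r // two_le_e.
    have h2 : 2 ^+ e <= E (8 * y).
      apply: (le_trans (two_le _)); rewrite ler_expR -(ler_pM2r d0).
      apply: (@le_trans _ _ (4 * psi * B)%:R); first by rewrite -natrM ler_nat leq_divM.
      rewrite !natrM; exact: arith_labels.
    apply: (@le_trans _ _ (E (1 + l) * E (8 * y) * E (- (a%:R * (lam / 2))))).
      by apply: ler_pM (ler_pM _ _ h1 h2) (lam_powV a); rewrite ?mulr_ge0 ?exprn_ge0.
    rewrite -!expRD ler_expR; apply: (arith_term1 ly ly1 ls t0 _ y4).
    rewrite lerBlDr -natrM natr1; apply: ltW; apply: lt_le_trans n2 _.
    by rewrite ler_nat ltnS half_nat2.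
  have e2 : (1 + x) ^+ (psi * (4 * B)) * x ^- n * (1 + lambda) ^- B <= E (- (97 * 10 ^+ 3 * y)).
    have h1 : x ^- n <= E (3 * l * zeta).
      by rewrite powx_eq ler_expR ler_wpM2l // mulr_ge0 // (le_trans _ l0).
    apply: (@le_trans _ _ (E y * E (3 * l * zeta) * E (- (B%:R * (lam / 2))))).
      by apply: ler_pM (ler_pM _ _ p3 h1) (lam_powV B); rewrite ?mulr_ge0 ?exprn_ge0.
    by rewrite -!expRD ler_expR; apply: arith_term2.
  apply: le_trans (lerD e1 e2) _; exact: arith_sum.
apply: le_trans (ler_pM _ _ codes term) _.
- have i1 N : 0 <= x ^- N by rewrite invr_ge0 exprn_ge0 // ltW.
  by rewrite !mulr_ge0 ?exprn_ge0.
- have i0 N : 0 <= (1 + lambda) ^- N by rewrite invr_ge0 exprn_ge0 // ltW // addr_gt0.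
  have i1 N : 0 <= x ^- N by rewrite invr_ge0 exprn_ge0 // ltW.
  by rewrite addr_ge0 // !mulr_ge0 ?exprn_ge0.
rewrite -[leLHS]mulrA ler_wpM2l ?exprn_ge0 // -expRD ler_expR.
apply: arith_total; apply: le_trans kt; by rewrite ler_peMr ?exprn_ge0.
Qed.

End MainBound.
End Asymptotics.

(** * The torus and its isoperimetry *)

Section OrdCycle.
Variable L : nat.

Definition rot (b : bool) (a : 'I_L) : 'I_L := if b then ordS a else ord_pred a.

Lemma rotK b : cancel (rot b) (rot (~~ b)).
Proof. by case: b => a; rewrite /rot /= ?ordSK ?ord_predK. Qed.

Lemma rotC b b' a : rot b (rot b' a) = rot b' (rot b a).
Proof. by case: b; case: b' => //; rewrite /rot ordSK ord_predK. Qed.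

Lemma iter_ordS m (a : 'I_L) : val (iter m (@ordS L) a) = (a + m) %% L.
Proof.
elim: m => [|m IH]; first by rewrite addn0 modn_small.
by rewrite iterS /= IH -addn1 modnDml addn1 addnS.
Qed.

Lemma ordS_reach (a b : 'I_L) : exists m, iter m (@ordS L) a = b.
Proof.
exists (b + (L - a)); apply: val_inj; rewrite iter_ordS addnCA subnKC ?modnDr ?modn_small //.
exact: ltnW.
Qed.

Lemma ordS_closed (P : pred 'I_L) a : P a -> (forall b, P b -> P (ordS b)) -> forall b, P b.
Proof.
move=> Pa h b; have [m <-] := ordS_reach a b; elim: m => //= m IH; exact: h.
Qed.

Hypothesis L4 : 4 <= L.

Lemma ordS_val (a : 'I_L) : val (ordS a) = if a.+1 == L then 0 else a.+1.
Proof.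
rewrite /=; case: eqP => [->|ne]; first by rewrite modnn.
by rewrite modn_small //; have := ltn_ord a; lia.
Qed.

Lemma ord_pred_val (a : 'I_L) : val (ord_pred a) = if a == 0 :> nat then L.-1 else a.-1.
Proof.
rewrite /=; case: eqP => [->|ne]; first by rewrite add0n modn_small //; lia.
have -> : (a + L).-1 = a.-1 + L by lia.
by rewrite modnDr modn_small //; have := ltn_ord a; lia.
Qed.

Lemma rot_neq b a : rot b a != a.
Proof.
move: L4 (ltn_ord a) => h4 ha; apply/eqP; case: b => /(congr1 val); rewrite /rot.
  by rewrite ordS_val /=; case: ifP => /eqP; lia.
by rewrite ord_pred_val /=; case: ifP => /eqP; lia.
Qed.

Lemma rot_inj a : injective (rot^~ a).
Proof.
move: L4 (ltn_ord a) => h4 ha b b' /(congr1 val); case: b; case: b' => //; rewrite /rot.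
  by rewrite ordS_val ord_pred_val; do 2!case: ifP => /eqP; lia.
by rewrite ordS_val ord_pred_val; do 2!case: ifP => /eqP; lia.
Qed.

Lemma odd_rot b a : ~~ odd L -> odd (rot b a) = ~~ odd a.
Proof.
move=> oL; case: b; rewrite /rot.
  rewrite [X in odd X]ordS_val; case: eqP => //= e.
  by rewrite (congr1 odd e : ~~ odd a = odd L) (negbTE oL).
rewrite [X in odd X]ord_pred_val; case: eqP => [->|/eqP a0] /=.
  have e : L.-1.+1 = L by rewrite prednK // (leq_trans _ L4).
  by rewrite -[odd _]negbK (congr1 odd e : ~~ odd L.-1 = odd L) (negbTE oL).
by rewrite -[in RHS](prednK (_ : 0 < a)) /= ?negbK // lt0n.
Qed.

End OrdCycle.

Section Torus.
Variables L d : nat.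
Local Notation V := (torus_vertex L d).
Implicit Types (x y a b : V) (i k c : 'I_d) (m : 'I_L).

Definition upd x i m : V := [ffun c => if c == i then m else x c].
Definition torus_stp (j : 'I_d * bool) x : V := upd x j.1 (rot j.2 (x j.1)).
Definition torus_opp (j : 'I_d * bool) := (j.1, ~~ j.2).
Definition torus_par x := odd (\sum_i x i).

Lemma updE x i m : upd x i m i = m. Proof. by rewrite ffunE eqxx. Qed.
Lemma updN x i m c : c != i -> upd x i m c = x c. Proof. by rewrite ffunE => /negbTE ->. Qed.
Lemma upd_upd x i m m' : upd (upd x i m) i m' = upd x i m'.
Proof. by apply/ffunP => c; rewrite !ffunE; case: eqP. Qed.
Lemma upd_id x i : upd x i (x i) = x.
Proof. by apply/ffunP => c; rewrite !ffunE; case: eqP => [->|]. Qed.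

Lemma torus_stpE j x c : torus_stp j x c = if c == j.1 then rot j.2 (x c) else x c.
Proof. by rewrite ffunE; case: eqP => [->|]. Qed.

Lemma torus_stpK j : cancel (torus_stp j) (torus_stp (torus_opp j)).
Proof. by move=> x; apply/ffunP => c; rewrite !torus_stpE /=; case: eqP; rewrite ?rotK. Qed.

Lemma torus_oppK : involutive torus_opp.
Proof. by case=> i b; rewrite /torus_opp /= negbK. Qed.

Lemma torus_stpC j j' x : torus_stp j (torus_stp j' x) = torus_stp j' (torus_stp j x).
Proof.
by apply/ffunP => c; rewrite !torus_stpE; do 2!case: eqP => _ //; rewrite rotC.
Qed.

Hypotheses (L4 : 4 <= L) (oL : ~~ odd L).

Lemma torus_stp_inj x j j' : torus_stp j x = torus_stp j' x -> j = j'.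
Proof.
case: j j' => [i b] [i' b'] /ffunP h.
have e : i = i'.
  apply/eqP; apply: contraT => ne; have := h i; rewrite !torus_stpE /= eqxx (negbTE ne).
  by move/eqP; rewrite (negbTE (rot_neq L4 _ _)).
rewrite -e in h *; have := h i; rewrite !torus_stpE /= eqxx => /(rot_inj L4) ->.
by [].
Qed.

Lemma torus_par_stp j x : torus_par (torus_stp j x) = ~~ torus_par x.
Proof.
rewrite /torus_par (bigD1 j.1) //= [in RHS](bigD1 j.1) //= !oddD torus_stpE eqxx odd_rot //.
rewrite (eq_bigr (fun c => x c : nat)) => [|c /negbTE ne]; last by rewrite torus_stpE ne.
by rewrite addNb.
Qed.

Definition torus_graph : step_graph := @StepGraph V ('I_d * bool)%type torus_stp torus_opp torus_par
  torus_stpK torus_oppK torus_stpC torus_stp_inj torus_par_stp.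

Lemma card_torus_dir : #|dir torus_graph| = 2 * d.
Proof. by rewrite card_prod card_ord card_bool mulnC. Qed.

Lemma card_torus : #|torus_graph| = L ^ d.
Proof. by rewrite card_ffun !card_ord. Qed.

Lemma torus_adjP x y : reflect (exists j, y = torus_stp j x) (torus_adj x y).
Proof.
apply: (iffP andP) => [[/cards1P[i hi] /forallP ha]|[j ->]].
  have ne : x i != y i by have := set11 i; rewrite -hi inE.
  have ey (b : bool) : y i = rot b (x i) -> exists j, y = torus_stp j x.
    move=> e; exists (i, b); apply/ffunP => c; rewrite torus_stpE /=.
    case: eqP => [->//|/eqP ci]; apply/eqP; have : c \notin [set i] by rewrite inE.
    by rewrite -hi inE negbK eq_sym.
  have := ha i; rewrite ne /= => /orP[] /eqP h.
    by apply: (ey true); apply: val_inj; rewrite /= h modn_small.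
  apply: (ey false); apply: (can_inj (@rotK L true)); rewrite /rot /= ord_predK.
  by apply: val_inj; rewrite /= h modn_small.
have dif c : (x c != torus_stp j x c) = (c == j.1).
  rewrite torus_stpE; case: (c =P j.1) => [->|_]; last by rewrite eqxx.
  by rewrite eq_sym rot_neq.
split.
  rewrite (_ : [set i | _] = [set j.1]) ?cards1 //.
  by apply/setP => c; rewrite !inE dif.
apply/forallP => c; apply/implyP; rewrite dif => /eqP ->; rewrite torus_stpE eqxx.
case: (j.2); rewrite /rot; first by rewrite /= modn_mod eqxx.
apply/orP; right; have := ordSK (x j.1); have := ord_predK (x j.1) => /(congr1 val) /= e _.
by rewrite e modn_small.
Qed.

Lemma independent_stable (I : {set V}) :
  independent (@torus_adj L d) I = stable (I : {set torus_graph}).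
Proof.
apply/idP/idP => [/forall_inP h|/stableP h].
  apply/stableP => x j xI; apply/negP => jI; have /forall_inP/(_ _ jI)/negP := h _ xI.
  by apply; apply/torus_adjP; exists j.
apply/forall_inP => x xI; apply/forall_inP => y yI; apply/negP => /torus_adjP[j ey].
by have := h _ j xI; rewrite /= -ey yI.
Qed.

End Torus.

(** [r p q] reads: [q] may serve as a code of [p]. Most edge counts below take this form, where only
    the existence and the unique decoding of codes have to be checked. *)
Lemma leq_card_rel (T1 T2 : finType) (S : {set T1}) (T : {set T2}) (r : T1 -> T2 -> Prop) :
  (forall p, p \in S -> exists2 q, q \in T & r p q) ->
  (forall p p' q, p \in S -> p' \in S -> r p q -> r p' q -> p = p') -> #|S| <= #|T|.
Proof.
move=> ex inj; pose f p := [pick q | (q \in T) && `[< r p q >]].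
have fP p : p \in S -> exists q, [/\ f p = Some q, q \in T & r p q].
  move=> pS; rewrite /f; case: pickP => [q /andP[qT /asboolP rq]|h]; first by exists q.
  by have [q qT /asboolP rq] := ex _ pS; have := h q; rewrite qT rq.
have injf : {in S &, injective f}.
  move=> p p' pS p'S e; have [q [fq _ rq]] := fP _ pS; have [q' [fq' _ rq']] := fP _ p'S.
  by move: rq'; have [->] : Some q' = Some q; [rewrite -fq' -e fq|move=> rq'; apply: inj rq rq'].
have injs : injective (@Some T2) by move=> q q' [].
rewrite -(card_in_imset injf) -(card_imset (mem T) injs).
apply/subset_leq_card/subsetP => o /imsetP[p pS ->]; have [q [-> qT _]] := fP _ pS.
exact: imset_f.
Qed.

Lemma inflow_opp (G : step_graph) (A : {set G}) j : #|inflow A (opp j)| = #|inflow A j|.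
Proof.
have e k : #|inflow A k| = #|A| - #|[set x in A | stp (opp k) x \in A]|.
  rewrite -(cardsID [set x | stp (opp k) x \in A] A) addnC.
  rewrite (_ : A :&: _ = [set x in A | stp (opp k) x \in A]) ?addnK.
    by apply: eq_card => x; rewrite !inE andbC.
  by apply/setP => x; rewrite !inE.
rewrite !e; congr (_ - _); rewrite oppK -(card_imset _ (@stp_injr G j)).
apply: eq_card => y; rewrite [RHS]inE; apply/imsetP/andP => [[x]|[yA jA]].
  by rewrite inE => /andP[xA jA] ->; rewrite stpK.
by exists (stp (opp j) y); rewrite ?stpVK // inE jA stpVK.
Qed.

Section Isoperimetry.
Variables L d : nat.
Hypotheses (L4 : 4 <= L) (oL : ~~ odd L).
Local Notation V := (torus_vertex L d).
Local Notation G := (@torus_graph L d L4 oL).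
Implicit Types (A : {set V}) (a b x y : V) (i k c : 'I_d) (m : 'I_L).

Definition up i x : V := torus_stp (i, true) x.

Lemma upE i x c : up i x c = if c == i then ordS (x c) else x c.
Proof. by rewrite /up torus_stpE. Qed.

Lemma up_upd i x m : up i (upd x i m) = upd x i (ordS m).
Proof. by apply/ffunP => c; rewrite upE !ffunE; case: eqP. Qed.

Definition edges A : {set 'I_d * V} := [set e | (e.2 \in A) && (up e.1 e.2 \notin A)].

(** In each direction a set is left as often upwards as downwards ([inflow_opp]), so counting upward
    exits suffices. *)
Lemma nabla_edges (A : {set G}) : nabla A = 2 * #|edges A|.
Proof.
have hf : \sum_i #|inflow A ((i, false) : dir G)| = #|edges A|.
  rewrite -sum1_card [RHS](eq_bigl (fun e => (e.2 \in A) && (up e.1 e.2 \notin A))); last by move=> e; rewrite inE.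
  rewrite -(pair_big_dep predT (fun i x => (x \in A) && (up i x \notin A)) (fun _ _ => 1)) /=.
  by apply: eq_bigr => i _; rewrite -sum1_card; apply: eq_bigl => x; rewrite inE.
rewrite nabla_inflow -hf mul2n -addnn.
rewrite (eq_bigr (fun j : 'I_d * bool => (fun i (u : bool) => #|inflow A ((i, u) : dir G)|) j.1 j.2)); last by case.
rewrite -(pair_bigA _ (fun i (u : bool) => #|inflow A ((i, u) : dir G)|)) /= -big_split /=.
apply: eq_bigr => i _; rewrite big_bool; congr (_ + _).
exact: (inflow_opp A ((i, false) : dir G)).
Qed.

Lemma line_edge A x i m : x \in A -> upd x i m \notin A ->
  exists m', upd x i m' \in A /\ up i (upd x i m') \notin A.
Proof.
move=> xA mA; have [/existsP[m' /andP[h1 h2]]|/existsPn h] :=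
  boolP [exists m', (upd x i m' \in A) && (up i (upd x i m') \notin A)]; first by exists m'.
case/negP: mA; apply: (@ordS_closed L (fun m => upd x i m \in A) (x i)); first by rewrite upd_id.
by move=> b bA; have := h b; rewrite bA up_upd negbK.
Qed.

(* The hybrids of [a] and [b] form a path along coordinate lines; it leaves [A] on one of them. *)
Definition hybrid (k : nat) a b : V := [ffun c : 'I_d => if c < k then b c else a c].

Lemma hybrid_edge A a b : a \in A -> b \notin A -> exists k x,
  [/\ (k, x) \in edges A, a k != b k & forall c, c != k -> x c = hybrid k a b c].
Proof.
move=> aA bA; have h0 : hybrid 0 a b = a by apply/ffunP => c; rewrite ffunE.
have hd : hybrid d a b = b by apply/ffunP => c; rewrite ffunE ltn_ord.
have [k kd [hk hk1]] : exists2 k, k < d & (hybrid k a b \in A) /\ (hybrid k.+1 a b \notin A).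
  have : exists n, hybrid n a b \notin A by exists d; rewrite hd.
  case/ex_minnP => [[|k]] hn hmin; first by rewrite h0 aA in hn.
  exists k; first by apply: hmin; rewrite hd.
  by split=> //; apply: contraT => /hmin; rewrite ltnn.
pose K := Ordinal kd; have step : hybrid k.+1 a b = upd (hybrid k a b) K (b K).
  apply/ffunP => c; rewrite !ffunE ltnS leq_eqVlt.
  by case: (c =P K) => [->|/eqP ne] /=; rewrite ?eqxx // (negbTE (ne : c != k :> nat)).
rewrite step in hk1; have [m [h1 h2]] := line_edge hk hk1.
exists K, (upd (hybrid k a b) K m); split; first by rewrite inE h1.
  apply: contra hk1 => /eqP e; rewrite -e -[a K](_ : hybrid k a b K = _) ?upd_id //.
  by rewrite ffunE ltnn.
by move=> c ck; rewrite updN.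
Qed.

(** Canonical paths: a pair [(a, b)] from [A] and its complement is charged to an exit on its hybrid
    path, in direction [k]. There the coordinates before [k] are those of [b] and the later ones
    those of [a]; the opposite hybrid and [a k] supply the rest. *)
Lemma isoperimetry_cheeger A : #|A| * #|~: A| <= L * L ^ d * #|edges A|.
Proof.
rewrite -cardsX; apply: (@leq_trans #|setX (setX (edges A) [set: V]) [set: 'I_L]|); last first.
  by rewrite !cardsX !cardsT card_ffun !card_ord; lia.
pose r (p : V * V) (q : 'I_d * V * V * 'I_L) := let k := q.1.1.1 in
  [/\ forall c, c != k -> q.1.1.2 c = hybrid k p.1 p.2 c, q.1.2 = hybrid k p.2 p.1 & q.2 = p.1 k].
apply: (@leq_card_rel _ _ _ _ r).
  move=> [a b]; rewrite inE in_setC => /andP[/= aA bA].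
  have [k [x [h1 h2 h3]]] := hybrid_edge aA bA.
  by exists (k, x, hybrid k b a, a k); rewrite ?in_setX ?in_setT ?h1.
move=> [a b] [a' b'] [[[k x] y] m] _ _ [/= h1 h2 h3] [/= h1' h2' h3'].
have off c : (a c = a' c) /\ (b c = b' c).
  have := congr1 (fun f : V => f c) h2; rewrite h2' !ffunE.
  case: (c =P k) => [->|/eqP ck]; first by rewrite ltnn -h3 -h3' => ->.
  by have := h1 c ck; rewrite (h1' c ck) !ffunE; case: (c < k) => -> ->.
by congr pair; apply/ffunP => c; have [] := off c.
Qed.

Lemma edges_setC A : #|edges (~: A)| = #|edges A|.
Proof.
have := nabla_edges A; have := nabla_edges (~: A); rewrite (@nablaC G).
by move=> -> /eqP; rewrite eqn_mul2l /= => /eqP.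
Qed.

(** If all lines in the two directions through points of [A] leave [A], each point is encoded by two
    exits: the one along [i] fixes all its coordinates but [i], the other all but [j]. *)
Lemma full_line A i j : i != j -> #|edges A| * #|edges A| < #|A| ->
  exists a, exists2 k, (k == i) || (k == j) & forall m, upd a k m \in A.
Proof.
move=> ij; rewrite ltnNge -cardsX => /negP hA; apply: contrapT => hn; apply: hA.
have mixed a k : a \in A -> (k == i) || (k == j) -> exists m, upd a k m \notin A.
  move=> aA kij; apply: contrapT => h; apply: hn; exists a, k => // m.
  by apply: contraT => mA; case: h; exists m.
pose r a (q : ('I_d * V) * ('I_d * V)) :=
  (forall c, c != i -> q.1.2 c = a c) /\ (forall c, c != j -> q.2.2 c = a c).
apply: (@leq_card_rel _ _ _ _ r) => [a aA|a a' q _ _ [h1 h2] [h1' h2']].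
  have [|m /(line_edge aA)[m1 [e1 e2]]] := mixed a i aA; first by rewrite eqxx.
  have [|m' /(line_edge aA)[m2 [e3 e4]]] := mixed a j aA; first by rewrite eqxx orbT.
  exists ((i, upd a i m1), (j, upd a j m2)); first by rewrite !inE /= e1 e2 e3 e4.
  by split=> c ck /=; rewrite updN.
apply/ffunP => c; case: (c =P i) => [->|/eqP ci]; last by rewrite -h1 // h1'.
by rewrite -h2 // h2'.
Qed.

(** Otherwise, in each of the [L] layers across direction [k], the line in direction [i] through the
    point of the full line would leave [A], at the cost of one edge per layer. *)
Lemma full_line_dir A a k i : #|edges A| < L -> (forall m, upd a k m \in A) ->
  exists a', forall m, upd a' i m \in A.
Proof.
move=> nL full; have [<-|ki] := eqVneq k i; first by exists a.
apply: contrapT => hn; move: nL; rewrite ltnNge => /negP; apply.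
rewrite -[L in L <= _]card_ord -cardsT.
pose r (m : 'I_L) (q : 'I_d * V) := q.2 k = m.
apply: (@leq_card_rel _ _ _ _ r) => [m _|m m' q _ _ <-]; last by move=> <-.
have [m' hm'] : exists m', upd (upd a k m) i m' \notin A.
  apply: contrapT => h; apply: hn; exists (upd a k m) => m'.
  by apply: contraT => mA; case: h; exists m'.
have [m1 [e1 e2]] := line_edge (full m) hm'.
by exists (i, upd (upd a k m) i m1); rewrite ?inE /= ?e1 // /r /= updN // updE.
Qed.

(** With at least [L] edges this follows from the Cheeger inequality. With fewer, if [A] exceeded
    the square of their number, [A] and its complement would contain full lines in a common
    direction, and each of the [L] layers across it would contain an edge. *)
Lemma isoperimetry_small A : 1 < d -> 2 * #|A| <= L ^ d -> #|A| <= 2 * #|edges A| ^ 2.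
Proof.
move=> d2 hA; set n := #|edges A|.
have cV : #|A| + #|~: A| = L ^ d by rewrite cardsC card_ffun !card_ord.
have [Ln|nL] := leqP L n.
  have h := isoperimetry_cheeger A; rewrite -/n in h.
  have h2 : L ^ d * #|A| <= L ^ d * (2 * L * n).
    apply: (@leq_trans (2 * (#|A| * #|~: A|))); last by nia.
    by rewrite mulnCA mulnC leq_mul2l; apply/orP; right; lia.
  have Ld : 0 < L ^ d by rewrite expn_gt0 (leq_trans _ L4).
  rewrite leq_pmul2l // in h2; apply: (leq_trans h2); rewrite -mulnA leq_mul2l /=.
  by rewrite -mulnn leq_mul2r Ln orbT.
apply: (@leq_trans (n * n)); last by rewrite -mulnn; lia.
rewrite leqNgt; apply/negP => hlt.
have hltC : n * n < #|~: A| by apply: leq_trans hlt _; lia.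
have ij : Ordinal (ltnW d2) != Ordinal d2 by [].
have [a [k _ ha]] := full_line ij hlt.
rewrite -[n](edges_setC A) in nL hltC.
have [b [k' _ hb]] := full_line ij hltC.
have [b1 hb1] := full_line_dir (Ordinal d2) nL hb; rewrite edges_setC in nL.
have [a1 ha1] := full_line_dir (Ordinal d2) nL ha.
set i := Ordinal d2 in ha1 hb1.
move: nL; rewrite ltnNge => /negP; apply; rewrite -[L in L <= _]card_ord -cardsT.
pose r (m : 'I_L) (q : 'I_d * V) := q.2 i = m.
apply: (@leq_card_rel _ _ _ _ r) => [m _|m m' q _ _ <-]; last by move=> <-.
have bA : upd b1 i m \notin A by have := hb1 m; rewrite inE.
have [k1 [x [h1 h2 h3]]] := hybrid_edge (ha1 m) bA.
have ik : i != k1 by apply: contraNneq h2 => <-; rewrite !updE.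
by exists (k1, x) => //; rewrite /r /= h3 // ffunE !updE; case: ifP.
Qed.

Definition shift_by (z : {set 'I_d}) x : V := [ffun c => if c \in z then ordS (x c) else x c].

Lemma shift_by_pair i j x : i != j -> shift_by [set i; j] x = up j (up i x).
Proof.
move=> ij; apply/ffunP => c; rewrite ffunE !upE in_set2.
case: (c =P j) => [->|_]; first by rewrite eq_sym (negbTE ij) orbT.
by rewrite orbF.
Qed.

Lemma up_inj i : injective (up i). Proof. exact: (can_inj (torus_stpK (i, true))). Qed.

Definition pairs : {set {set 'I_d}} := [set z : {set 'I_d} | #|z| == 2].

(** Averaging over [A]: a shift by a pair is two upward steps, and each direction occurs in at most
    [d - 1] pairs. So there are at most [(d - 1) * #|edges A|] failures, spread over at least [d]
    points. *)
Lemma exists_mostly_inside A : d <= #|A| -> 0 < d ->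
  exists2 a, a \in A & #|[set z in pairs | shift_by z a \notin A]| <= #|edges A|.
Proof.
move=> dA d0; apply: contrapT => hn.
pose f i := #|[set x in A | up i x \notin A]|.
have nf : #|edges A| = \sum_i f i.
  rewrite -sum1_card (eq_bigl (fun e : 'I_d * V => (e.2 \in A) && (up e.1 e.2 \notin A))); last by move=> e; rewrite inE.
  rewrite -(pair_big_dep predT (fun i x => (x \in A) && (up i x \notin A)) (fun _ _ => 1)) /=.
  by apply: eq_bigr => i _; rewrite /f -sum1_card; apply: eq_bigl => x; rewrite inE.
have h1 z : z \in pairs -> #|[set x in A | shift_by z x \notin A]| <= \sum_(i in z) f i.
  move=> zP; have /cards2P[i [j [ij ->]]] : #|z| == 2 by rewrite inE in zP.
  rewrite big_setU1 ?inE // big_set1.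
  pose T := [set x | (up i x \in A) && (up j (up i x) \notin A)].
  have cT : #|T| <= f j.
    rewrite -(card_imset (mem T) (@up_inj i)); apply/subset_leq_card/subsetP => _ /imsetP[x xT ->].
    by rewrite inE in xT; rewrite inE.
  apply: (@leq_trans #|[set x in A | up i x \notin A] :|: T|).
    apply/subset_leq_card/subsetP => x; rewrite inE => /andP[xA]; rewrite shift_by_pair // => h.
    by rewrite in_setU !inE xA h andbT /= orNb.
  by apply: leq_trans (leq_cardU _ _) _; rewrite leq_add2l.
have h2 i : #|[set z in pairs | i \in z]| <= d.-1.
  apply: (@leq_trans #|[set [set i; j] | j in [set~ i]]|); last first.
    by apply: leq_trans (leq_imset_card _ _) _; rewrite cardsC1 card_ord.
  apply/subset_leq_card/subsetP => z; rewrite !inE => /andP[/eqP cz iz].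
  have /eqP/cards1P[j ej] : #|z :\ i| = 1 by move: cz; rewrite (cardsD1 i) iz => -[].
  apply/imsetP; exists j; last by rewrite -(setD1K iz) ej.
  by rewrite in_setC; have := set11 j; rewrite -ej !inE => /andP[].
pose bad a := #|[set z in pairs | shift_by z a \notin A]|.
have h3 : \sum_(a in A) bad a <= d.-1 * #|edges A|.
  apply: (@leq_trans (\sum_(z in pairs) \sum_(i in z) f i)).
    apply: (@leq_trans (\sum_(z in pairs) #|[set x in A | shift_by z x \notin A]|)); last exact: leq_sum.
    apply: eq_leq; rewrite /bad.
    under eq_bigr do rewrite -sum1dep_card; under [RHS]eq_bigr do rewrite -sum1dep_card.
    rewrite (exchange_big_dep (mem pairs)) //=; last by move=> a z _ /andP[].
    apply: eq_bigr => z zP; apply: eq_bigl => a; by rewrite zP andbA.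
  rewrite (exchange_big_dep predT) //= nf big_distrr /=; apply: leq_sum => i _.
  rewrite sum_nat_const leq_mul2r; apply/orP; right; apply: leq_trans (h2 i).
  by rewrite cardsE.
have h4 : #|A| * #|edges A|.+1 <= \sum_(a in A) bad a.
  rewrite -sum_nat_const; apply: leq_sum => a aA; rewrite ltnNge; apply/negP => h.
  by apply: hn; exists a.
have := leq_trans h4 h3; apply/negP; rewrite -ltnNge.
apply: (@leq_trans (d * #|edges A|.+1)); last by rewrite leq_mul2r dA orbT.
have pred_lt (m n : nat) : 0 < m -> m.-1 * n < m * n.+1 by case: m => // m _; nia.
exact: pred_lt.
Qed.

(** For all but [2 * n] of the pairs [z], the shifts of [a] and [b] by [z] remain inside and
    outside, and the hybrid path between them yields an edge. Off its direction [k] this edge shows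
    which coordinates belong to [z], and [#|z| = 2] settles [k]; hence there are at most [3 * n]
    pairs. *)
Lemma isoperimetry_local A : d <= #|A| -> d <= #|~: A| -> d * (d - 1) <= 6 * #|edges A|.
Proof.
have [d0|d0] := posnP d; first by have -> : d * (d - 1) = 0 by rewrite d0.
move=> dA dC; set n := #|edges A|.
have [a aA ha] := exists_mostly_inside dA d0.
have [b bC hb] := exists_mostly_inside dC d0.
rewrite edges_setC -/n in hb; rewrite -/n in ha.
pose Z := [set z in pairs | (shift_by z a \in A) && (shift_by z b \notin A)].
have hZ : #|Z| <= n.
  pose r z (q : 'I_d * V) := forall c, c != q.1 ->
    q.2 c = hybrid q.1 (shift_by z a) (shift_by z b) c.
  apply: (@leq_card_rel _ _ _ _ r) => [z|z z' [k x]].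
    rewrite !inE => /and3P[_ h1 h2]; have [k [x [e1 _ e2]]] := hybrid_edge h1 h2.
    by exists (k, x).
  rewrite !inE => /and3P[cz _ _] /and3P[cz' _ _] h1 h2.
  have hS (y : 'I_L) : ordS y == y = false by apply: negbTE; apply: (rot_neq L4 true).
  have off c : c != k -> (c \in z) = (c \in z').
    move=> ck; have := h1 c ck; rewrite (h2 c ck) /= !ffunE.
    by case: (c < k); case: (c \in z); case: (c \in z') => // /eqP; rewrite ?hS // eq_sym hS.
  have eD : z :\ k = z' :\ k by apply/setP => c; rewrite !inE; case: eqP => //= /eqP/off ->.
  apply/setP => c; case: (c =P k) => [->|/eqP/off//].
  move: cz cz'; rewrite (cardsD1 k) (cardsD1 k z') eD.
  by case: (k \in z); case: (k \in z'); move: (#|_|) => [|[|[|]]].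
have : #|pairs| <= #|Z| + (n + n).
  apply: (@leq_trans #|Z :|: ([set z in pairs | shift_by z a \notin A] :|:
    [set z in pairs | shift_by z b \notin ~: A])|).
    apply/subset_leq_card/subsetP => z zP; rewrite !in_setU !inE -/pairs.
    have -> : #|z| == 2 by rewrite inE in zP.
    by case: (shift_by z a \in A); case: (shift_by z b \in A).
  apply: leq_trans (leq_cardU _ _) _; rewrite leq_add2l.
  by apply: leq_trans (leq_cardU _ _) _; apply: leq_add.
rewrite card_draws card_ord bin2 subn1; have := odd_double_half (d * d.-1).
have : odd (d * d.-1) = false by rewrite -(prednK d0) oddM /=; case: (odd _).
move=> ->; rewrite add0n; move: hZ; move: (d * d.-1)./2 #|Z| => u v; lia.
Qed.

Lemma isoperimetry_nabla (A : {set G}) : d <= #|A| -> d <= #|~: A| -> d * (d - 1) <= 3 * nabla A.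
Proof. by move=> h1 h2; rewrite nabla_edges mulnA; exact: isoperimetry_local. Qed.

End Isoperimetry.

(** * Contours *)

Section Contours.
Variable G : step_graph.
Local Notation D := #|dir G|.
Implicit Types (x y r : G) (i j : dir G) (A U W : {set G}) (rho : {set G}).
Variable I : {set G}.
Hypothesis sI : stable I.

(* The even phase: the even points all of whose neighbours see an occupied even point, together
   with the odd points that see one. *)
Definition phase : {set G} := [set x | if par x then [exists j, stp j x \in I]
  else [forall j, [exists k, stp k (stp j x) \in I]]].

Lemma phase_odd x : par x -> (x \in phase) = [exists j, stp j x \in I].
Proof. by rewrite inE => ->. Qed.

Lemma phase_even x : ~~ par x -> (x \in phase) = [forall j, stp j x \in phase].
Proof.
move=> px; rewrite {1}/phase in_set (negbTE px); apply: eq_forallb => j.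
by rewrite phase_odd // par_stp.
Qed.

Lemma occupied_even x : x \in I -> ~~ par x -> x \in phase.
Proof.
move=> xI px; rewrite phase_even //; apply/forallP => j.
by rewrite phase_odd ?par_stp //; apply/existsP; exists (opp j); rewrite stpK.
Qed.

Lemma occupied_odd x : x \in I -> par x -> x \notin phase.
Proof.
move=> xI px; rewrite phase_odd //; apply/existsPn => j; exact: (stableP _ sI).
Qed.

Lemma phase_edge_par x j : x \in phase -> stp j x \notin phase -> par x.
Proof. by move=> xX; apply: contraR => px; move: xX; rewrite phase_even // => /forallP. Qed.

Definition adjK : rel G := fun x y => [&& x \in bnd phase, y \in bnd phase & adj x y].
Definition contour r : {set G} := [set y | connect adjK r y].
Definition cedge r x j := (x \in contour r) && ((stp j x \in phase) != (x \in phase)).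

Lemma adjK_sym : connect_sym adjK.
Proof.
apply: sym_connect_sym => x y; rewrite /adjK andbCA; congr [&& _, _ & _].
by apply/existsP/existsP => -[j /eqP ->]; exists (opp j); rewrite stpK.
Qed.

Lemma bnd_stp U x j : (stp j x \in U) != (x \in U) -> x \in bnd U /\ stp j x \in bnd U.
Proof.
move=> h; split; apply/bndP; first by exists j.
by exists (opp j); rewrite stpK eq_sym.
Qed.

Lemma contour_stp r x j : x \in bnd phase -> stp j x \in bnd phase ->
  (stp j x \in contour r) = (x \in contour r).
Proof.
move=> xK jK; rewrite !inE !(adjK_sym r); apply: (same_connect adjK_sym).
rewrite adjK_sym; apply: connect1; rewrite /adjK xK jK; apply/existsP; by exists j.
Qed.

Lemma contour_bnd r x : r \in bnd phase -> x \in contour r -> x \in bnd phase.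
Proof.
rewrite [x \in contour r]inE => rK /connectP[p pp ->]; elim: p r rK pp => //= y p IH r rK /andP[/and3P[_ yK _]].
exact: IH.
Qed.

Lemma contour_id r : r \in contour r. Proof. by rewrite inE. Qed.

Lemma contour_eq r x : x \in contour r -> contour x = contour r.
Proof.
rewrite inE => h; apply/setP => y; rewrite !inE.
by rewrite -(same_connect adjK_sym h).
Qed.

Lemma contour_ind r (P : G -> Prop) : P r ->
  (forall x j, x \in contour r -> stp j x \in contour r -> x \in bnd phase -> stp j x \in bnd phase ->
     P x -> P (stp j x)) ->
  forall x, x \in contour r -> P x.
Proof.
move=> Pr hs x; rewrite inE => /connectP[p pp ->].
suff h : forall z, z \in contour r -> P z -> path adjK z p -> P (last z p).
  exact: h (contour_id r) Pr pp.
elim: p {pp x} => //= y p IH z zr Pz /andP[/and3P[zK yK /existsP[j /eqP ey]] pp].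
have yr : y \in contour r by rewrite ey contour_stp // -ey.
by apply: IH => //; rewrite ey; apply: hs; rewrite -?ey.
Qed.

Lemma cedge_sym r x j : cedge r (stp j x) (opp j) = cedge r x j.
Proof.
rewrite /cedge stpK eq_sym; case: (boolP (_ != _)) => [h|]; last by rewrite !andbF.
by have [xK jK] := bnd_stp h; rewrite contour_stp.
Qed.

Lemma contour_edge r x : r \in bnd phase -> x \in contour r -> exists j, cedge r x j.
Proof.
move=> rK xr; have /bndP[j hj] := contour_bnd rK xr.
by exists j; rewrite /cedge xr.
Qed.

Definition boundary_of rho U :=
  (forall x j, ((stp j x \in U) != (x \in U)) = [exists r in rho, cedge r x j]).

Section GoodFrom.
Variables (rho U : {set G}).
Hypotheses (sK : rho \subset bnd phase) (bU : boundary_of rho U).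
Hypothesis typeU : forall x, x \in bnd U -> (x \in U) = (x \in phase).

Lemma bnd_boundary x : (x \in bnd U) = [exists r in rho, x \in contour r].
Proof.
apply/bndP/existsP => [[j]|[r /andP[rr xr]]].
  by rewrite bU => /existsP[r /andP[rr /andP[xr _]]]; exists r; rewrite rr.
have [j hj] := contour_edge (subsetP sK _ rr) xr.
by exists j; rewrite bU; apply/existsP; exists r; rewrite rr.
Qed.

(** Occupied even points are in the phase and occupied odd points are not, whereas edges leaving the
    phase have an odd inner end; so their ends are vacant. An odd point of the phase sees an
    occupied even point and an even point outside it has a neighbour outside it; these witnesses
    stay on the right side of [U], which agrees with the phase on its boundary. *)
Lemma boundary_good : good I U.
Proof.
have edge x j : x \in U -> stp j x \notin U -> x \in phase /\ stp j x \notin phase.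
  move=> xU jU; have h : (stp j x \in U) != (x \in U) by rewrite xU (negbTE jU).
  have [xb jb] := bnd_stp h; by rewrite -typeU // -typeU.
split.
- by move=> x j xU jU; have [h1 h2] := edge _ _ xU jU; apply: phase_edge_par h1 h2.
- move=> x j xU jU; have [h1 h2] := edge _ _ xU jU.
  have px := phase_edge_par h1 h2; split.
    by apply: contraL h1 => /occupied_odd; apply.
  by apply: contra h2 => /occupied_even; apply; rewrite par_stp px.
- move=> x xU xb; have xX : x \in phase by rewrite -typeU.
  have /bndP[j0] := xb; rewrite xU eqb_id => j0U; have [_ h2] := edge _ _ xU j0U.
  have px := phase_edge_par xX h2; move: (xX); rewrite phase_odd // => /existsP[j jI].
  exists j; rewrite in_setI jI /=; apply: contraT => jU; have [_] := edge _ _ xU jU.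
  by rewrite occupied_even // par_stp px.
move=> y yU yb; have yX : y \notin phase by rewrite -typeU.
have /bndP[j0] := yb; rewrite (negbTE yU) eqbF_neg negbK => j0U.
have := @edge (stp j0 y) (opp j0) j0U; rewrite stpK => /(_ yU)[h1 h2].
have py : ~~ par y.
  by have := @phase_edge_par (stp j0 y) (opp j0) h1; rewrite stpK par_stp => /(_ h2).
move: yX; rewrite phase_even // => /forallPn[j jX]; exists j; apply: contra jX => jU.
have := @edge (stp j y) (opp j) jU; rewrite stpK => /(_ yU)[h3 _].
by [].
Qed.

Lemma boundary_rooted : rooted adj rho (bnd U).
Proof.
apply/rootedP; split.
  apply/subsetP => r rr; rewrite bnd_boundary; apply/existsP; exists r.
  by rewrite rr contour_id.
move=> P' s1 s2 hc; apply/eqP; rewrite eqEsubset s2; apply/subsetP => x.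
rewrite bnd_boundary => /existsP[r /andP[rr xr]].
apply: (@contour_ind r (fun z => z \in P')) xr; first exact: (subsetP s1).
move=> z j zr jr zK jK zP; apply: hc zP _ _.
  by rewrite bnd_boundary; apply/existsP; exists r; rewrite rr.
by apply/existsP; exists j.
Qed.

End GoodFrom.

Definition cutby r U := forall x j, ((stp j x \in U) != (x \in U)) = cedge r x j.

Lemma cutbyC r U : cutby r U -> cutby r (~: U).
Proof. by move=> cU x j; rewrite -cU !in_setC; do 2!case: (_ \in U). Qed.

Lemma cutby_small r U : cutby r U -> exists2 W, cutby r W & 2 * #|W| <= #|G|.
Proof.
move=> cU; have := cardsC U; have [h|h] := leqP (2 * #|U|) #|G|; first by exists U.
by exists (~: U); [apply: cutbyC|lia].
Qed.

(** Along a step between points of the contour, [U] and the phase change together or not at all. So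
    [U] or its complement agrees with the phase on the whole contour. *)
Lemma cutby_type r U x : cutby r U -> x \in contour r ->
  (x \in U) (+) (x \in phase) = (r \in U) (+) (r \in phase).
Proof.
move=> cU; apply: (@contour_ind r (fun x => (x \in U) (+) (x \in phase) = (r \in U) (+) (r \in phase))) => //.
move=> y j yr jr yK jK <-; have := cU y j; rewrite /cedge yr /=.
by do 4!case: (_ \in _).
Qed.

Lemma cutby_const r r' U x : cutby r U -> contour r' != contour r -> x \in contour r' ->
  (x \in U) = (r' \in U).
Proof.
move=> cU ne; apply: (@contour_ind r' (fun x => (x \in U) = (r' \in U))) => //.
move=> y j yr jr yK jK <-; apply/eqP; apply: contraNT ne; rewrite cU => /andP[yr' _].
by rewrite -(contour_eq yr) -(contour_eq yr').
Qed.

Hypothesis connG : forall A, A != set0 -> (forall x j, x \in A -> stp j x \in A) -> A = setT.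

Lemma closed_empty A x : (forall y j, y \in A -> stp j y \in A) -> x \notin A -> A = set0.
Proof.
move=> h xA; apply/eqP; apply: contraT => /connG/(_ h) e.
by rewrite e inE in xA.
Qed.

Section Laminar.
Variables (r1 r2 : G) (U1 U2 : {set G}).
Hypotheses (r1K : r1 \in bnd phase) (r2K : r2 \in bnd phase).
Hypotheses (c1 : cutby r1 U1) (c2 : cutby r2 U2) (ne : contour r1 != contour r2).
Hypotheses (s1 : 2 * #|U1| <= #|G|) (s2 : 2 * #|U2| <= #|G|).

(** Each contour lies on one side of the other region. In each of the four cases one of the four
    parts into which [U1] and [U2] divide the graph is closed under steps, hence empty. If it is the
    outside of both, the size bounds force the regions to be disjoint. *)
Lemma laminar : [\/ [disjoint U1 & U2], U1 \subset U2 | U2 \subset U1].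
Proof.
have ne' : contour r2 != contour r1 by rewrite eq_sym.
have e1 x j : (stp j x \in U1) != (x \in U1) -> (x \in U2) = (r1 \in U2).
  by rewrite c1 => /andP[xr _]; apply: cutby_const c2 ne xr.
have e2 x j : (stp j x \in U2) != (x \in U2) -> (x \in U1) = (r2 \in U1).
  by rewrite c2 => /andP[xr _]; apply: cutby_const c1 ne' xr.
have [j1 h1] := contour_edge r1K (contour_id r1); rewrite -c1 in h1.
have [a1 a1U] : exists a, a \notin U1.
  by case: (boolP (r1 \in U1)) h1 => [_|]; [rewrite eqb_id; exists (stp j1 r1)|exists r1].
have [t1|t1] := boolP (r1 \in U2); have [t2|t2] := boolP (r2 \in U1).
- constructor 1.
  have eW : ~: (U1 :|: U2) = set0.
    apply: (@closed_empty _ r1); last by rewrite !inE t1 orbT.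
    move=> x j; rewrite !inE !negb_or => /andP[x1 x2].
    apply/andP; split; apply/negP => jU.
      by have := e1 x j; rewrite jU (negbTE x1) (negbTE x2) t1 => /(_ isT).
    by have := e2 x j; rewrite jU (negbTE x1) (negbTE x2) t2 => /(_ isT).
  have cU : #|U1 :|: U2| = #|G| by have := cardsC (U1 :|: U2); rewrite eW cards0 addn0.
  rewrite -setI_eq0 -cards_eq0; have := cardsUI U1 U2; lia.
- constructor 2; rewrite -setD_eq0; apply/eqP.
  apply: (@closed_empty _ r1) => [x j|]; last by rewrite in_setD t1.
  rewrite !in_setD => /andP[x2 x1]; apply/andP; split; apply: contraT => jU.
    by have := e2 x j; rewrite negbK in jU; rewrite jU (negbTE x2) x1 (negbTE t2) => /(_ isT).
  by have := e1 x j; rewrite (negbTE jU) x1 (negbTE x2) t1 => /(_ isT).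
- constructor 3; rewrite -setD_eq0; apply/eqP.
  apply: (@closed_empty _ r2) => [x j|]; last by rewrite in_setD t2.
  rewrite !in_setD => /andP[x1 x2]; apply/andP; split; apply: contraT => jU.
    by have := e1 x j; rewrite negbK in jU; rewrite jU (negbTE x1) x2 (negbTE t1) => /(_ isT).
  by have := e2 x j; rewrite (negbTE jU) x2 (negbTE x1) t2 => /(_ isT).
constructor 1; rewrite -setI_eq0; apply/eqP.
apply: (@closed_empty _ a1) => [x j|]; last by rewrite inE (negbTE a1U).
rewrite !in_setI => /andP[x1 x2]; apply/andP; split; apply: contraT => jU.
  by have := e1 x j; rewrite (negbTE jU) x1 x2 (negbTE t1) => /(_ isT).
by have := e2 x j; rewrite (negbTE jU) x1 x2 (negbTE t2) => /(_ isT).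
Qed.

Lemma cutby_neq : U1 != U2.
Proof.
apply: contra ne => /eqP e; have [j h] := contour_edge r1K (contour_id r1).
move: h; rewrite -c1 e c2 => /andP[h _].
by rewrite (contour_eq h).
Qed.

End Laminar.

Section DisjointUnion.
Variables (rho : {set G}) (Uf : G -> {set G}).
Hypothesis sK : rho \subset bnd phase.
Hypothesis cutU : forall r, r \in rho -> cutby r (Uf r).
Hypothesis disj : forall r r', r \in rho -> r' \in rho -> r != r' -> [disjoint Uf r & Uf r'].
Hypothesis distinct : forall r r', r \in rho -> r' \in rho -> r != r' -> contour r != contour r'.

Let U := \bigcup_(r in rho) Uf r.

Lemma contour_uniq r r' x : r \in rho -> r' \in rho -> x \in contour r -> x \in contour r' -> r = r'.
Proof.
move=> rr rr' xr xr'; apply/eqP; apply: contraT => /(distinct rr rr').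
by rewrite -(contour_eq xr) -(contour_eq xr') eqxx.
Qed.

Lemma union_edge r x j : r \in rho -> cedge r x j -> (x \in U) = (x \in Uf r).
Proof.
move=> rr h; apply/bigcupP/idP => [[r' rr' xr']|xr]; last by exists r.
apply: contraT => xr; have := h; rewrite -cutU // (negbTE xr) eqbF_neg negbK => jr.
have e : r' != r by apply: contraNneq xr => <-.
have jr' : stp j x \notin Uf r' by apply/negP => h'; have := disjointFr (disj rr' rr e) h'; rewrite jr.
have : (stp j x \in Uf r') != (x \in Uf r') by rewrite xr' (negbTE jr').
rewrite cutU // => /andP[x1 _]; move: h => /andP[x2 _].
by rewrite (contour_uniq rr' rr x1 x2) eqxx in e.
Qed.

Lemma union_boundary : boundary_of rho U.
Proof.
move=> x j; apply/idP/existsP => [|[r /andP[rr h]]]; last first.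
  have h' := h; rewrite -cedge_sym in h'.
  by rewrite (union_edge rr h) (union_edge rr h') cutU.
have [xU|xU] := boolP (x \in U).
  have /bigcupP[r rr xr] := xU; rewrite eqb_id => jU; exists r; rewrite rr -cutU // xr eqb_id.
  by apply: contra jU => jr; apply/bigcupP; exists r.
rewrite eqbF_neg negbK => /bigcupP[r rr jr]; exists r; rewrite rr -cutU // jr eq_sym eqb_id.
by apply: contra xU => xr; apply/bigcupP; exists r.
Qed.

Lemma union_type b : (forall r, r \in rho -> (r \in Uf r) (+) (r \in phase) = b) ->
  forall x, x \in bnd U -> (x \in U) = (x \in phase) (+) b.
Proof.
move=> hb x; rewrite (bnd_boundary sK union_boundary) => /existsP[r /andP[rr xr]].
have [j h] := contour_edge (subsetP sK _ rr) xr; rewrite (union_edge rr h) -(hb _ rr).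
by rewrite -(cutby_type (cutU rr) xr) addbC -addbA addbb addbF.
Qed.

Lemma union_nabla : nabla U = \sum_(r in rho) nabla (Uf r).
Proof.
have hU x : x \in U -> exists2 r, r \in rho & x \in Uf r by move/bigcupP=> [r rr xr]; exists r.
transitivity (\sum_(r in rho) \sum_(x in Uf r) ndeg (~: U) x).
  rewrite /nabla; under [RHS]eq_bigr do rewrite big_mkcond /=.
  rewrite exchange_big big_mkcond /=; apply: eq_bigr => x _.
  case: ifPn => [/hU[r rr xr]|xU]; last first.
    rewrite big1 // => r rr; case: ifP => // xr.
    by case/negP: xU; apply/bigcupP; exists r.
  rewrite (bigD1 r) //= xr big1 ?addn0 // => r' /andP[rr' ne].
  by rewrite (disjointFl (disj rr' rr ne)).
apply: eq_bigr => r rr; apply: eq_bigr => x xr; apply: eq_card => j; rewrite !inE.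
apply/idP/idP; first by apply: contra => jr; apply/bigcupP; exists r.
move=> jr; have h : cedge r x j by rewrite -cutU // xr (negbTE jr).
by rewrite -cedge_sym in h; rewrite (union_edge rr h).
Qed.

End DisjointUnion.

End Contours.

(** * Contours that wrap around the torus *)

Section Poincare.
Variables L d : nat.
Hypotheses (L4 : 4 <= L) (oL : ~~ odd L).
Local Notation V := (torus_vertex L d).
Local Notation G := (@torus_graph L d L4 oL).
Implicit Types (A : {set V}) (x y : V) (i j k c : 'I_d) (m : 'I_L) (f : V -> bool).
Implicit Type w : 'I_d -> V -> bool.

Lemma up_closed A : A != set0 -> (forall i x, x \in A -> up i x \in A) -> A = setT.
Proof.
case/set0Pn => a aA h; apply/setP => b; rewrite [RHS]inE; apply: contraT => bA.
by have [k [x [+ _ _]]] := hybrid_edge aA bA; rewrite inE => /andP[/h ->].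
Qed.

Lemma torus_connected (A : {set G}) : A != set0 ->
  (forall x (j : dir G), x \in A -> stp j x \in A) -> A = setT.
Proof. by move=> A0 h; apply: up_closed => // i x xA; apply: (h x (i, true)). Qed.

Lemma upC i j x : up i (up j x) = up j (up i x).
Proof. exact: (@torus_stpC L d (i, true) (j, true)). Qed.

Lemma upd_up i j x m : i != j -> upd (up j x) i m = up j (upd x i m).
Proof.
move=> ij; apply/ffunP => c; rewrite ffunE !upE ffunE; case: (c =P i) => [->|//].
by rewrite (negbTE ij).
Qed.

(** The circulation mod 2 of a form around the cycle through [x] in direction [i]. For a closed form
    it does not depend on [x], so one missed line per direction makes all circulations vanish. *)
Definition circ i f x := \big[addb/false]_m f (upd x i m).

Lemma circ_split i f g x : circ i (fun y => f y (+) g y) x = circ i f x (+) circ i g x.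
Proof. exact: big_split. Qed.

Lemma circ_diff i f x : circ i (fun y => f (up i y) (+) f y) x = false.
Proof.
rewrite circ_split /circ; under eq_bigr do rewrite up_upd.
rewrite [X in _ (+) X](reindex_inj (can_inj (@ordSK L))).
by rewrite addbb.
Qed.

Definition square_closed w := forall i j x, w i x (+) w j (up i x) = w j x (+) w i (up j x).

Lemma circ_up w i j x : square_closed w -> circ i (w i) (up j x) = circ i (w i) x.
Proof.
move=> cw; have [<-|ij] := eqVneq i j.
  by apply: eq_bigr => m _; congr (w i _); apply/ffunP => c; rewrite !ffunE; case: eqP.
transitivity (circ i (fun y => w i y (+) (w j (up i y) (+) w j y)) x).
  apply: eq_bigr => m _; rewrite upd_up //; have := cw i j (upd x i m).
  by do 4!case: (w _ _).
by rewrite circ_split circ_diff addbF.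
Qed.

Lemma circ_const w i x y : square_closed w -> circ i (w i) x = circ i (w i) y.
Proof.
move=> cw; have : x \in [set z | circ i (w i) z == circ i (w i) y].
  rewrite (_ : [set z | _] = setT) ?inE //; apply: up_closed.
    by apply/set0Pn; exists y; rewrite inE.
  by move=> j z; rewrite !inE circ_up.
by rewrite inE => /eqP.
Qed.

(* A closed form mod 2 is made to vanish in one direction after the other by subtracting exact
   forms. *)
Lemma poincare_even w : square_closed w -> (forall i x, circ i (w i) x = false) ->
  exists f, forall i x, f (up i x) (+) f x = w i x.
Proof.
suff main n : forall (S : {set 'I_d}) w, #|~: S| <= n -> square_closed w ->
    (forall i x, circ i (w i) x = false) -> (forall i x, i \in S -> w i x = false) ->
    exists f, forall i x, f (up i x) (+) f x = w i x.
  by move=> cw ew; apply: (main #|~: set0| set0 w) => // i x; rewrite inE.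
elim: n => [|n IH] {}S {}w hn cw ew zw.
  exists (fun=> false) => i x; rewrite zw //; apply: contraT => iS.
  by move: hn; rewrite leqn0 => /eqP/cards0_eq/setP/(_ i); rewrite !inE iS.
have [e0|/set0Pn[i iS]] := eqVneq (~: S) set0; last first.
  pose g x := \big[addb/false]_(m < L | m < x i) w i (upd x i m).
  have gi x : g (up i x) (+) g x = w i x.
    have e m : upd (up i x) i m = upd x i m by apply/ffunP => c; rewrite !ffunE; case: eqP.
    have gx : \big[addb/false]_(m < L | m < (x i).+1) w i (upd x i m) = w i x (+) g x.
      rewrite (bigD1 (x i)) //= upd_id; congr (_ (+) _); apply: eq_bigl => m.
      by rewrite ltnS [RHS]ltn_neqAle andbC.
    rewrite {1}/g (eq_bigr _ (fun m _ => congr1 (w i) (e m))) upE eqxx.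
    rewrite (eq_bigl (fun m : 'I_L => m < if (x i).+1 == L then 0 else (x i).+1)); last first.
      by move=> m; rewrite [X in _ < X](ordS_val L4).
    case: eqP => [eL|_]; last by rewrite gx -addbA addbb addbF.
    rewrite big_pred0 //=; have := ew i x; rewrite /circ.
    rewrite (eq_bigl (fun m : 'I_L => m < (x i).+1)) ?gx; last by move=> m; rewrite eL ltn_ord.
    by case: (w i x); case: (g x).
  pose w' j x := w j x (+) (g (up j x) (+) g x).
  have [||||f hf] := IH (i |: S) w'.
  - move: hn; rewrite (cardsD1 i) iS add1n ltnS; apply: leq_trans.
    by apply/subset_leq_card/subsetP => c; rewrite !inE negb_or.
  - move=> j k x; rewrite /w'; have := cw j k x; rewrite (upC k j).
    by do 4!case: (w _ _); do 4!case: (g _).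
  - by move=> j x; rewrite /w' circ_split ew circ_diff.
  - move=> j x; rewrite in_setU1; have [->|ji] := eqVneq j i; first by rewrite /w' gi addbb.
    move=> /= jS; rewrite /w' zw //= /g upE eq_sym (negbTE ji).
    suff -> : \big[addb/false]_(m < L | m < x i) w i (upd (up j x) i m) = g x by rewrite addbb.
    apply: eq_bigr => m _; rewrite upd_up 1?eq_sym //; have := cw i j (upd x i m).
    by rewrite !(zw j) // addbF addFb.
  exists (fun x => f x (+) g x) => j x; have := hf j x; rewrite /w'.
  by case: (w j x); case: (f _); case: (f _); case: (g _); case: (g _).
by apply: IH cw ew zw; rewrite e0 cards0.
Qed.

Lemma poincare w : square_closed w -> (forall i, exists x, forall m, ~~ w i (upd x i m)) ->
  exists f, forall i x, f (up i x) (+) f x = w i x.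
Proof.
move=> cw h; apply: poincare_even => // i x; have [y hy] := h i.
by rewrite (circ_const _ x y cw) /circ big1 // => m _; apply/negbTE.
Qed.

(** Each [y] is charged to an exit from [U], together with [y i]. If the line through [y] in
    direction [i] lies inside [U], the exit is taken along [k], where the coordinate [y k] is lost;
    the line is therefore chosen with [y k] as its coordinate [i]. *)
Lemma separating_nabla (U : {set G}) i k :
  (forall x, exists m, upd x i m \in U) -> (forall x, exists m, upd x k m \notin U) ->
  L ^ d <= L * #|edges U|.
Proof.
move=> hi hk; rewrite -(card_torus d L4 oL) -cardsT -[L in L * _]card_ord -cardsT mulnC -cardsX.
pose r (y : G) (q : ('I_d * V) * 'I_L) := [/\ y i = q.2,
  forall c, c != i -> c != k -> q.1.2 c = y c &
  (q.1.1 = i /\ (k != i -> q.1.2 k = y k)) \/ [/\ q.1.1 = k, k != i & q.1.2 i = y k]].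
apply: (@leq_card_rel _ _ _ _ r) => [y _|y y' [[c z] m] _ _ [/= h1 h2 h3] [/= h1' h2' h3']].
  have [m mU] := hi y; have [hm|hm] := boolP [exists m', upd y i m' \notin U].
    have /existsP[m' m'U] := hm; have := @line_edge _ _ U (upd y i m) i m' mU.
    rewrite upd_upd => /(_ m'U)[m2 []]; rewrite upd_upd => e1 e2.
    exists ((i, upd y i m2), y i); first by rewrite in_setX !inE e1 e2.
    by split=> //= [c ci _|]; [rewrite updN|left; split=> // ki; rewrite updN].
  have full m' : upd y i m' \in U by move/existsPn: hm => /(_ m'); rewrite negbK.
  have [n] := hk (upd y i (y k)); have [->|ki] := eqVneq k i; first by rewrite upd_upd full.
  move=> nU; have [m2 [e1 e2]] := @line_edge _ _ U (upd y i (y k)) k n (full _) nU.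
  exists ((k, upd (upd y i (y k)) k m2), y i); first by rewrite in_setX !inE e1 e2.
  split=> //= [c ci ck|]; first by rewrite !updN.
  by right; split=> //; rewrite updN 1?eq_sym // updE.
apply/ffunP => b; have [->|bi] := eqVneq b i; first by rewrite h1 h1'.
have [->|bk] := eqVneq b k; last by rewrite -h2 // h2'.
have [eki|ki] := eqVneq k i; first by rewrite eki h1 h1'.
by case: h3 h3' => [[e ->//]|[e _ e']] [[e1 h]|[e1 _ h]]; rewrite -?e' -?h //;
  move: ki; rewrite -e -e1 eqxx.
Qed.

End Poincare.

Section Roots.
Variable G : step_graph.
Implicit Types (x y r : G) (j : dir G) (U : {set G}) (rho C : {set G}).
Variable I : {set G}.
Hypothesis sI : stable I.
Local Notation phase := (phase I).
Local Notation contour := (contour I).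
Local Notation cedge := (cedge I).
Local Notation cutby := (cutby I).

Definition roots : {set G} := [set r in bnd phase | fingraph.root (adjK I) r == r].

Lemma roots_bnd : roots \subset bnd phase.
Proof. by apply/subsetP => r; rewrite inE => /andP[]. Qed.

Lemma root_exists x : x \in bnd phase -> exists2 r, r \in roots & x \in contour r.
Proof.
move=> xK; have h := connect_root (adjK I) x; exists (fingraph.root (adjK I) x).
  rewrite inE root_root ?eqxx ?andbT; last exact: adjK_sym.
  by apply: (contour_bnd xK); rewrite inE.
by rewrite inE adjK_sym.
Qed.

Lemma roots_distinct r r' : r \in roots -> r' \in roots -> r != r' -> contour r != contour r'.
Proof.
rewrite !inE => /andP[_ /eqP er] /andP[_ /eqP er']; apply: contra_neq => e.
have : r' \in contour r by rewrite e contour_id.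
by rewrite inE => /(fingraph.rootP (@adjK_sym _ I)); rewrite er er'.
Qed.

Lemma roots_uniq r r' x : r \in roots -> r' \in roots -> x \in contour r -> x \in contour r' -> r = r'.
Proof. by move=> h h'; apply: (contour_uniq (rho := roots)) => //; exact: roots_distinct. Qed.

Lemma cut_good r U : r \in bnd phase -> cutby r U ->
  exists U', [/\ good I U', rooted adj [set r] (bnd U'), nabla U' = nabla U & U' = U \/ U' = ~: U].
Proof.
move=> rK cU.
have [W [cW hr nW eW]] : exists W, [/\ cutby r W, (r \in W) (+) (r \in phase) = false,
    nabla W = nabla U & W = U \/ W = ~: U].
  case e : ((r \in U) (+) (r \in phase)); last by exists U; split=> //; left.
  exists (~: U); split; [exact: cutbyC|by rewrite in_setC addNb e|exact: nablaC|by right].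
have sK : [set r] \subset bnd phase by rewrite sub1set.
have bW : boundary_of I [set r] W.
  move=> x j; rewrite cW; apply/idP/existsP => [h|[r' /andP[/set1P -> //]]].
  by exists r; rewrite set11.
exists W; split=> //; last exact: (boundary_rooted sK bW).
apply: (boundary_good sI) => x; rewrite (bnd_boundary sK bW) => /existsP[r' /andP[/set1P -> xr]].
by have := cutby_type cW xr; rewrite hr; do 2!case: (_ \in _).
Qed.

Section Xor.
Variables (C : {set G}) (Uf : G -> {set G}).
Hypotheses (sC : C \subset roots) (cutU : forall r, r \in C -> cutby r (Uf r)).

(** Reversing the phase in each region [Uf r] cancels exactly the contours in [C]. *)
Definition xor_region : {set G} :=
  [set x | (x \in phase) (+) \big[addb/false]_(r in C) (x \in Uf r)].

Lemma xor_boundary : boundary_of I (roots :\: C) xor_region.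
Proof.
have ex (a b : bool) : (a != b) = a (+) b by case: a; case: b.
have xrE y : (y \in xor_region) = (y \in phase) (+) \big[addb/false]_(r in C) (y \in Uf r) by rewrite inE.
move=> x j; rewrite ex !xrE.
rewrite (_ : _ (+) _ = ((stp j x \in phase) != (x \in phase)) (+) \big[addb/false]_(r in C) cedge r x j); last first.
  rewrite ex [in RHS](eq_bigr (fun r => (stp j x \in Uf r) (+) (x \in Uf r))) => [|r rC]; last by rewrite -cutU // ex.
  by rewrite big_split addbACA.
rewrite /cedge; case: (boolP (_ != _)) => h; last first.
  rewrite big1 => [|r _]; last by rewrite andbF.
  by apply/esym/existsP => -[r /andP[_]]; rewrite andbF.
have [xK _] := bnd_stp h; have [r0 r0R xr0] := root_exists xK.
have e r : r \in roots -> (x \in contour r) = (r == r0).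
  move=> rR; apply/idP/eqP => [xr|->//]; exact: roots_uniq xr xr0.
rewrite (eq_bigr (fun r => r == r0)) => [|r rC]; last by rewrite andbT e // (subsetP sC).
have -> : \big[addb/false]_(r in C) (r == r0) = (r0 \in C).
  case: (boolP (r0 \in C)) => r0C; last first.
    by rewrite big1 // => r rC; apply: contraNF r0C => /eqP <-.
  rewrite (bigD1 r0) //= eqxx big1 ?addbF // => r /andP[_ /negbTE ->].
  by [].
rewrite addTb; apply/idP/existsP => [r0C|[r]].
  by exists r0; rewrite in_setD r0C r0R xr0.
by rewrite in_setD andbT => /andP[/andP[rC rR]]; rewrite e // => /eqP <-.
Qed.

End Xor.
End Roots.

Section Wrap.
Variables L d : nat.
Hypotheses (L4 : 4 <= L) (oL : ~~ odd L).
Local Notation V := (torus_vertex L d).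
Local Notation G := (@torus_graph L d L4 oL).
Implicit Types (x y r : G) (i k : 'I_d) (U : {set G}) (rho : {set G}).
Variable I : {set G}.
Hypothesis sI : stable I.

Definition cedge_up r i x := cedge I r x ((i, true) : dir G).

(** The phase changes an even number of times around a unit square, and adjacent boundary points lie
    on the same contour. Hence crossings of the square, whether they share a vertex or are opposite,
    belong to one contour. *)
Lemma cedge_up_closed r : square_closed (cedge_up r).
Proof.
have c y z z' i (j j' : dir G) : z = @stp G j (up i y) -> z' = @stp G j' y ->
    ((z \in phase I) != (up i y \in phase I)) || ((up i y \in phase I) != (y \in phase I)) ->
    ((z' \in phase I) != (y \in phase I)) || ((up i y \in phase I) != (y \in phase I)) ->
    (up i y \in contour I r) == (y \in contour I r).
  move=> -> -> h h'; apply/eqP/(@contour_stp _ _ r y ((i, true) : dir G)).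
    by case/orP: h' => [/bnd_stp[]|/(@bnd_stp _ _ y ((i, true) : dir G))[]].
  by case/orP: h => [/bnd_stp[]|/(@bnd_stp _ _ y ((i, true) : dir G))[]].
move=> i k x; have down y m : y = @stp G ((m, false) : dir G) (up m y) by rewrite (@stpK G (m, true)).
have := c x (up k (up i x)) (up k x) i (k, true) (k, true) erefl erefl.
have := c x (up k (up i x)) (up i x) k (i, true) (i, true) (upC k i x) erefl.
have := c (up i x) (up k x) x k (i, false) (i, false); rewrite (upC k i) => /(_ (down _ _) (down _ _)).
have := c (up k x) (up i x) x i (k, false) (k, false); rewrite (upC i k) => /(_ (down _ _) (down _ _)).
rewrite /cedge_up /cedge /= -!/(up _ _) (upC i k).
by do 4!case: (_ \in phase I) => //=; do 4!case: (_ \in contour I r) => //=; move=> h1 h2 h3 h4;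
  first [by []|by move: (h1 isT isT)|by move: (h2 isT isT)|by move: (h3 isT isT)|by move: (h4 isT isT)].
Qed.

Lemma cut_or_wrap r : (exists U, cutby I r U) \/ exists i, forall x, exists m, cedge_up r i (upd x i m).
Proof.
have [h|/existsNP[i h]] := pselect (forall i, exists x, forall m, ~~ cedge_up r i (upd x i m)); last first.
  right; exists i => x; apply: contrapT => hx; apply: h; exists x => m.
  by apply/negP => h; apply: hx; exists m.
left; have [f hf] := poincare L4 (cedge_up_closed r) h; exists [set x | f x].
have hu (x : G) i : ((stp ((i, true) : dir G) x \in [set y | f y]) != (x \in [set y | f y])) =
    cedge I r x ((i, true) : dir G).
  by rewrite !inE; have := hf i x; rewrite /cedge_up => <-; rewrite /up; case: (f x); case: (f _).
move=> x [i [|]]; first exact: hu.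
have := hu (stp ((i, false) : dir G) x) i; rewrite (@stpVK G (i, true)) => h1.
by rewrite -(@cedge_sym G I r x ((i, false) : dir G)) eq_sym; exact: h1.
Qed.

Definition wraps r := exists i, forall x, exists m, cedge_up r i (upd x i m).

Lemma wrap_nabla rho U : rho \subset roots I -> boundary_of I rho U -> (forall r, r \in rho -> wraps r) ->
  L ^ d * #|rho| <= L * nabla U.
Proof.
move=> sR bU hw; rewrite -(card_torus d L4 oL) -cardsT mulnC -cardsX.
apply: (@leq_trans #|setX (edges U :|: edges (~: U)) [set: 'I_L]|); last first.
  rewrite cardsX cardsT card_ord mulnC leq_mul2l; apply/orP; right.
  by apply: leq_trans (leq_cardU _ _) _; rewrite (edges_setC L4 oL) (nabla_edges U) mul2n addnn.
pose r (p : G * G) (q : ('I_d * V) * 'I_L) := [/\ cedge_up p.1 q.1.1 q.1.2,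
  forall c, c != q.1.1 -> q.1.2 c = p.2 c & p.2 q.1.1 = q.2].
apply: (@leq_card_rel _ _ _ _ r) => [[s y]|[s y] [s' y'] [[c z] m]].
  rewrite inE => /andP[/= sr _]; have [i /(_ y)[m hm]] := hw _ sr.
  exists ((i, upd y i m), y i); last by split=> //= c ci; rewrite updN.
  have : (@stp G (i, true) (upd y i m) \in U) != (upd y i m \in U).
    by rewrite bU; apply/existsP; exists s; rewrite sr.
  rewrite in_setX in_setT andbT in_setU !inE /= -/(up i (upd y i m)) negbK.
  by do 2!case: (_ \in U).
rewrite !inE !andbT => /= sr s'r [/= h1 h2 h3] [/= h1' h2' h3'].
have -> : s = s'.
  move/andP: h1 => [h1 _]; move/andP: h1' => [h1' _].
  by apply: (roots_uniq _ _ h1 h1'); apply: (subsetP sR).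
congr pair; apply/ffunP => e; have [->|ne] := eqVneq e c; first by rewrite h3 h3'.
by rewrite -h2 // h2'.
Qed.

(* If a separating contour with a small boundary had wrapping contours on both sides, every line of
   some family of parallel lines would cross it; so all wrapping contours lie on one side of it, and
   reversing the phase on the other sides leaves a region bounded by the wrapping contours alone. *)
Lemma wrap_case : (exists2 r, r \in roots I & ~ exists U, cutby I r U) ->
  exists rho U, [/\ good I U, rooted adj rho (bnd U), 0 < #|rho| & L ^ d * #|rho| <= L * nabla U].
Proof.
case=> r0 r0R nc0.
have [[r [U [rR cU hU]]]|nW] := pselect (exists r U, [/\ r \in roots I, cutby I r U & L ^ d <= L * nabla U]).
  have [W [gW rW nW _]] := cut_good sI (subsetP (roots_bnd I) _ rR) cU.
  by exists [set r], W; rewrite cards1 muln1 nW.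
pose C := [set r in roots I | `[< exists U, cutby I r U >]].
(* All regions are taken on the side away from [r0], so a region containing another wrapping contour
   separates it from the one of [r0], and [separating_nabla] applies. *)
have /choice[Uf hUf] : forall r, exists U, r \in C -> cutby I r U /\ r0 \notin U.
  move=> r; have [|_] := boolP (r \in C); last by exists set0.
  rewrite inE => /andP[_ /asboolP[U cU]]; have [h|h] := boolP (r0 \in U); last by exists U.
  by exists (~: U) => _; split; [exact: cutbyC|rewrite in_setC h].
have sC : C \subset roots I by apply/subsetP => r; rewrite inE => /andP[].
have cU r : r \in C -> cutby I r (Uf r) by move=> /hUf[].
have bU := xor_boundary sC cU; set U := xor_region _ _ _ in bU.
have wrap r : r \in roots I :\: C -> wraps r.
  rewrite in_setD => /andP[nC rR]; case: (cut_or_wrap r) => // hc.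
  by case/negP: nC; rewrite inE rR; apply/asboolP.
have r0C : r0 \in roots I :\: C by rewrite in_setD r0R inE r0R andbT; apply/negP => /asboolP.
have sR : roots I :\: C \subset roots I by exact: subsetDl.
have sB := subset_trans sR (roots_bnd I).
have out r r' x : r \in C -> r' \in roots I :\: C -> x \in contour I r' -> x \notin Uf r.
  move=> rC r'C xr'.
  have ne s : s \in roots I :\: C -> contour I s != contour I r.
    move=> sC'; apply: (roots_distinct (subsetP sR _ sC') (subsetP sC _ rC)).
    by apply: contraTneq sC' => ->; rewrite in_setD rC.
  rewrite (cutby_const (cU _ rC) (ne _ r'C) xr'); apply/negP => r'U; apply: nW.
  exists r, (Uf r); split; [exact: (subsetP sC)|exact: cU|].
  have [i hi] := wrap _ r'C; have [k hk] := wrap _ r0C; have [_ r0U] := hUf _ rC.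
  apply: leq_trans (separating_nabla (U := Uf r) (i := i) (k := k) _ _) _.
  - move=> y; have [m /andP[hm _]] := hi y; exists m.
    by rewrite (cutby_const (cU _ rC) (ne _ r'C) hm).
  - move=> y; have [m /andP[hm _]] := hk y; exists m.
    by rewrite (cutby_const (cU _ rC) (ne _ r0C) hm).
  by rewrite leq_mul2l nabla_edges; apply/orP; right; lia.
exists (roots I :\: C), U; split.
- apply: (boundary_good sI) => x; rewrite (bnd_boundary sB bU) => /existsP[r' /andP[r'C xr']].
  rewrite /U inE big1 ?addbF // => r rC; exact/negbTE/(out _ _ _ rC r'C xr').
- exact: (boundary_rooted sB bU).
- by apply/card_gt0P; exists r0.
exact: wrap_nabla.
Qed.
End Wrap.

(** * Outermost contours *)

Section AllCut.
Variable G : step_graph.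
Implicit Types (x y r : G) (j : dir G) (U : {set G}) (rho : {set G}).
Local Notation D := #|dir G|.

Lemma card_star U x : (forall j, stp j x \in U) -> D <= #|U|.
Proof.
move=> h; rewrite -cardsT -(card_imset _ (@stp_inj G x)).
by apply/subset_leq_card/subsetP => _ /imsetP[j _ ->].
Qed.

Section Star.
Variables (I U : {set G}).
Hypothesis gU : good I U.

(** An inner boundary point has an even neighbour in [U], all of whose neighbours lie in [U]; an
    outer one has an odd neighbour outside [U], all of whose neighbours lie outside. This supplies
    the sizes required by the local isoperimetric inequality. *)
Lemma good_star : bnd U != set0 -> D <= #|U| /\ D <= #|~: U|.
Proof.
have [oU _ inn out] := gU; case/set0Pn => z /bndP[k hk].
have [x [j [xU jU]]] : exists x j, x \in U /\ stp j x \notin U.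
  case: (boolP (z \in U)) hk => [zU|zU].
    by rewrite eqb_id; exists z, k.
  by rewrite eqbF_neg negbK => kU; exists (stp k z), (opp k); rewrite stpK.
have h : (stp j x \in U) != (x \in U) by rewrite xU (negbTE jU).
have [xb jb] := bnd_stp h; have px := oU _ _ xU jU; split.
  have [i] := inn _ xU xb; rewrite inE => /andP[_ iU].
  by apply: (@card_star _ (stp i x)) => i'; apply: odd_even_in => //; rewrite par_stp px.
have [i iU] := out _ jU jb.
apply: (@card_star _ (stp i (stp j x))) => i'; rewrite in_setC.
by apply: odd_even_out => //; rewrite !par_stp px.
Qed.

End Star.

Hypothesis connG : forall A : {set G}, A != set0 -> (forall x j, x \in A -> stp j x \in A) -> A = setT.
Variable I : {set G}.
Hypothesis sI : stable I.
Local Notation phase := (phase I).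
Local Notation contour := (contour I).
Local Notation cutby := (cutby I).
Local Notation roots := (roots I).

(** The default [set0] does not occur for roots once all contours cut. When both sides have exactly
    half of the points, either may be picked. *)
Definition interior r : {set G} :=
  if [pick U : {set G} | `[< cutby r U >] && (2 * #|U| <= #|G|)] is Some U then U else set0.

Definition all_cut := forall r, r \in roots -> exists U, cutby r U.

Definition outermost : {set G} := [set r in roots |
  [forall s in roots, (interior r \subset interior s) ==> (s == r)]].

(* The outermost contours whose interior boundary lies in the odd phase ([b = false]) or in the
   even phase ([b = true]). *)
Definition outer b : {set G} := [set r in outermost | (r \in interior r) (+) (r \in phase) == b].

Lemma outermost_roots : outermost \subset roots.
Proof. by apply/subsetP => r; rewrite inE => /andP[]. Qed.

Hypothesis aC : all_cut.

Lemma interiorP r : r \in roots -> cutby r (interior r) /\ 2 * #|interior r| <= #|G|.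
Proof.
move=> rR; have [U cU] := aC rR; have [W cW sW] := cutby_small sI cU; rewrite /interior.
by case: (pickP (fun U : {set G} => `[< cutby r U >] && (2 * #|U| <= #|G|))) => [W' /andP[/asboolP c s]//|/(_ W)]; rewrite sW andbT => /asboolP.
Qed.

Lemma interior_inj r s : r \in roots -> s \in roots -> interior r = interior s -> r = s.
Proof.
move=> rR sR; apply: contra_eq => ne; have [c1 s1] := interiorP rR; have [c2 s2] := interiorP sR.
by apply: (cutby_neq (subsetP (roots_bnd I) _ rR) c1 c2); apply: roots_distinct.
Qed.

Lemma outermost_disjoint r s : r \in outermost -> s \in outermost -> r != s ->
  [disjoint interior r & interior s].
Proof.
move=> rM sM ne; have rR := subsetP outermost_roots _ rM; have sR := subsetP outermost_roots _ sM.
have rB := subsetP (roots_bnd I) _ rR; have sB := subsetP (roots_bnd I) _ sR.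
have [c1 s1] := interiorP rR; have [c2 s2] := interiorP sR.
move: rM sM; rewrite [r \in _]inE [s \in _]inE => /andP[_ /forall_inP rM] /andP[_ /forall_inP sM].
case: (laminar sI connG rB sB c1 c2 (roots_distinct rR sR ne) s1 s2) => // h.
  by move: (rM _ sR); rewrite h eq_sym (negbTE ne).
by move: (sM _ rR); rewrite h (negbTE ne).
Qed.

Lemma outermost_cover r : r \in roots -> exists2 s, s \in outermost & interior r \subset interior s.
Proof.
move=> rR; pose P s := (s \in roots) && (interior r \subset interior s).
have Pr : P r by rewrite /P rR /=.
case: (arg_maxnP (fun s => #|interior s|) Pr) => s /andP[sR rs] smax; exists s => //.
rewrite inE sR /=; apply/forall_inP => u uR; apply/implyP => su.
apply/eqP/interior_inj => //; apply/eqP; rewrite eq_sym eqEcard su /=.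
by apply: smax; rewrite /P uR (subset_trans rs).
Qed.

(** Reversing the phase in all interiors removes every boundary edge, so the result is constant. The
    phase of a point thus depends on the parity of the number of interiors around it, and the points
    of one phase are in at least one interior, hence in an outermost one. *)
Lemma phase_covered : exists b, forall x, (x \in phase) = ~~ b ->
  x \in \bigcup_(r in outermost) interior r.
Proof.
have bU := xor_boundary (subxx roots) (fun r rR => (interiorP rR).1).
set U := xor_region _ _ _ in bU.
have cl x j : (stp j x \in U) = (x \in U).
  apply/eqP; rewrite -[_ == _]negbK bU setDv; apply/existsPn => r; by rewrite inE.
have [b hb] : exists b, forall x, (x \in U) = b.
  have [->|/connG ->] := eqVneq U set0; first by exists false => x; rewrite inE.
    by exists true => x; rewrite inE.
  by move=> x j; rewrite cl.
exists b => x hx; apply: contraT => xI.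
move: (hb x); rewrite inE hx big1 => [|r rR]; first by case: (b).
apply: contraNF xI => xr; have [s sM /subsetP rs] := outermost_cover rR.
by apply/bigcupP; exists s => //; apply: rs.
Qed.

Lemma outer_volume : minn #|phase| #|~: phase| <=
  \sum_(r in outer false) #|interior r| + \sum_(r in outer true) #|interior r|.
Proof.
have -> : \sum_(r in outer false) #|interior r| + \sum_(r in outer true) #|interior r| =
    \sum_(r in outermost) #|interior r|.
  rewrite [RHS](bigID (fun r => (r \in interior r) (+) (r \in phase) == false)) /=; congr (_ + _).
    by apply: eq_bigl => r; rewrite inE.
  by apply: eq_bigl => r; rewrite inE; case: (_ (+) _).
have [b hb] := phase_covered.
have : #|\bigcup_(r in outermost) interior r| <= \sum_(r in outermost) #|interior r|.
  elim/big_rec2: _ => [|r m U _ h]; first by rewrite cards0.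
  by apply: leq_trans (leq_cardU _ _) _; rewrite leq_add2l.
apply: leq_trans; case: b hb => hb; rewrite geq_min; apply/orP; [right|left];
  apply/subset_leq_card/subsetP => x hx; apply: hb; first by rewrite in_setC in hx; apply/negbTE.
by rewrite hx.
Qed.

(** For outermost contours of a single type, the union of the interiors agrees with the phase along
    its whole boundary, or disagrees along all of it, and then the complement is good. *)
Lemma outer_good b rho : rho \subset outer b -> exists U, [/\ good I U, rooted adj rho (bnd U)
  & nabla U = \sum_(r in rho) nabla (interior r)].
Proof.
move=> sO; have oP r : r \in rho -> (r \in outermost) && ((r \in interior r) (+) (r \in phase) == b).
  by move/(subsetP sO); rewrite inE.
have rM r : r \in rho -> r \in outermost by move/oP/andP=> [].
have rR r : r \in rho -> r \in roots by move/rM; apply: (subsetP outermost_roots).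
have sK : rho \subset bnd phase by apply/subsetP => r /rR; apply: (subsetP (roots_bnd I)).
have cU r : r \in rho -> cutby r (interior r) by move/rR => /interiorP[].
have dj r s : r \in rho -> s \in rho -> r != s -> [disjoint interior r & interior s].
  by move=> /rM h1 /rM h2; apply: outermost_disjoint.
have ds r s : r \in rho -> s \in rho -> r != s -> contour r != contour s.
  by move=> /rR h1 /rR h2; apply: roots_distinct.
have bU := union_boundary cU dj ds.
have tU : forall r, r \in rho -> (r \in interior r) (+) (r \in phase) = b.
  by move=> r /oP/andP[_ /eqP].
have nU := union_nabla cU dj ds; have := union_type sK cU dj ds tU.
set U := \bigcup_(r in rho) _ in bU nU *; case: b {sO oP} tU => tU h.
  exists (~: U); split; last by rewrite nablaC.
    apply: (boundary_good sI) => x; rewrite bndC => /h; rewrite in_setC.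
    by move=> ->; rewrite addbT negbK.
  by rewrite bndC; exact: (boundary_rooted sK bU).
exists U; split=> //; last exact: (boundary_rooted sK bU).
by apply: (boundary_good sI) => x /h; rewrite addbF.
Qed.

Lemma interior_good r : r \in roots -> exists U, [/\ good I U, nabla U = nabla (interior r),
  D <= #|interior r| & D <= #|~: interior r|].
Proof.
move=> rR; have rB := subsetP (roots_bnd I) _ rR; have [c _] := interiorP rR.
have [U [gU rU nU eU]] := cut_good sI rB c; exists U.
have bU : bnd U != set0.
  by apply/set0Pn; exists r; have /rootedP[/subsetP h _] := rU; apply: h; rewrite inE.
have [h1 h2] := good_star gU bU.
by split=> //; case: eU h1 h2 => ->; rewrite ?setCK.
Qed.

End AllCut.

(** * Exponential moments of the volume enclosed by outermost contours *)

Section Chernoff.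
Variable R : realType.
Local Open Scope ring_scope.

Lemma geometric_sum_le (s : R) M : 0 < s <= 1 -> \sum_(i < M) expR (- (s * i%:R)) <= 2 / s.
Proof.
move=> /andP[s0 s1]; have hy : expR (- s) <= 1 - s / 2.
  rewrite expRN -[X in X <= _]mul1r ler_pdivrMr ?expR_gt0 //.
  have := expR_ge1Dx s; have := expR_gt0 s; nra.
suff h : (1 - expR (- s)) * \sum_(i < M) expR (- (s * i%:R)) = 1 - expR (- (s * M%:R)).
  have h1 : s / 2 * \sum_(i < M) expR (- (s * i%:R)) <= 1.
    apply: (@le_trans _ _ (1 - expR (- (s * M%:R)))); last by have := expR_gt0 (- (s * M%:R)); lra.
    rewrite -h ler_wpM2r ?sumr_ge0 // => [i _|]; first exact: expR_ge0.
    by lra.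
  by rewrite ler_pdivlMr // mulrC; lra.
elim: M => [|M IH]; first by rewrite big_ord0 !mulr0 oppr0 expR0 subrr.
rewrite big_ord_recr /= mulrDr IH -[M.+1]addn1 natrD mulrDr opprD mulr1 expRD; ring.
Qed.

Lemma expR_sub1_le (y : R) : expR y - 1 <= y * expR y.
Proof.
have := expR_ge1Dx (- y); rewrite expRN => h.
have : (1 - y) * expR y <= 1 by rewrite -ler_pdivlMr ?expR_gt0 // mul1r.
lra.
Qed.

Variable d : nat.
Local Notation dR := (d%:R : R).
Local Notation l := (ln dR).
Local Notation k := (kappa R d).
Hypothesis l_big : 10 ^+ 5 <= l.

Lemma volume_le u B : (d <= 13 * B)%N -> (u <= 2 * (d * B) ^ 2)%N -> u%:R <= expR (k * B%:R / 4).
Proof.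
move=> dB hu; have k0 := kappa_gt0 l_big; have kB := kt_big l_big dB.
have k2 := kappa_sqr l_big; have l1 := l_ge1 l_big; have d1 := d_ge1 l_big.
have d3 : 512 * dR ^+ 3 <= dR ^+ 4.
  rewrite [dR ^+ 4]exprSr mulrC ler_pM2l; last by rewrite exprn_gt0 //; lra.
  have := d_ge_l3 l_big; apply: le_trans; apply: (@le_trans _ _ (10 ^+ 14 * 1)); first by lra.
  by rewrite ler_pM2l ?exprn_gt0 // exprn_ege1.
set s := k * B%:R in kB *; have s0 : 0 <= s by rewrite mulr_ge0 //; lra.
have h1 : dR ^+ 4 <= expR (s / 8).
  rewrite {1}(d_expR l_big) -expRM_natl ler_expR; lra.
have h2 : (s / 8 / 2) ^+ 2 <= expR (s / 8) by apply: (expR_ge_pow 1); lra.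
have -> : s / 4 = s / 8 + s / 8 by field.
rewrite expRD; apply: le_trans (ler_pM _ _ h1 h2); rewrite ?sqr_ge0 ?exprn_ge0 //.
apply: (@le_trans _ _ (2 * (dR * B%:R) ^+ 2)).
  by rewrite -natrM -natrX -[2]/(2%:R) -natrM ler_nat.
apply: (@le_trans _ _ (512 * dR ^+ 3 * (s / 8 / 2) ^+ 2)); last first.
  by rewrite ler_wpM2r // sqr_ge0.
have -> : 512 * dR ^+ 3 * (s / 8 / 2) ^+ 2 = 2 * (dR * B%:R) ^+ 2 * (k ^+ 2 * dR) by rewrite /s; field.
by rewrite k2 ler_peMr // mulr_ge0 // sqr_ge0.
Qed.

Variable L : nat.
Hypotheses (L4 : (4 <= L)%N) (oL : ~~ odd L).
Local Notation LR := (L%:R : R).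

(* The exponential tilt of the volume is balanced against half of the cost k B of a contour. *)
Definition tilt : R := k / (8 * dR * LR).

Lemma L_ge1 : 1 <= LR. Proof. by rewrite ler1n (leq_trans _ L4). Qed.

Lemma tilt_gt0 : 0 < tilt.
Proof.
have := kappa_gt0 l_big; have := d_gt0 l_big; have := L_ge1 => *.
by rewrite divr_gt0 ?mulr_gt0 //; lra.
Qed.

(** [exp v - 1 <= v * exp v] leaves a factor [u] and an exponential. The quadratic volume bound,
    free of [L], absorbs the factor into [exp (kappa * B / 4)]; the linear one, with its factor [L],
    is used in the exponent only, where the tilt compensates it. *)
Lemma tilt_bound u B : (d <= 13 * B)%N -> (u <= 2 * (d * B) ^ 2)%N -> (u <= 2 * L * (d * B))%N ->
  expR (tilt * u%:R) - 1 <= tilt * expR (k * B%:R / 2).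
Proof.
move=> dB h1 h2; have t0 := tilt_gt0; have L1 := L_ge1; have d0 := d_gt0 l_big.
have hu := volume_le dB h1.
have ht : tilt * u%:R <= k * B%:R / 4.
  apply: (@le_trans _ _ (tilt * (2 * LR * (dR * B%:R)))).
    by rewrite ler_pM2l // -!natrM ler_nat.
  have hL : LR != 0 by rewrite lt0r_neq0 //; lra.
  by rewrite (_ : tilt * _ = k * B%:R / 4) // /tilt; field; rewrite hL lt0r_neq0.
apply: le_trans (expR_sub1_le _) _; rewrite -mulrA ler_pM2l //.
have -> : k * B%:R / 2 = k * B%:R / 4 + k * B%:R / 4 by field.
by rewrite expRD ler_pM ?expR_ge0 // ler_expR.
Qed.

(** The price of one outermost contour apart from the tilt: 2 comes from [2 ^+ #|rho|] and [8 / k]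
    from the sum over [B]. Of the gain [k * B], half pays for the tilt and a quarter makes this sum
    converge; the last quarter gives the exponent, as [d <= 13 * B]. *)
Definition fugacity : R := 16 / k * expR (- (k * dR / 52)).

Lemma fugacity_ge0 : 0 <= fugacity.
Proof. by have := kappa_gt0 l_big => h; rewrite mulr_ge0 ?expR_ge0 // divr_ge0 //; lra. Qed.

Lemma kappa_ge_inv : dR^-1 <= k.
Proof.
have k0 := kappa_gt0 l_big; have d1 := d_ge1 l_big; have l1 := l_ge1 l_big.
rewrite -[X in X <= _]mul1r ler_pdivrMr; last by lra.
rewrite -(@ler_pXn2r _ 2) ?nnegrE //; last by rewrite mulr_ge0 //; lra.
rewrite expr1n exprMn expr2 [dR ^+ 2]expr2 mulrA.
by have := kappa_sqr l_big; rewrite expr2 => ->; nra.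
Qed.

Lemma fugacity_le : fugacity <= (16 * dR)^-1.
Proof.
have k0 := kappa_gt0 l_big; have d1 := d_ge1 l_big; have kd := kappa_d l_big; have l1 := l_ge1 l_big.
have h : expR (- (k * dR / 52)) <= dR ^- 3.
  rewrite {2}(d_expR l_big) -expRM_natl -expRN ler_expR lerN2.
  have : l <= l ^+ 2 by rewrite expr2 ler_peMr //; lra.
  lra.
have d256 : 256 <= dR.
  have := d_ge_l3 l_big; apply: le_trans; apply: (@le_trans _ _ (10 ^+ 14 * 1)); first by lra.
  by rewrite ler_pM2l ?exprn_gt0 // exprn_ege1.
rewrite /fugacity; apply: (@le_trans _ _ (16 / k * dR ^- 3)).
  by rewrite ler_pM2l // divr_gt0.
apply: (@le_trans _ _ (16 * dR * dR ^- 3)).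
  rewrite ler_pM2r; last by rewrite invr_gt0 exprn_gt0 //; lra.
  by have := kappa_ge_inv => ?; rewrite ler_pM2l // invf_ple ?posrE //; lra.
rewrite -[X in _ <= X]mul1r ler_pdivlMr; last by lra.
have -> : 16 * dR * dR ^- 3 * (16 * dR) = 256 / dR by field; lra.
by rewrite ler_pdivrMr; lra.
Qed.

Local Notation G := (@torus_graph L d L4 oL).
Local Notation vol I r := (#|interior (G := G) I r|%:R : R).
Implicit Types (I rho : {set G}) (r : G).

Lemma volume_nat (u v w e B : nat) : (0 < w -> u + v = w -> 2 * u <= w -> u * v <= L * w * e ->
  2 * e = 2 * d * B -> u <= 2 * L * (d * B))%N.
Proof.
move=> w0 e1 h1 h2 e2; have -> : (d * B = e)%N by lia.
rewrite -(leq_pmul2l w0); apply: (@leq_trans (2 * (u * v))%N); last first.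
  by rewrite [X in (_ <= X)%N](_ : _ = 2 * (L * w * e))%N; [rewrite leq_mul2l h2|lia].
by rewrite -e1 in h1 *; nia.
Qed.

(** The inequality reduces to [d - 1 <= 6 * B]; the constant 13 leaves room. *)
Lemma local_nat n B : (100 <= d -> n = 2 * d * B -> d * (d - 1) <= 3 * n -> d <= 13 * B)%N.
Proof.
move=> d1 ->; have -> : (3 * (2 * d * B) = d * (6 * B))%N by lia.
by rewrite leq_pmul2l; lia.
Qed.

Lemma good_nabla I (U : {set G}) : good I U -> exists B, nabla U = (2 * d * B)%N.
Proof.
move=> gU; have d0 : (0 < d)%N by have := d_ge100 l_big; lia.
exists #|inflow U ((Ordinal d0, true) : dir G)|.
rewrite nabla_inflow -(card_torus_dir d L4 oL) -sum_nat_const.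
by apply: eq_bigr => j _; apply: inflow_const; exact: good_odd gU.
Qed.

Lemma nabla_volume (U : {set G}) B : nabla U = (2 * d * B)%N -> (B < (L ^ d).+1)%N.
Proof.
move=> eU; have d0 : (0 < 2 * d)%N by rewrite muln_gt0 /=; apply: leq_trans (d_ge100 l_big).
rewrite ltnS; apply: leq_trans (_ : #|U| <= _)%N; last by rewrite -(card_torus d L4 oL) max_card.
have : (nabla U <= \sum_(x in U) 2 * d)%N.
  by rewrite /nabla; apply: leq_sum => x _; rewrite -(card_torus_dir d L4 oL) ndeg_le.
by rewrite eU sum_nat_const mulnC leq_pmul2r.
Qed.

Lemma interior_tilt I r : stable I -> all_cut I -> r \in roots I -> exists B,
  [/\ nabla (interior I r) = (2 * d * B)%N, (d <= 13 * B)%N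
    & expR (tilt * vol I r) - 1 <= tilt * expR (k * B%:R / 2)].
Proof.
move=> sI aC rR; have [U [gU nU D1 D2]] := interior_good sI aC rR.
have [_ s2] := interiorP sI aC rR; have [B eB] := good_nabla gU; rewrite nU in eB.
have d100 := d_ge100 l_big; rewrite (card_torus_dir d L4 oL) in D1 D2.
have := @isoperimetry_nabla L d L4 oL (interior I r) => /(_ _ _)/(local_nat d100 eB) dB.
have {}dB : (d <= 13 * B)%N by apply: dB; [apply: leq_trans D1|apply: leq_trans D2]; lia.
have eN := nabla_edges (interior I r); rewrite eB in eN.
rewrite (card_torus d L4 oL) in s2.
exists B; split=> //; apply: tilt_bound => //.
  have d2 : (1 < d)%N by lia.
  have := isoperimetry_small L4 oL d2 s2.
  by rewrite (_ : #|edges _| = d * B)%N //; lia.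
have := isoperimetry_cheeger L4 oL (interior I r).
have := cardsC (interior I r); rewrite (card_torus d L4 oL) => e1 h.
apply: (volume_nat _ e1 s2 h (esym eN)); by rewrite expn_gt0 (leq_trans _ L4).
Qed.

Lemma outer_tilt I b rho : stable I -> all_cut I -> rho \subset outer I b -> exists B,
  [/\ I \in contour_event rho B, (#|rho| * d <= 13 * B)%N, (B < (L ^ d).+1)%N
    & \prod_(r in rho) (expR (tilt * vol I r) - 1) <= tilt ^+ #|rho| * expR (k * B%:R / 2)].
Proof.
move=> sI aC sO; have [U [gU rU nU]] := outer_good (@torus_connected L d L4 oL) sI aC sO.
have /choice[Bf hB] : forall r, exists B, r \in roots I ->
  [/\ nabla (interior I r) = (2 * d * B)%N, (d <= 13 * B)%N
    & expR (tilt * vol I r) - 1 <= tilt * expR (k * B%:R / 2)].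
  move=> r; have [rR|_] := boolP (r \in roots I); last by exists 0%N.
  by have [B h] := interior_tilt sI aC rR; exists B.
have rR r : r \in rho -> r \in roots I.
  by move=> /(subsetP sO); rewrite inE => /andP[/(subsetP (outermost_roots I))].
pose B := (\sum_(r in rho) Bf r)%N.
have eU : nabla U = (2 * d * B)%N.
  by rewrite nU big_distrr /=; apply: eq_bigr => r /rR/hB[].
exists B; split.
- rewrite inE sI; apply/asboolP; exists U; split=> //.
  by rewrite (card_torus_dir d L4 oL).
- rewrite big_distrr -sum_nat_const /=; apply: leq_sum => r /rR/hB[_ h _]; exact: h.
- exact: nabla_volume eU.
rewrite natr_sum mulr_sumr mulr_suml expR_sum -prodr_const -big_split /=.
apply: ler_prod => r /rR/hB[_ _ h]; rewrite h andbT subr_ge0 -{1}expR0 ler_expR.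
by rewrite mulr_ge0 // (ltW tilt_gt0).
Qed.

Variable lambda : R.
Hypothesis lambda0 : 0 < lambda.
Hypothesis lambda_big : 4 * 10 ^+ 6 * (l * k) <= lambda ^+ 2.
Local Notation w := (weight lambda).
Local Notation Z := (partition_fun G lambda).

Lemma Z_ge0 : 0 <= Z.
Proof. by apply: sumr_ge0 => I _; exact: weight_ge0. Qed.

Lemma torus_bound rho B : (d <= 13 * B)%N -> (#|rho| * d <= 13 * B)%N ->
  \sum_(I in contour_event rho B) w I <= 2 ^+ #|rho| * expR (- (k * B%:R)) * Z.
Proof.
apply: main_bound => //; first exact: card_torus_dir.
exact: isoperimetry_nabla.
Qed.

Lemma tail_sum (m M : nat) :
  \sum_(B < M | (m <= 13 * B)%N) expR (- (k * B%:R / 2)) <= 8 / k * expR (- (k * m%:R / 52)).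
Proof.
have k0 := kappa_gt0 l_big; have k1 := kappa_le1 l_big.
apply: (@le_trans _ _ (\sum_(B < M) expR (- (k / 4 * B%:R)) * expR (- (k * m%:R / 52)))); last first.
  rewrite -mulr_suml ler_pM2r ?expR_gt0 //; apply: le_trans (geometric_sum_le _ _) _; first by lra.
  by rewrite (_ : 2 / (k / 4) = 8 / k) //; field; lra.
rewrite big_mkcond; apply: ler_sum => B _; case: ifP => h; last by rewrite mulr_ge0 ?expR_ge0.
have hm : m%:R <= 13 * B%:R :> R by rewrite -natrM ler_nat.
have : k * m%:R <= k * (13 * B%:R) by rewrite ler_pM2l.
rewrite -expRD ler_expR; lra.
Qed.

(** The contours in [rho] jointly bound one good region, whose [B] is the sum of theirs. The contour
    bound gains [exp (- k * B)], half of which pays for the product; summing over [B] with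
    [#|rho| * d <= 13 * B] leaves one [fugacity] per contour. *)
Lemma outer_sum b rho :
  \sum_(I | [&& stable I, `[< all_cut I >] & rho \subset outer I b])
     w I * \prod_(r in rho) (expR (tilt * vol I r) - 1) <= (tilt * fugacity) ^+ #|rho| * Z.
Proof.
have k0 := kappa_gt0 l_big; have k1 := kappa_le1 l_big; have t0 := tilt_gt0.
have w0 I : 0 <= w I by exact: weight_ge0.
have [->|rho0] := eqVneq rho set0.
  rewrite cards0 expr0 mul1r /partition_fun big_mkcond [X in _ <= X]big_mkcond; apply: ler_sum => I _.
  by rewrite big_set0 mulr1; case: (stable I) => //=; case: (_ && _).
have kr : (0 < #|rho|)%N by rewrite card_gt0.
have dB B : (#|rho| * d <= 13 * B)%N -> (d <= 13 * B)%N by apply: leq_trans; rewrite leq_pmull.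
pose g (I : {set G}) (B : nat) := w I * (tilt ^+ #|rho| * expR (k * B%:R / 2)).
have g0 I B : 0 <= g I B by rewrite !mulr_ge0 ?expR_ge0 ?exprn_ge0 // ltW.
apply: (@le_trans _ _ (\sum_(I : {set G}) \sum_(B < (L ^ d).+1 | (#|rho| * d <= 13 * B)%N)
    if I \in contour_event rho B then g I B else 0)).
  rewrite big_mkcond; apply: ler_sum => I _; case: ifP => [/and3P[sI /asboolP aC sO]|_]; last first.
    by apply: sumr_ge0 => B _; case: ifP.
  have [B [h1 h2 h3 h4]] := outer_tilt sI aC sO.
  rewrite (bigD1 (Ordinal h3)) //= h1.
  apply: (@le_trans _ _ (g I B)); first by rewrite ler_wpM2l.
  by rewrite lerDl sumr_ge0 // => B' _; case: ifP.
rewrite exchange_big /=.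
apply: (@le_trans _ _ (\sum_(B < (L ^ d).+1 | (#|rho| * d <= 13 * B)%N)
    ((2 * tilt) ^+ #|rho| * Z) * expR (- (k * B%:R / 2)))).
  apply: ler_sum => B hB; rewrite -big_mkcond /= -mulr_suml.
  apply: le_trans (ler_wpM2r _ (torus_bound (dB _ hB) hB)) _.
    by rewrite mulr_ge0 ?expR_ge0 ?exprn_ge0 // ltW.
  have e : expR (- (k * B%:R)) * expR (k * B%:R / 2) = expR (- (k * B%:R / 2)).
    by rewrite -expRD; congr expR; field.
  have m5 (u v c f z : R) : c * u * z * (f * v) = c * f * z * (u * v) by ring.
  by rewrite -e [(2 * tilt) ^+ _]exprMn m5.
rewrite -mulr_sumr; apply: le_trans (ler_wpM2l _ (tail_sum _ _)) _.
  by rewrite mulr_ge0 ?Z_ge0 // exprn_ge0 //; lra.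
rewrite mulrAC; apply: ler_wpM2r; first exact: Z_ge0.
have -> : tilt * fugacity = 2 * tilt * (8 / k * expR (- (k * dR / 52))) by rewrite /fugacity; field; lra.
rewrite [X in _ <= X]exprMn; apply: ler_wpM2l; first by rewrite exprn_ge0 //; lra.
rewrite exprMn. rewrite -expRM_natr natrM; apply: ler_pM; rewrite ?expR_ge0 ?divr_ge0 ?(ltW k0) //.
  have h8 : 1 <= 8 / k by rewrite ler_pdivlMr //; lra.
  by rewrite -[X in X <= _]expr1 ler_weXn2l.
by rewrite (_ : - (k * (#|rho|%:R * dR) / 52) = - (k * dR / 52) * #|rho|%:R) //; ring.
Qed.

Definition outer_vol I b := \sum_(r in outer I b) vol I r.

(* Expanding the product over outermost contours of 1 + (e^(t vol) - 1) leaves a sum over sets of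
   roots, to which the contour bound applies. *)
Lemma chernoff b : \sum_(I | stable I && `[< all_cut I >]) w I * expR (tilt * outer_vol I b)
  <= expR (tilt * fugacity * LR ^+ d) * Z.
Proof.
apply: (@le_trans _ _ (\sum_(rho : {set G}) (tilt * fugacity) ^+ #|rho| * Z)); last first.
  rewrite -mulr_suml; apply: ler_wpM2r; first exact: Z_ge0.
  have f0 : 0 <= tilt * fugacity by rewrite mulr_ge0 ?fugacity_ge0 // (ltW tilt_gt0).
  apply: (@le_trans _ _ (\prod_(r in [set: G]) (1 + tilt * fugacity))).
    rewrite prod_1D_sub [X in _ <= X]big_mkcond; apply: ler_sum => rho _.
    by rewrite subsetT prodr_const.
  rewrite prodr_const cardsT (card_torus d L4 oL) -natrX.
  by rewrite expRM_natr lerXn2r ?nnegrE ?expR_ge0 ?expR_ge1Dx //; lra.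
apply: (@le_trans _ _ (\sum_(I | stable I && `[< all_cut I >])
   \sum_(rho : {set G} | rho \subset outer I b) w I * \prod_(r in rho) (expR (tilt * vol I r) - 1))).
  apply: ler_sum => I _; rewrite -mulr_sumr -prod_1D_sub /outer_vol mulr_sumr expR_sum.
  rewrite (eq_bigr (fun r => 1 + (expR (tilt * vol I r) - 1))) // => r _.
  by rewrite addrC subrK.
rewrite (exchange_big_dep predT) //=; apply: ler_sum => rho _.
apply: le_trans (outer_sum b rho).
by rewrite le_eqVlt; apply/orP; left; apply/eqP; apply: eq_bigl => I; rewrite andbA.
Qed.

Lemma outer_tail b (a : R) :
  \sum_(I | [&& stable I, `[< all_cut I >] & a <= outer_vol I b]) w I
    <= expR (tilt * (fugacity * LR ^+ d - a)) * Z.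
Proof.
have t0 := tilt_gt0.
apply: (@le_trans _ _ (expR (- (tilt * a)) *
   \sum_(I | stable I && `[< all_cut I >]) w I * expR (tilt * outer_vol I b))); last first.
  apply: le_trans (ler_wpM2l (expR_ge0 _) (chernoff b)) _.
  by rewrite mulrA -expRD; apply: ler_wpM2r; [exact: Z_ge0|rewrite ler_expR; lra].
rewrite mulr_sumr big_mkcond [X in _ <= X]big_mkcond; apply: ler_sum => I _.
have w0 : 0 <= w I by exact: weight_ge0.
rewrite andbA; case: (stable I && _) => //=; case: ifP => h; last first.
  by rewrite !mulr_ge0 ?expR_ge0.
rewrite mulrCA -expRD -[X in X <= _]mulr1 ler_wpM2l // -expR0 ler_expR.
by rewrite addrC subr_ge0 ler_pM2l.
Qed.

End Chernoff.

(** * Independent sets with few points in a class *)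

Section Entropy.
Variable R : realType.
Local Open Scope ring_scope.

Lemma ln2_ge_half : 2^-1 <= ln 2 :> R.
Proof.
rewrite -ler_expR lnK ?posrE // -[X in X <= _]invrK -expRN.
rewrite -[X in _ <= X]invrK lef_pV2 ?posrE ?invr_gt0 ?expR_gt0 //.
by apply: le_trans (expR_ge1Dx _); lra.
Qed.

Lemma entropyE (a : R) : entropy a * ln 2 = - (a * ln a) - (1 - a) * ln (1 - a).
Proof.
have h := ln2_ge_half; rewrite /entropy /log2; field; lra.
Qed.

Lemma sum_small_subsets (T : finType) (S : {set T}) (lam theta : R) :
  0 < lam -> 0 < theta -> theta <= lam / (1 + lam) ->
  \sum_(A : {set T} | (A \subset S) && (#|A|%:R <= theta * #|S|%:R)) lam ^+ #|A|
    <= expR (#|S|%:R * (entropy theta * ln 2 + theta * ln lam)).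
Proof.
move=> l0 t0 tl; have t1 : theta < 1.
  by apply: le_lt_trans tl _; rewrite ltr_pdivrMr; lra.
have h1 : 0 < 1 - theta by lra.
(* The tilt for which a point is chosen with probability [theta]: [1 + lam * z] is the inverse of
   [1 - theta]. The bound on [theta] amounts to [z <= 1], the sign needed for Markov's
   inequality. *)
pose z := theta / (lam * (1 - theta)).
have z0 : 0 < z by rewrite divr_gt0 // mulr_gt0.
have z1 : ln z <= 0.
  rewrite ln_le0 // ler_pdivrMr ?mulr_gt0 // mul1r.
  by move: tl; rewrite ler_pdivlMr; lra.
have ez : ln z = ln theta - (ln lam + ln (1 - theta)).
  by rewrite ln_div ?posrE ?mulr_gt0 // lnM ?posrE.
apply: (@le_trans _ _ (\sum_(A : {set T} | A \subset S)
    expR (- (theta * #|S|%:R * ln z)) * (lam * z) ^+ #|A|)).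
  rewrite big_mkcond [X in _ <= X]big_mkcond; apply: ler_sum => A _.
  case: (A \subset S) => //=; case: ifP => h; last first.
    by rewrite mulr_ge0 ?expR_ge0 // exprn_ge0 // mulr_ge0 // ltW.
  rewrite exprMn mulrCA -[X in X <= _]mulr1 ler_pM2l ?exprn_gt0 //.
  have -> : z ^+ #|A| = expR (#|A|%:R * ln z) by rewrite expRM_natl lnK ?posrE.
  rewrite -expRD -[X in X <= _]expR0 ler_expR.
  have -> : - (theta * #|S|%:R * ln z) + #|A|%:R * ln z = (theta * #|S|%:R - #|A|%:R) * - ln z by ring.
  by rewrite mulr_ge0 // ?subr_ge0 // oppr_ge0.
rewrite -mulr_sumr; under eq_bigr do rewrite -prodr_const.
rewrite -prod_1D_sub prodr_const.
have -> : 1 + lam * z = (1 - theta)^-1 by rewrite /z; field; lra.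
have -> : (1 - theta)^-1 ^+ #|S| = expR (#|S|%:R * - ln (1 - theta)).
  by rewrite -lnV ?posrE // expRM_natl lnK ?posrE ?invr_gt0.
rewrite -expRD ler_expR entropyE ez; lra.
Qed.

Lemma sum_split_sets (T : finType) (E : {set T}) (P Q : pred {set T}) (lam : R) : 0 <= lam ->
  \sum_(I : {set T} | P (I :&: E) && Q (I :&: ~: E)) lam ^+ #|I| <=
  (\sum_(A : {set T} | (A \subset E) && P A) lam ^+ #|A|) *
  (\sum_(B : {set T} | (B \subset ~: E) && Q B) lam ^+ #|B|).
Proof.
move=> l0; rewrite big_distrlr /= pair_big /=.
rewrite (reindex_onto (fun p : {set T} * {set T} => p.1 :|: p.2) (fun I => (I :&: E, I :&: ~: E))) /=; last first.
  by move=> I _; rewrite -setIUr setUCr setIT.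
rewrite big_mkcond [X in _ <= X]big_mkcond; apply: ler_sum => -[A B] _ /=.
case: ifP => [/andP[/andP[PA QB] /eqP[eA eB]]|_]; last by case: ifP => // _; rewrite mulr_ge0 ?exprn_ge0.
rewrite eA in PA; rewrite eB in QB; rewrite PA QB.
have sA : A \subset E by rewrite -eA subsetIr.
have sB : B \subset ~: E by rewrite -eB subsetIr.
rewrite sA sB /=.
have d : A :&: B = set0.
  apply/eqP; rewrite setI_eq0 disjoints_subset; apply: subset_trans sA _.
  by rewrite -setCS setCK in sB.
by rewrite cardsU d cards0 subn0 exprD.
Qed.

End Entropy.

Section Balanced.
Variables L d : nat.
Hypotheses (L4 : (4 <= L)%N) (oL : ~~ odd L) (d0 : (0 < d)%N).
Local Notation G := (@torus_graph L d L4 oL).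
Implicit Type I : {set G}.

Definition evens : {set G} := [set x | ~~ par x].

Lemma evens_class : evens = even_class L d. Proof. by []. Qed.

Lemma evensC : ~: evens = odd_class L d.
Proof. by apply/setP => x; rewrite !inE negbK. Qed.

Lemma card_evensC : #|~: evens| = #|evens|.
Proof.
pose j : dir G := (Ordinal d0, true).
rewrite -(card_imset _ (@stp_injr G j)); apply: eq_card => x; apply/imsetP/idP => [[y]|xE].
  by rewrite !in_set negbK => py ->; rewrite par_stp py.
exists (stp (opp j) x); last by rewrite stpVK.
by rewrite !in_set negbK par_stp; rewrite in_set in xE.
Qed.

Lemma card_evens : 2 * #|evens| = L ^ d.
Proof.
have := cardsC evens; rewrite card_evensC -(card_torus d L4 oL); lia.
Qed.

Lemma stable_evens I : I \subset evens -> stable I.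
Proof.
move=> /subsetP h; apply/stableP => x j /h; rewrite in_set => px; apply/negP => /h.
by rewrite in_set par_stp px.
Qed.

Local Open Scope ring_scope.
Variables (R : realType) (lambda rho beta y : R).
Hypotheses (lambda0 : 0 < lambda) (rho0 : 0 <= rho) (beta0 : 0 < beta).
Hypothesis small : rho + beta <= lambda / (1 + lambda).
Local Notation N := (#|evens|%:R : R).
Hypothesis entropy_small :
  N * ((entropy beta + entropy (rho + beta) + (2 * beta + rho) * log2 lambda) * ln 2) + y
    <= N * (log2 (1 + lambda) * ln 2).
Local Notation w := (weight lambda).
Local Notation Z := (partition_fun G lambda).

Lemma partition_ge : (1 + lambda) ^+ #|evens| <= Z.
Proof.
rewrite -prodr_const prod_1D_sub big_mkcond [X in _ <= X]big_mkcond; apply: ler_sum => I _.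
case: ifP => [/stable_evens ->|_]; first by rewrite prodr_const.
by case: ifP => // _; exact: weight_ge0.
Qed.

(** Stability is dropped, so the sum factors over the two classes, and [Z] is bounded below by the
    sets of even points alone. *)
Lemma sum_few (E : {set G}) : #|E| = #|evens| -> #|~: E| = #|evens| ->
  \sum_(I | (#|I :&: E|%:R <= beta * N) && (#|I :&: ~: E|%:R <= (rho + beta) * N)) w I
    <= expR (- y) * Z.
Proof.
move=> cE cC; rewrite /weight.
apply: le_trans (sum_split_sets E (fun A => #|A|%:R <= beta * N) (fun B => #|B|%:R <= (rho + beta) * N) (ltW lambda0)) _.
have h1 := @sum_small_subsets R G E lambda beta lambda0 beta0.
have h2 := @sum_small_subsets R G (~: E) lambda (rho + beta) lambda0.
rewrite cE in h1; rewrite cC in h2.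
apply: (@le_trans _ _ (expR (N * (entropy beta * ln 2 + beta * ln lambda)) *
   expR (N * (entropy (rho + beta) * ln 2 + (rho + beta) * ln lambda)))).
  have l0 := ltW lambda0; have b1 : 0 < rho + beta by move: rho0 beta0; lra.
  apply: ler_pM; last exact: h2.
  - by apply: sumr_ge0 => A _; rewrite exprn_ge0.
  - by apply: sumr_ge0 => A _; rewrite exprn_ge0.
  by apply: h1; apply: le_trans small; move: rho0; lra.
apply: (@le_trans _ _ (expR (- y) * (1 + lambda) ^+ #|evens|)); last first.
  by rewrite ler_pM2l ?expR_gt0 // partition_ge.
have l1 : 0 < 1 + lambda by rewrite addr_gt0.
have -> : (1 + lambda) ^+ #|evens| = expR (N * ln (1 + lambda)) by rewrite expRM_natl lnK ?posrE.
rewrite -!expRD ler_expR.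
have ll := ln2_ge_half R; clear h1 h2 cE cC E.
have e (u : R) : log2 u * ln 2 = ln u.
  by rewrite /log2 divfK // lt0r_neq0 //; apply: lt_le_trans ll; rewrite invr_gt0.
have := entropy_small; rewrite e.
have -> : (entropy beta + entropy (rho + beta) + (2 * beta + rho) * log2 lambda) * ln 2 =
    entropy beta * ln 2 + entropy (rho + beta) * ln 2 + (2 * beta + rho) * ln lambda.
  by rewrite -[ln lambda]e; ring.
lra.
Qed.

End Balanced.

(** * Conclusion *)

Section Rates.
Variable R : realType.
Local Open Scope ring_scope.

Lemma expR1_le4 : expR 1 <= 4 :> R.
Proof.
have h : expR (2^-1) <= 2 :> R by rewrite -ler_ln ?posrE ?expR_gt0 // expRK ln2_ge_half.
have -> : 1 = 2^-1 + 2^-1 :> R by field.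
have := expR_gt0 (2^-1 : R); rewrite expRD; nra.
Qed.

Lemma sum_nonempty_le (T : finType) (x : R) : 0 <= x -> x * #|T|%:R <= 1 ->
  \sum_(A : {set T} | A != set0) x ^+ #|A| <= 4 * (x * #|T|%:R).
Proof.
move=> x0 x1; have h : \sum_(A : {set T}) x ^+ #|A| = (1 + x) ^+ #|T|.
  rewrite -cardsT -prodr_const prod_1D_sub [RHS]big_mkcond; apply: eq_bigr => A _.
  by rewrite subsetT prodr_const.
rewrite (bigD1 set0) //= cards0 expr0 in h.
have h2 : (1 + x) ^+ #|T| <= expR (x * #|T|%:R).
  by rewrite expRM_natr lerXn2r ?nnegrE ?expR_ge0 ?expR_ge1Dx // addr_ge0.
have h3 := expR_sub1_le (x * #|T|%:R).
have h4 : expR (x * #|T|%:R) <= 4 by apply: le_trans expR1_le4; rewrite ler_expR.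
have h5 : x * #|T|%:R * expR (x * #|T|%:R) <= x * #|T|%:R * 4.
  by rewrite ler_wpM2l // mulr_ge0.
lra.
Qed.

Variables (L d : nat).
Hypothesis L4 : (4 <= L)%N.
Local Notation dR := (d%:R : R).
Local Notation LR := (L%:R : R).
Local Notation l := (ln dR).
Local Notation k := (kappa R d).
Hypothesis l_big : 10 ^+ 5 <= l.
Local Notation Y := (LR ^+ (d - 1)).

Lemma L_ge4 : 4 <= LR. Proof. by rewrite ler_nat. Qed.

Lemma d_ge16 : 10 ^+ 14 <= dR.
Proof.
apply: le_trans (d_ge_l3 l_big); rewrite -[X in X <= _]mulr1 ler_pM2l ?exprn_gt0 //.
by rewrite exprn_ege1 // l_ge1.
Qed.

Lemma surface_big : 10 ^+ 3 * dR ^+ 5 * LR ^+ 2 <= Y.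
Proof.
have d100 := d_ge100 l_big; have L1 := L_ge4; have dd := d_ge16.
have -> : (d - 1 = d - 3 + 2)%N by lia.
rewrite exprD; apply: ler_wpM2r; first exact: sqr_ge0.
have h : expR (dR / 2) <= LR ^+ (d - 3).
  apply: (@le_trans _ _ (expR 1 ^+ (d - 3))); last first.
    by rewrite lerXn2r ?nnegrE ?expR_ge0 //; apply: le_trans expR1_le4 _; lra.
  rewrite -expRM_natl mulr1 ler_expR natrB; last by lia.
  lra.
apply: le_trans h; apply: (@le_trans _ _ ((dR / 2 / 8) ^+ 8)); last by apply: (expR_ge_pow 7); lra.
have -> : (dR / 2 / 8) ^+ 8 = dR ^+ 5 * (dR ^+ 3 / 16 ^+ 8) by field.
rewrite mulrC; apply: ler_wpM2l; first by rewrite exprn_ge0 //; lra.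
rewrite ler_pdivlMr ?exprn_gt0 //; apply: (@le_trans _ _ ((10 ^+ 14) ^+ 3)); first by lra.
by rewrite lerXn2r ?nnegrE ?exprn_ge0 //; lra.
Qed.

Lemma lnL_itv : 1 <= ln LR <= LR.
Proof.
have L1 := L_ge4; apply/andP; split.
  rewrite -[X in X <= _]expRK ler_ln ?posrE ?expR_gt0 //; last by lra.
  exact: le_trans expR1_le4 L1.
rewrite -ler_expR lnK ?posrE; last by lra.
by apply: le_trans (expR_ge1Dx _); lra.
Qed.

Definition rate : R := Y / (dR ^+ 4 * ln LR ^+ 2).

Lemma rate_ge : 8 <= rate.
Proof.
have /andP[h1 h2] := lnL_itv; have h := surface_big; have d1 := d_ge1 l_big.
have h3 : ln LR ^+ 2 <= LR ^+ 2 by rewrite lerXn2r ?nnegrE //; lra.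
rewrite ler_pdivlMr; last by rewrite mulr_gt0 ?exprn_gt0 //; lra.
have h4 : 8 * dR ^+ 4 <= 10 ^+ 3 * dR ^+ 5.
  rewrite (_ : 10 ^+ 3 * dR ^+ 5 = 10 ^+ 3 * dR * dR ^+ 4); last by ring.
  rewrite ler_pM2r; last by rewrite exprn_gt0 //; lra.
  lra.
apply: le_trans h; rewrite mulrA; apply: ler_pM => //; rewrite ?mulr_ge0 ?exprn_ge0 //; lra.
Qed.

Lemma rate_le : rate <= Y / dR ^+ 4.
Proof.
have /andP[h1 h2] := lnL_itv; have d1 := d_ge1 l_big; have L1 := L_ge4.
rewrite /rate ler_pM2l; last by rewrite exprn_gt0 //; lra.
rewrite lef_pV2 ?posrE ?mulr_gt0 ?exprn_gt0 //; try lra.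
by rewrite ler_peMr ?exprn_ge0 ?exprn_ege1 //; lra.
Qed.

Lemma rate_surface : 3 * rate <= Y / (128 * dR ^+ 2).
Proof.
have h := rate_le; have d1 := d_ge1 l_big; have L1 := L_ge4; have dd := d_ge16.
apply: (@le_trans _ _ (3 * (Y / dR ^+ 4))); first by rewrite ler_pM2l.
rewrite mulrCA ler_pM2l; last by rewrite exprn_gt0 //; lra.
rewrite ler_pdivrMr; last by rewrite exprn_gt0 //; lra.
have -> : (128 * dR ^+ 2)^-1 * dR ^+ 4 = dR ^+ 2 / 128 by field; lra.
have : 384 * 1 <= dR * dR by apply: ler_pM; lra.
rewrite expr2; lra.
Qed.

Lemma LdE : LR ^+ d = LR * Y.
Proof. by rewrite -exprS; congr (_ ^+ _); have := d_ge100 l_big; lia. Qed.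

(** The weight of one wrapping contour: it brings at least [Y / (2 * d)] to [B], half of the gain
    [k * B] is kept for summing over [B], and 2 comes from [2 ^+ #|rho|]. The [L ^ d] possible roots
    do not matter beside it. *)
Let x : R := 2 * expR (- (k * (Y / (4 * dR)))).

Lemma wrap_small : x * LR ^+ d <= 1 /\ 4 / k * (4 * (x * LR ^+ d)) <= expR (- (3 * rate)).
Proof.
have k0 := kappa_gt0 l_big; have d1 := d_ge1 l_big; have L1 := L_ge4; have dd := d_ge16.
have kd := kappa_ge_inv l_big; have sb := surface_big; have rs := rate_surface; have rg := rate_ge.
have Y0 : 0 < Y by rewrite exprn_gt0 //; lra.
set u := k * (Y / (4 * dR)).
have hu : Y / (4 * dR ^+ 2) <= u.
  rewrite /u (_ : Y / (4 * dR ^+ 2) = dR^-1 * (Y / (4 * dR))); last by field; lra.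
  by rewrite ler_wpM2r // divr_ge0 //; lra.
have h1 : Y / (8 * dR ^+ 2) + 3 * rate <= u.
  apply: le_trans hu; have : 0 <= Y / dR ^+ 2 by rewrite divr_ge0 ?exprn_ge0 //; lra.
  move: rs; rewrite !invfM ![Y * (_ * _)]mulrCA; lra.
have h2 : 125 * dR ^+ 3 * LR ^+ 2 <= Y / (8 * dR ^+ 2).
  rewrite ler_pdivlMr; last by rewrite mulr_gt0 ?exprn_gt0 //; lra.
  rewrite (_ : 125 * dR ^+ 3 * LR ^+ 2 * (8 * dR ^+ 2) = 10 ^+ 3 * dR ^+ 5 * LR ^+ 2) //; ring.
have h3 : 32 * dR * LR ^+ d <= expR (32 * dR + dR * LR).
  rewrite expRD; apply: ler_pM; rewrite ?mulr_ge0 ?exprn_ge0 //; try lra.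
    by apply: le_trans (expR_ge1Dx _); lra.
  by rewrite expRM_natl lerXn2r ?nnegrE ?expR_ge0 //; apply: le_trans (expR_ge1Dx _); lra.
have h4 : 32 * dR + dR * LR <= 125 * dR ^+ 3 * LR ^+ 2.
  have e1 : 1 <= dR ^+ 2 * LR by rewrite mulr_ege1 ?exprn_ege1 //; lra.
  have e2 : 32 + LR <= 125 * LR by lra.
  rewrite (_ : 32 * dR + dR * LR = dR * (32 + LR)); last by ring.
  rewrite (_ : 125 * dR ^+ 3 * LR ^+ 2 = dR * (125 * LR * (dR ^+ 2 * LR))); last by ring.
  rewrite ler_pM2l; last by lra.
  by apply: le_trans e2 _; rewrite ler_peMr //; lra.
have h5 : 32 * dR * LR ^+ d <= expR (u - 3 * rate) by apply: le_trans h3 _; rewrite ler_expR; lra.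
have Ld0 : 0 < LR ^+ d by rewrite exprn_gt0 //; lra.
have h6 : expR (- u) * (32 * dR * LR ^+ d) <= expR (- (3 * rate)).
  apply: (@le_trans _ _ (expR (- u) * expR (u - 3 * rate))); first by rewrite ler_pM2l ?expR_gt0.
  by rewrite -expRD ler_expR; lra.
have h7 : 4 / k * (4 * (x * LR ^+ d)) <= expR (- (3 * rate)).
  apply: le_trans h6; rewrite /x -/u.
  rewrite (_ : 4 / k * (4 * (2 * expR (- u) * LR ^+ d)) = expR (- u) * (32 * k^-1 * LR ^+ d)); last by ring.
  rewrite ler_pM2l ?expR_gt0 // ler_pM2r // ler_pM2l // invf_ple ?posrE //; lra.
split=> //; have e3 : expR (- (3 * rate)) <= 1 by rewrite -[X in _ <= X]expR0 ler_expR; lra.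
have kk := kappa_le1 l_big.
have k4 : 1 <= 4 / k by rewrite ler_pdivlMr //; lra.
have x0 : 0 <= x * LR ^+ d by rewrite mulr_ge0 ?(ltW Ld0) // mulr_ge0 ?expR_ge0.
have : 1 * (4 * (x * LR ^+ d)) <= 4 / k * (4 * (x * LR ^+ d)) by rewrite ler_wpM2r //; lra.
lra.
Qed.
End Rates.

Section Assembly.
Variable R : realType.
Local Open Scope ring_scope.
Variables (L d : nat).
Hypotheses (L4 : (4 <= L)%N) (oL : ~~ odd L).
Local Notation dR := (d%:R : R).
Local Notation LR := (L%:R : R).
Local Notation l := (ln dR).
Local Notation k := (kappa R d).
Hypothesis l_big : 10 ^+ 5 <= l.
Local Notation Y := (LR ^+ (d - 1)).
Local Notation G := (@torus_graph L d L4 oL).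
Implicit Types (I rho : {set G}) (r : G).
Variable lambda : R.
Hypothesis lambda0 : 0 < lambda.
Hypothesis lambda_big : 4 * 10 ^+ 6 * (l * k) <= lambda ^+ 2.
Local Notation w := (weight lambda).
Local Notation Z := (partition_fun G lambda).
Local Notation y := (rate R L d).

Lemma wrap_nat (m B : nat) : (0 < m -> L ^ d * m <= L * (2 * d * B) ->
  (L ^ (d - 1) * m <= 2 * d * B) /\ (d <= 13 * B /\ m * d <= 13 * B))%N.
Proof.
have d100 := d_ge100 l_big; have Ld : (L ^ d = L * L ^ (d - 1))%N by rewrite -expnS; congr expn; lia.
have big : (2 * d * d <= L ^ (d - 1))%N.
  rewrite -(ler_nat R) !natrM natrX; apply: le_trans (surface_big L4 l_big).
  have d1 := d_ge1 l_big; have L1 := L_ge4 R L4.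
  rewrite (_ : 10 ^+ 3 * dR ^+ 5 * LR ^+ 2 = dR * dR * (10 ^+ 3 * (dR ^+ 3 * LR ^+ 2))); last by ring.
  rewrite (_ : 2%:R * dR * dR = dR * dR * 2%:R); last by ring.
  rewrite ler_pM2l; last by rewrite mulr_gt0 //; lra.
  have : 1 <= dR ^+ 3 * LR ^+ 2 by rewrite mulr_ege1 ?exprn_ege1 //; lra.
  lra.
move=> m0; rewrite Ld -mulnA leq_pmul2l; last by lia.
move=> h; split=> //; have h1 : (m * (2 * d * d) <= 2 * d * B)%N.
  by apply: leq_trans h; rewrite mulnC leq_mul2r big orbT.
have {h1} : (m * d <= B)%N.
  by rewrite -(@leq_pmul2l (2 * d)) 1?mulnCA //; lia.
by move=> h1; nia.
Qed.

Lemma wrap_sum : \sum_(I : {set G} | stable I && ~~ `[< all_cut I >]) w I <= expR (- (3 * y)) * Z.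
Proof.
have k0 := kappa_gt0 l_big; have k1 := kappa_le1 l_big; have d1 := d_ge1 l_big; have L1 := L_ge4 R L4.
have w0 I : 0 <= w I by exact: weight_ge0.
have [x1 x2] := wrap_small L4 l_big; set x := 2 * expR _ in x1 x2.
have x0 : 0 <= x by rewrite mulr_ge0 ?expR_ge0.
have Z0 : 0 <= Z by exact: Z_ge0.
pose P rho (B : nat) := (L ^ d * #|rho| <= L * (2 * d * B))%N.
apply: (@le_trans _ _ (\sum_(rho : {set G} | rho != set0) \sum_(B < (L ^ d).+1 | P rho B)
    \sum_(I in contour_event rho B) w I)).
  apply: (@le_trans _ _ (\sum_(I : {set G}) \sum_(rho : {set G} | rho != set0)
     \sum_(B < (L ^ d).+1 | P rho B) if I \in contour_event rho B then w I else 0)); last first.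
    rewrite exchange_big; apply: ler_sum => rho _; rewrite exchange_big; apply: ler_sum => B _.
    by rewrite -big_mkcond.
  rewrite big_mkcond; apply: ler_sum => I _.
  have s0 rho B : 0 <= if I \in contour_event rho B then w I else 0 by case: ifP.
  case: ifP => [/andP[sI /asboolP nC]|_]; last by apply: sumr_ge0 => rho _; apply: sumr_ge0.
  have [r rR nr] : exists2 r, r \in roots I & ~ exists U, cutby I r U.
    by apply: contrapT => h; apply: nC => r rR; apply: contrapT => nr; apply: h; exists r.
  have [rho [U [gU rU rho0 hU]]] := @wrap_case L d L4 oL I sI (ex_intro2 _ _ r rR nr).
  have [B eB] := good_nabla l_big gU; rewrite eB in hU.
  have hB := nabla_volume l_big eB.
  rewrite (bigD1 rho) /=; last by rewrite -card_gt0.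
  rewrite (bigD1 (Ordinal hB)) //= ifT; last first.
    rewrite inE sI; apply/asboolP; exists U; split=> //.
    by rewrite (card_torus_dir d L4 oL).
  rewrite -addrA lerDl addr_ge0 ?sumr_ge0 // => rho' _; exact: sumr_ge0.
apply: (@le_trans _ _ (\sum_(rho : {set G} | rho != set0) 4 / k * x ^+ #|rho| * Z)).
  apply: ler_sum => rho rho0; have m0 : (0 < #|rho|)%N by rewrite card_gt0.
  apply: (@le_trans _ _ (\sum_(B < (L ^ d).+1) x ^+ #|rho| * Z * expR (- (k / 2 * B%:R)))).
    rewrite [X in _ <= X](bigID (fun B : 'I__ => P rho B)) /= -[X in X <= _]addr0.
    apply: lerD; last by apply: sumr_ge0 => B _; rewrite !mulr_ge0 ?exprn_ge0 ?expR_ge0.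
    apply: ler_sum => B /(wrap_nat m0)[h1 [h2 h3]].
    apply: le_trans (torus_bound l_big lambda0 lambda_big h2 h3) _.
    rewrite [X in _ <= X]mulrAC; apply: ler_wpM2r => //.
    rewrite /x exprMn -mulrA; apply: ler_wpM2l; first by rewrite exprn_ge0.
    rewrite -expRM_natl -expRD ler_expR.
    have h4 : Y * #|rho|%:R <= 2 * dR * B%:R by rewrite -natrX -!natrM ler_nat.
    have h5 : Y / (4 * dR) * #|rho|%:R <= B%:R / 2.
      rewrite (_ : Y / (4 * dR) * #|rho|%:R = Y * #|rho|%:R / (4 * dR)); last by field; lra.
      rewrite ler_pdivrMr; last by lra.
      lra.
    have : k * (Y / (4 * dR) * #|rho|%:R) <= k * (B%:R / 2) by rewrite ler_pM2l.
    lra.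
  rewrite -mulr_sumr (_ : 4 / k * x ^+ #|rho| * Z = x ^+ #|rho| * Z * (4 / k)); last by rewrite -mulrA mulrC.
  apply: ler_wpM2l; first by rewrite mulr_ge0 ?exprn_ge0.
  apply: le_trans (geometric_sum_le _ _) _; first by lra.
  by rewrite (_ : 2 / (k / 2) = 4 / k) //; field; lra.
rewrite -mulr_suml -mulr_sumr; apply: ler_wpM2r => //.
apply: le_trans x2; rewrite ler_pM2l ?divr_gt0 // -natrX -(card_torus d L4 oL).
by apply: sum_nonempty_le => //; rewrite (card_torus d L4 oL) natrX.
Qed.

Variable rho : R.
Hypothesis rho0 : 0 <= rho.
Variable s : R.
Hypotheses (s0 : 0 < s) (s2 : s ^+ 2 = dR).
Hypothesis small : rho + 1 / (2 * s) <= lambda / (1 + lambda).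
Hypothesis entropy_bound : entropy (1 / (2 * s)) + entropy (rho + 1 / (2 * s))
  + (1 / s + rho) * log2 lambda + 10 / (dR ^+ 4 * LR * ln LR ^+ 2) <= log2 (1 + lambda).
Let beta : R := 1 / (2 * s).
Local Notation E := (@evens L d L4 oL).
Local Notation N := (#|E|%:R : R).

Lemma card_evensR : 2 * N = LR ^+ d.
Proof. by rewrite -natrM card_evens ?natrX //; apply: leq_trans (d_ge100 l_big). Qed.

Lemma few_arith (n g u q v z : R) : n * g * (u + q) <= n * g * v -> z <= g * (n * q) ->
  n * (u * g) + z <= n * (v * g).
Proof. lra. Qed.

(** Multiplied by [N = L ^ d / 2], the slack term of the entropy hypothesis is [5 * y]; passing to
    natural logarithms costs the factor [ln 2 >= 1 / 2]. *)
Lemma few_hyp : N * ((entropy beta + entropy (rho + beta) + (2 * beta + rho) * log2 lambda) * ln 2)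
   + 5 / 2 * y <= N * (log2 (1 + lambda) * ln 2).
Proof.
have ll := ln2_ge_half R; have hN := card_evensR; rewrite (LdE L4 l_big) in hN.
have yg := rate_ge L4 l_big; have d1 := d_ge1 l_big; have L1 := L_ge4 R L4.
have /andP[lL _] := lnL_itv R L4.
have N0 : 0 <= N by [].
have e : N * (10 / (dR ^+ 4 * LR * ln LR ^+ 2)) = 5 * y.
  rewrite (_ : N = LR * Y / 2); last by rewrite -hN; field.
  by rewrite /rate; field; rewrite !lt0r_neq0 //; lra.
have eb : 2 * beta = 1 / s by rewrite /beta; field; rewrite lt0r_neq0.
have h : N * ln 2 * (entropy beta + entropy (rho + beta) + (2 * beta + rho) * log2 lambda
    + 10 / (dR ^+ 4 * LR * ln LR ^+ 2)) <= N * ln 2 * log2 (1 + lambda).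
  by rewrite eb; apply: ler_wpM2l => //; rewrite mulr_ge0 //; lra.
have h2 : 5 / 2 * y <= ln 2 * (5 * y).
  have : 0 <= (ln 2 - 2^-1) * y by rewrite mulr_ge0 ?subr_ge0 //; lra.
  lra.
rewrite -e in h2; exact: few_arith h h2.
Qed.

Lemma sum_cover5 (P P1 P2 P3 P4 P5 : pred {set G}) (b1 b2 b3 b4 b5 : R) :
  (forall I, P I -> [|| P1 I, P2 I, P3 I, P4 I | P5 I]) ->
  \sum_(I : {set G} | P1 I) w I <= b1 -> \sum_(I : {set G} | P2 I) w I <= b2 -> \sum_(I : {set G} | P3 I) w I <= b3 ->
  \sum_(I : {set G} | P4 I) w I <= b4 -> \sum_(I : {set G} | P5 I) w I <= b5 ->
  \sum_(I : {set G} | P I) w I <= b1 + b2 + b3 + b4 + b5.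
Proof.
move=> h h1 h2 h3 h4 h5; apply: le_trans (lerD (lerD (lerD (lerD h1 h2) h3) h4) h5).
rewrite big_mkcond (big_mkcond P1) (big_mkcond P2) (big_mkcond P3) (big_mkcond P4) (big_mkcond P5).
rewrite -!big_split /=; apply: ler_sum => I _; have w0 : 0 <= @weight G R lambda I by exact: weight_ge0.
have := h I; case: (P I) => [/(_ isT)|_].
  by case: (P1 I) => /=; case: (P2 I) => /=; case: (P3 I) => /=; case: (P4 I) => /=; case: (P5 I) => //= _; lra.
by rewrite !addr_ge0 //; case: ifP.
Qed.

(** The threshold [beta * N / 2] is [L ^ d / (8 * s)], at least twice the [fugacity] term, so half
    of it survives; [s^-1 <= k] then makes the exponent at least [3 * y]. *)
Lemma outer_case b : \sum_(I : {set G} | [&& stable I, `[< all_cut I >] & beta * N / 2 <= outer_vol R I b]) w I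
  <= expR (- (3 * y)) * Z.
Proof.
apply: le_trans (outer_tail l_big L4 oL lambda0 lambda_big b _) _.
apply: ler_wpM2r; first exact: Z_ge0.
rewrite ler_expR; have yd := rate_surface L4 l_big; have k0 := kappa_gt0 l_big.
have d1 := d_ge1 l_big; have L1 := L_ge4 R L4; have l1 := l_ge1 l_big.
have ds : dR = s * s by rewrite -s2 expr2.
have s1 : 1 <= s.
  by rewrite leNgt; apply/negP => h; move: d1; rewrite ds; move: s0 h; nra.
have sd : s <= dR by rewrite ds; move: s1; nra.
have ks : s^-1 <= k.
  rewrite -[X in X <= _]mul1r ler_pdivrMr // -(@ler_pXn2r _ 2) ?nnegrE //; last by rewrite mulr_ge0 // ltW.
  by rewrite expr1n exprMn s2 (kappa_sqr l_big).
have f := fugacity_le l_big.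
have f2 : (16 * dR)^-1 <= (16 * s)^-1.
  by rewrite lef_pV2 ?posrE; [lra|move: s0; lra|lra].
have Ld0 : 0 < LR ^+ d by rewrite exprn_gt0 //; lra.
have h1 : fugacity R d * LR ^+ d - beta * N / 2 <= - ((16 * s)^-1 * LR ^+ d).
  have -> : beta * N / 2 = 2 * (16 * s)^-1 * LR ^+ d.
    by rewrite -card_evensR /beta; field; rewrite lt0r_neq0.
  have : fugacity R d * LR ^+ d <= (16 * s)^-1 * LR ^+ d by rewrite ler_pM2r //; lra.
  lra.
have t0 := tilt_gt0 l_big L4.
apply: (@le_trans _ _ (tilt R d L * - ((16 * s)^-1 * LR ^+ d))); first by rewrite ler_pM2l.
rewrite mulrN lerN2; apply: le_trans yd _.
have -> : tilt R d L * ((16 * s)^-1 * LR ^+ d) = k * (Y / (128 * s * dR)).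
  rewrite /tilt (LdE L4 l_big); field; rewrite !lt0r_neq0 //; lra.
have -> : Y / (128 * dR ^+ 2) = s^-1 * (Y / (128 * s * dR)).
  rewrite [dR ^+ 2]expr2 {1}ds; field; rewrite !lt0r_neq0 //; lra.
by rewrite ler_wpM2r // divr_ge0 ?exprn_ge0 // !mulr_ge0 // ltW.
Qed.

Lemma balanced_bound :
  \sum_(I : {set G} | stable I && (`| #|I :&: E|%:R - #|I :&: ~: E|%:R | <= rho * N)) w I <= expR (- (2 * y)) * Z.
Proof.
have d0 : (0 < d)%N by have := d_ge100 l_big; lia.
have b0 : 0 < beta by rewrite divr_gt0 // mulr_gt0.
have cE := card_evensC L4 oL d0.
have few := sum_few lambda0 rho0 b0 small few_hyp.
have few1 := few E erefl cE.
have few2 := few (~: E) cE; rewrite setCK in few2; have {}few2 := few2 erefl.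
have Z0 : 0 <= Z by exact: Z_ge0.
apply: le_trans (sum_cover5 _ few1 few2 wrap_sum (outer_case false) (outer_case true)) _; last first.
  (* All five bounds are at most [exp (- 5 / 2 * y)]; the surplus [y / 2] in the exponent absorbs
     the factor 5, since [y >= 8] and [exp 4 >= 1 + 4]. *)
  have y8 := rate_ge L4 l_big; rewrite -!mulrDl; apply: ler_wpM2r => //.
  have e1 : expR (- (3 * y)) <= expR (- (5 / 2 * y)) by rewrite ler_expR; lra.
  have e2 : expR (- (5 / 2 * y)) = expR (- (2 * y)) * (expR (y / 2))^-1.
    by rewrite -expRN -expRD; congr expR; field.
  have e3 : 5 <= expR (y / 2) by apply: le_trans (expR_ge1Dx _); lra.
  have e4 : 5 * expR (- (5 / 2 * y)) <= expR (- (2 * y)).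
    rewrite e2 mulrCA -[X in _ <= X]mulr1 ler_pM2l ?expR_gt0 //.
    by rewrite ler_pdivrMr ?expR_gt0 // mul1r.
  lra.
move=> I /andP[sI]; rewrite ler_norml sI /= => /andP[h1 h2].
have [aC|_] := boolP `[< all_cut I >]; last by rewrite !orbT.
have [f1|f1] := lerP #|I :&: E|%:R (beta * N).
  by rewrite (_ : #|I :&: ~: E|%:R <= (rho + beta) * N) //; lra.
have [f2|f2] := lerP #|I :&: ~: E|%:R (beta * N).
  by rewrite (_ : #|I :&: E|%:R <= (rho + beta) * N) //; lra.
(* Now both classes have more than [beta * N] occupied points, so both phases are that large, and
   the outermost contours of one of the two types enclose half of this volume. *)
have hp1 : (#|I :&: E| <= #|phase I|)%N.
  apply/subset_leq_card/subsetP => x; rewrite inE => /andP[xI xE].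
  by apply: occupied_even => //; rewrite inE in xE.
have hp2 : (#|I :&: ~: E| <= #|~: phase I|)%N.
  apply/subset_leq_card/subsetP => x; rewrite inE => /andP[xI xE]; rewrite in_setC.
  by apply: occupied_odd => //; move: xE; rewrite !inE negbK.
have := outer_volume (@torus_connected L d L4 oL) sI (elimT (asboolP _) aC).
rewrite -(ler_nat R) natrD !natr_sum => hv.
have hm : beta * N <= (minn #|phase I| #|~: phase I|)%:R.
  rewrite /minn; case: ifP => _.
    by apply: le_trans (ltW f1) _; rewrite ler_nat.
  by apply: le_trans (ltW f2) _; rewrite ler_nat.
rewrite /outer_vol /=.
case: (lerP (beta * N / 2) (\sum_(r in outer I false) #|interior I r|%:R)) => v1; first by [].
case: (lerP (beta * N / 2) (\sum_(r in outer I true) #|interior I r|%:R)) => v2; first by [].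
lra.
Qed.

End Assembly.

Local Open Scope ring_scope.

Lemma powR_kappa (R : realType) (d : nat) : 10 ^+ 5 <= ln (d%:R : R) ->
  (d%:R `^ (- (1 / 4)) * ln d%:R `^ (3 / 4)) ^+ 2 = ln (d%:R : R) * kappa R d.
Proof.
move=> l_big; have d0 := d_gt0 l_big; have l1 := l_ge1 l_big; have k0 := kappa_gt0 l_big.
have p4 (a r : R) : (a `^ r) ^+ 4 = a `^ (r * 4) by rewrite powRrM powR_mulrn ?powR_ge0.
apply: (@pexpIrn _ 2) => //; rewrite ?nnegrE ?sqr_ge0 ?mulr_ge0 ?powR_ge0 //; try lra.
rewrite -exprM exprMn !p4 (_ : - (1 / 4) * 4 = -1); last by field.
rewrite (_ : 3 / 4 * 4 = 3); last by field.
rewrite powRN powRr1 ?powR_mulrn; [|lra..].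
rewrite exprMn (_ : kappa R d ^+ 2 = ln d%:R / d%:R).
  by field; lra.
by rewrite -[in RHS](kappa_sqr l_big) mulfK //; lra.
Qed.

Theorem theorem1p5 (R : realType) :
  exists c d0 : R, 0 < c /\ 0 < d0 /\
    forall (d L : nat) (lambda rho : R),
      d0 <= d%:R ->
      (4 <= L)%N -> ~~ odd L ->
      0 < lambda ->
      c * d%:R `^ (- (1 / 4)) * ln d%:R `^ (3 / 4) <= lambda ->
      0 <= rho ->
      rho + 1 / (2 * d%:R `^ (1 / 2)) <= lambda / (1 + lambda) ->
      entropy (1 / (2 * d%:R `^ (1 / 2)))
        + entropy (rho + 1 / (2 * d%:R `^ (1 / 2)))
        + (1 / d%:R `^ (1 / 2) + rho) * log2 lambda
        + 10 / (d%:R ^+ 4 * L%:R * ln L%:R ^+ 2)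
        <= log2 (1 + lambda) ->
      hc_measure (@torus_adj L d) lambda (balanced_indep_sets L d rho)
        <= expR (- (2 * L%:R ^+ (d - 1) / (d%:R ^+ 4 * ln L%:R ^+ 2))).
Proof.
(* [2000 ^ 2 = 4 * 10 ^ 6] is the constant that the contour bound requires for [lambda ^+ 2]; [d0]
   gives [ln d >= 10 ^ 5], on which the numerical estimates rest. *)
exists 2000, (expR (10 ^+ 5)); split; first by lra.
split; first exact: expR_gt0.
move=> d L lambda rho hd L4 oL lambda0 lambda_big rho0 small entropy_bound.
have l_big : 10 ^+ 5 <= ln (d%:R : R).
  have d0 : 0 < d%:R :> R by apply: lt_le_trans hd; exact: expR_gt0.
  by rewrite -ler_expR lnK ?posrE.
have lam2 : 4 * 10 ^+ 6 * (ln (d%:R : R) * kappa R d) <= lambda ^+ 2.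
  rewrite -(powR_kappa l_big) (_ : 4 * 10 ^+ 6 = 2000 ^+ 2); last by lra.
  rewrite -exprMn mulrA lerXn2r ?nnegrE ?(ltW lambda0) //.
  by rewrite !mulr_ge0 ?powR_ge0.
have d0 := d_gt0 l_big.
have s2 : (d%:R `^ (1 / 2)) ^+ 2 = d%:R :> R.
  rewrite -powR_mulrn ?powR_ge0 // -powRrM (_ : 1 / 2 * 2%:R = 1 :> R); last by field.
  by rewrite powRr1 // ltW.
have := balanced_bound L4 oL l_big lambda0 lam2 rho0 (powR_gt0 _ d0) s2 small entropy_bound.
pose G := torus_graph d L4 oL.
have Z0 : 0 < partition_fun G lambda.
  by apply: lt_le_trans (partition_ge d L4 oL lambda0); rewrite exprn_gt0 // addr_gt0.
have eI : independent (@torus_adj L d) =1 (fun I : {set G} => stable I).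
  exact: independent_stable.
have eZ : hc_partition (@torus_adj L d) lambda = partition_fun G lambda.
  by apply: eq_bigl => I; rewrite inE eI.
rewrite -ler_pdivrMr // /hc_measure eZ mulr_suml /rate mulrA; apply: le_trans.
rewrite le_eqVlt; apply/orP; left; apply/eqP; apply: eq_bigl => I.
rewrite !inE eI -evensC -evens_class.
have hN := card_evensR L4 oL l_big.
rewrite [X in _ <= X](_ : _ = rho * #|evens d L4 oL|%:R); last by rewrite -hN; field.
by rewrite andbC andbA andbb.
Qed.
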